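(* Let $G=\mathrm{Heis}(\mathbb{R}^2,\omega)$ be the $3$-dimensional (simply connected) Heisenberg group, whose Lie algebra $\mathfrak{g}$ has a basis $P,Q,Z$ with $[P,Q]=Z$, $[P,Z]=[Q,Z]=0$, and let $\tau$ be the involution with $\tau(Q)=Q$, $\tau(P)=-P$, $\tau(Z)=-Z$. Every unitary representation $(\pi^c,\mathcal{H})$ of $G$ (identified with its $c$-dual group $G^c$) with $-i\,\mathtt{d}\pi^c(Z)\ge0$ has a euclidean realization.
   Context: A reflection positive Hilbert space is a triple $(\mathcal{E},\mathcal{E}_+,\theta)$, where $\mathcal{E}$ is a complex Hilbert space, $\theta$ a unitary involution on $\mathcal{E}$ and $\mathcal{E}_+\subseteq\mathcal{E}$ a closed subspace with $\langle\theta v,v\rangle\ge0$ for $v\in\mathcal{E}_+$. $\widehat{\mathcal{E}}$ is the Hilbert completion of $\mathcal{E}_+/\{v\in\mathcal{E}_+:\langle\theta v,v\rangle=0\}$ with respect to $\|\widehat v\|=\sqrt{\langle\theta v,v\rangle}$, $q:\mathcal{E}_+\to\widehat{\mathcal{E}}$, $v\mapsto\widehat v$, is the canonical map, and for an operator $T$ on $\mathcal{E}_+$ preserving the null space of $q$ (on its domain), $\widehat T$ is defined by $\widehat T\widehat v=\widehat{Tv}$. Let $(G,H,\tau)$ be a symmetric Lie group ($\tau$ an involutive automorphism of the Lie group $G$, $H$ an open subgroup of $G^\tau$), with $\mathfrak{g}=\mathfrak{h}\oplus\mathfrak{q}$ the decomposition of its Lie algebra into $\pm1$-eigenspaces of $\tau$;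 $\mathfrak{g}^c=\mathfrak{h}\oplus i\mathfrak{q}\subseteq\mathfrak{g}_{\mathbb{C}}$ and $G^c$ is the simply connected Lie group with Lie algebra $\mathfrak{g}^c$. A unitary representation $\pi$ of $G$ on $\mathcal{E}$ (with derived representation $\mathtt{d}\pi$ on the space $\mathcal{E}^\infty$ of smooth vectors) is reflection positive on $(\mathcal{E},\mathcal{E}_+,\theta)$ if (RP1) $\pi(\tau(g))=\theta\pi(g)\theta$ for $g\in G$; (RP2) $\pi(h)\mathcal{E}_+=\mathcal{E}_+$ for $h\in H$; (RP3) there is a subspace $\mathcal{D}\subseteq\mathcal{E}_+\cap\mathcal{E}^\infty$, dense in $\mathcal{E}_+$, with $\mathtt{d}\pi(x)\mathcal{D}\subseteq\mathcal{D}$ for all $x\in\mathfrak{q}$. Then $h\mapsto\widehat{\pi(h)}$ is a unitary representation of $H$ on $\widehat{\mathcal{E}}$, and on the dense subspace $\widehat{\mathcal{D}}=q(\mathcal{D})$ one has the operators $\beta(x+iy):=\widehat{\mathtt{d}\pi(x)}-i\,\widehat{\mathtt{d}\pi(y)}$, $x\in\mathfrak{h}$, $y\in\mathfrak{q}$. If this infinitesimally unitary representation $\beta$ of $\mathfrak{g}^c$ integrates to a unitary representation $\pi^c$ of $G^c$ on $\widehat{\mathcal{E}}$ (so that $\mathtt{d}\pi^c(z)$ extends $\beta(z)$ for $z\in\mathfrak{g}^c$), compatible with the representation $h\mapsto\widehat{\pi(h)}$ of $H$, then $(\pi,\mathcal{E})$ is called a euclidean realization of $(\pi^c,\widehat{\mathcal{E}})$,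 and of every unitary representation of $G^c$ unitarily equivalent to it. For the Heisenberg group: $H=G^\tau=\exp(\mathbb{R}Q)$, $\mathfrak{h}=\mathbb{R}Q$, $\mathfrak{q}=\mathbb{R}P+\mathbb{R}Z$, and the Lie algebra isomorphism $\mathfrak{g}\to\mathfrak{g}^c$, $Q\mapsto Q$, $P\mapsto iP$, $Z\mapsto iZ$, is used to identify $G^c$ with $G$. The condition $-i\,\mathtt{d}\pi^c(Z)\ge0$ says that $\pi^c(\exp tZ)=e^{itB}$ with $B\ge0$ self-adjoint. *)

(* Defs.v *)
From HB Require Import structures.
From mathcomp Require Import all_boot all_order all_algebra.
From mathcomp Require Import sesquilinear complex ring.
From mathcomp Require Import all_classical all_reals all_analysis.

Set Implicit Arguments.
Unset Strict Implicit.
Unset Printing Implicit Defensive.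

Import Order.TTheory GRing.Theory Num.Theory.
Import numFieldNormedType.Exports.

Local Open Scope classical_set_scope.
Local Open Scope complex_scope.
Local Open Scope ring_scope.

(* The inner product is linear in its first argument. *)
Record hilbert (R : realType) := Hilbert {
  hcarrier :> completeNormedModType R[i];
  inner : {dot hcarrier for Num.conj};
  innerE : forall v : hcarrier, inner v v = `|v| ^+ 2
}.

Notation "''<' u , v >" := (inner _ u v)
  (at level 2, u at level 60, v at level 60, format "''<' u ,  v >")
  : ring_scope.

Definition is_isometry (R : realType) (E F : hilbert R) (U : E -> F) : Prop :=
  forall u v : E, '<U u, U v> = '<u, v>.

Definition is_unitary (R : realType) (E F : hilbert R) (U : {linear E -> F})
    : Prop :=
  is_isometry U /\ (forall w : F, exists v : E, U v = w).

Definition is_subspace (R : realType) (E : hilbert R) (A : set E) : Prop :=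
  submod_closed [in A].

Section Heisenberg.
Variable K : numFieldType.

(* The triple (p, q, z) stands for p P + q Q + z Z.  For the field of real
   numbers this is g, for the field of complex numbers it is g_C. *)
Definition heis : normedModType K := ((K^o * K^o) * K^o)%type : normedModType K.

Definition heis_mk (p q z : K) : heis := ((p, q), z).

Definition coordP (x : heis) : K := x.1.1.
Definition coordQ (x : heis) : K := x.1.2.
Definition coordZ (x : heis) : K := x.2.

Definition basisP : heis := heis_mk 1 0 0.
Definition basisQ : heis := heis_mk 0 1 0.
Definition basisZ : heis := heis_mk 0 0 1.

Definition bracket (x y : heis) : heis :=
  (coordP x * coordQ y - coordQ x * coordP y) *: basisZ.

(* The simply connected group G with Lie algebra g, in exponential coordinates:
   its elements are those of g, exp is the identity map (so exp (t x) is written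
   t *: x below), and the product is the Baker-Campbell-Hausdorff product. *)
Definition heis_mul (x y : heis) : heis := x + y + 2^-1 *: bracket x y.

(* In these coordinates the involution of G and its derivative, the involution
   of g, are given by the same formula. *)
Definition tau (x : heis) : heis := heis_mk (- coordP x) (coordQ x) (- coordZ x).

(* h, and also the subgroup H = G^tau of G *)
Definition fix_tau : set heis := [set x | tau x = x].

(* q *)
Definition antifix_tau : set heis := [set x | tau x = - x].

Lemma heis_eq (x y : heis) :
  coordP x = coordP y -> coordQ x = coordQ y -> coordZ x = coordZ y -> x = y.
Proof.
case: x y => [[p q] z] [[p' q'] z'].
by rewrite /coordP /coordQ /coordZ /= => -> -> ->.
Qed.

Lemma bracketPQ : bracket basisP basisQ = basisZ.
Proof. by rewrite /bracket /coordP /coordQ /= !mulr1 mulr0 subr0 scale1r. Qed.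

Lemma bracketPZ : bracket basisP basisZ = 0.
Proof. by rewrite /bracket /coordP /coordQ /= ?(mulr0, mul0r) subr0 scale0r. Qed.

Lemma bracketQZ : bracket basisQ basisZ = 0.
Proof. by rewrite /bracket /coordP /coordQ /= ?(mulr0, mul0r) subr0 scale0r. Qed.

Lemma heis_mulA (x y z : heis) :
  heis_mul x (heis_mul y z) = heis_mul (heis_mul x y) z.
Proof.
case: x y z => [[p q] z] [[p' q'] z'] [[p'' q''] z''].
apply: heis_eq; rewrite /heis_mul /bracket /coordP /coordQ /coordZ /=;
  rewrite /GRing.scale /=; ring.
Qed.

Lemma heis_mul0 (x : heis) : heis_mul x 0 = x.
Proof.
by rewrite /heis_mul /bracket /coordP /coordQ /= !mulr0 subr0 scale0r scaler0 !addr0.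
Qed.

Lemma heis_mulN (x : heis) : heis_mul x (- x) = 0.
Proof.
rewrite /heis_mul /bracket /coordP /coordQ /= subrr add0r.
by rewrite !mulrN mulrC subrr scale0r scaler0.
Qed.

Lemma heis_mulZ (s t : K) (x : heis) :
  heis_mul (s *: x) (t *: x) = (s + t) *: x.
Proof.
case: x => [[p q] z].
apply: heis_eq; rewrite /heis_mul /bracket /coordP /coordQ /coordZ /=;
  rewrite /GRing.scale /=; ring.
Qed.

Lemma tau_mul (x y : heis) : tau (heis_mul x y) = heis_mul (tau x) (tau y).
Proof.
case: x y => [[p q] z] [[p' q'] z'].
apply: heis_eq; rewrite /tau /heis_mul /bracket /coordP /coordQ /coordZ /=;
  rewrite /GRing.scale /=; ring.
Qed.

End Heisenberg.

Section CDual.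
Variable R : realType.

Definition re_part (w : heis R[i]) : heis R :=
  heis_mk (complex.Re (coordP w)) (complex.Re (coordQ w)) (complex.Re (coordZ w)).
Definition im_part (w : heis R[i]) : heis R :=
  heis_mk (complex.Im (coordP w)) (complex.Im (coordQ w)) (complex.Im (coordZ w)).

(* g^c = h + i q, a real Lie subalgebra of g_C *)
Definition gc : set (heis R[i]) :=
  [set w | fix_tau (re_part w) /\ antifix_tau (im_part w)].

(* The isomorphism of g with g^c, P |-> iP, Q |-> Q, Z |-> iZ, through which
   G^c is identified with G. *)
Definition to_gc (x : heis R) : heis R[i] :=
  heis_mk (0 +i* coordP x) (coordQ x)%:C (0 +i* coordZ x).

Lemma to_gc_linear (t : R) (x y : heis R) :
  to_gc (t *: x + y) = t%:C *: to_gc x + to_gc y.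
Proof.
case: x y => [[p q] z] [[p' q'] z'].
apply: heis_eq; rewrite /to_gc /coordP /coordQ /coordZ /=;
  rewrite /GRing.scale /=; simpc; by [].
Qed.

Lemma to_gc_bracket (x y : heis R) :
  to_gc (bracket x y) = bracket (to_gc x) (to_gc y).
Proof.
case: x y => [[p q] z] [[p' q'] z'].
apply: heis_eq; rewrite /to_gc /bracket /coordP /coordQ /coordZ /=;
  rewrite /GRing.scale /=; simpc; rewrite ?mulr0 ?mulr1 //.
Qed.

Lemma to_gc_inj : injective to_gc.
Proof. by move=> x y [eP eQ eZ]; apply: heis_eq. Qed.

Lemma range_to_gc : range to_gc = gc.
Proof.
apply/seteqP; split=> [_ [[[p q] z] _ <-]|[[[a b] [c d]] [e f]]].
  by split; apply: heis_eq; rewrite /coordP /coordQ /coordZ /= ?oppr0.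
have Npos (x : R) : - x = x -> x = 0.
  by move/eqP; rewrite eq_sym -subr_eq0 opprK -mulr2n mulrn_eq0 => /eqP.
case=> /= re_fix im_antifix.
have a0 : a = 0 by apply: Npos; exact: (congr1 (@coordP R) re_fix).
have e0 : e = 0 by apply: Npos; exact: (congr1 (@coordZ R) re_fix).
have d0 : d = 0.
  by apply: Npos; apply: esym; exact: (congr1 (@coordQ R) im_antifix).
by rewrite a0 d0 e0; exists (heis_mk b c f).
Qed.

End CDual.

Section Representations.
Variable R : realType.

(* The target is a complex space, so the real increment is cast to R[i]. *)
Definition diff_quot (E : hilbert R) (F : heis R -> E) (g x : heis R) (t : R)
    : E :=
  (t^-1)%:C *: (F (g + t *: x) - F g).

(* F is of class C^n on G: iterated directional derivatives in the global chart
   of G exist and are continuous. *)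
Fixpoint is_Cn (E : hilbert R) (n : nat) (F : heis R -> E) : Prop :=
  match n with
  | 0%N => continuous F
  | n'.+1 => continuous F /\
      forall x : heis R, exists F' : heis R -> E,
        (forall g, diff_quot F g x t @[t --> (0 : R)^'] --> F' g)
        /\ is_Cn n' F'
  end.

Definition is_smooth (E : hilbert R) (F : heis R -> E) : Prop :=
  forall n, is_Cn n F.

Record is_unitary_rep (E : hilbert R) (pi : heis R -> {linear E -> E}) : Prop := {
  rep_unitary : forall g, is_unitary (pi g);
  rep_mul : forall g h v, pi (heis_mul g h) v = pi g (pi h v);
  rep_cont : forall v, continuous (fun g => pi g v)
}.

Definition smooth_vectors (E : hilbert R) (pi : heis R -> {linear E -> E})
    : set E :=
  [set v | is_smooth (fun g => pi g v)].

Definition orbit_quot (E : hilbert R) (pi : heis R -> {linear E -> E})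
    (x : heis R) (v : E) (t : R) : E :=
  (t^-1)%:C *: (pi (t *: x) v - v).

(* The domain of the infinitesimal generator of t |-> pi (exp (t x)); it
   contains the smooth vectors. *)
Definition generator_dom (E : hilbert R) (pi : heis R -> {linear E -> E})
    (x : heis R) : set E :=
  [set v | cvg (orbit_quot pi x v t @[t --> (0 : R)^'])].

(* The generator itself, meaningful on generator_dom pi x only; its restriction
   to the smooth vectors is the operator of the derived representation. *)
Definition dpi (E : hilbert R) (pi : heis R -> {linear E -> E})
    (x : heis R) (v : E) : E :=
  lim (orbit_quot pi x v t @[t --> (0 : R)^']).

(* B = - i dpi(x) is, on the whole domain of the generator, the self-adjoint
   operator such that pi (exp (t x)) = e^{itB} (Stone); the condition is that
   B >= 0 as an unbounded operator.  The order of R[i] is the one for which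
   0 <= c means that c is real and nonnegative. *)
Definition nonneg_generator (E : hilbert R) (pi : heis R -> {linear E -> E})
    (x : heis R) : Prop :=
  forall v, generator_dom pi x v -> 0 <= '<(- 'i) *: dpi pi x v, v>.

Definition unitarily_equivalent (E F : hilbert R)
    (pi : heis R -> {linear E -> E}) (rho : heis R -> {linear F -> F}) : Prop :=
  exists U : {linear E -> F},
    is_unitary U /\ forall g v, U (pi g v) = rho g (U v).

End Representations.

Section ReflectionPositivity.
Variable R : realType.

Record rp_hilbert := RPHilbert {
  rp_space :> hilbert R;
  rp_plus : set rp_space;
  rp_theta : {linear rp_space -> rp_space};
  rp_plus_subspace : is_subspace rp_plus;
  rp_plus_closed : closed rp_plus;
  rp_theta_unitary : is_unitary rp_theta;
  rp_theta_invol : forall v, rp_theta (rp_theta v) = v;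
  rp_positive : forall v, rp_plus v -> 0 <= '<rp_theta v, v>
}.

(* (Ehat, q) is a Hilbert completion of E_+ / {v | <theta v, v> = 0} for the
   norm sqrt <theta v, v>, together with its canonical map.  The values of q
   outside of E_+ are irrelevant. *)
Record is_completion (E : rp_hilbert) (Ehat : hilbert R) (q : E -> Ehat)
    : Prop := {
  hat_linear : forall (a : R[i]) u v, rp_plus u -> rp_plus v ->
    q (a *: u + v) = a *: q u + q v;
  hat_inner : forall u v : E, rp_plus u -> rp_plus v ->
    '<q u, q v> = '<rp_theta E u, v>;
  hat_dense : dense (q @` @rp_plus E)
}.

(* pi is reflection positive, D being the dense subspace invariant under the
   derived representation of q. *)
Record is_rp_rep (E : rp_hilbert) (pi : heis R -> {linear E -> E}) (D : set E)
    : Prop := {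
  rp_rep : is_unitary_rep pi;
  rp1 : forall g v, pi (tau g) v = rp_theta E (pi g (rp_theta E v));
  rp2 : forall h, fix_tau h -> pi h @` @rp_plus E = @rp_plus E;
  rp3_subspace : is_subspace D;
  rp3_sub : D `<=` @rp_plus E `&` smooth_vectors pi;
  rp3_dense : @rp_plus E `<=` closure D;
  rp3_inv : forall x, antifix_tau x -> forall v, D v -> D (dpi pi x v)
}.

(* beta pi q w v is beta(w) (q v), for w = x + iy in g^c and v in D *)
Definition beta (E : rp_hilbert) (pi : heis R -> {linear E -> E})
    (Ehat : hilbert R) (q : E -> Ehat) (w : heis R[i]) (v : E) : Ehat :=
  q (dpi pi (re_part w) v) - 'i *: q (dpi pi (im_part w) v).

(* pic is a unitary representation of G^c (identified with G) which integrates
   beta and is compatible with the representation of H on Ehat. *)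
Record integrates (E : rp_hilbert) (pi : heis R -> {linear E -> E}) (D : set E)
    (Ehat : hilbert R) (q : E -> Ehat) (pic : heis R -> {linear Ehat -> Ehat})
    : Prop := {
  int_rep : is_unitary_rep pic;
  int_smooth : forall v, D v -> smooth_vectors pic (q v);
  int_extends : forall x v, D v -> dpi pic x (q v) = beta pi q (to_gc x) v;
  int_compat : forall h, fix_tau h ->
    forall v : E, rp_plus v -> pic h (q v) = q (pi h v)
}.

Definition has_euclidean_realization (H : hilbert R)
    (rho : heis R -> {linear H -> H}) : Prop :=
  exists (E : rp_hilbert) (pi : heis R -> {linear E -> E}) (D : set E)
         (Ehat : hilbert R) (q : E -> Ehat)
         (pic : heis R -> {linear Ehat -> Ehat}),
    [/\ is_rp_rep pi D,
        is_completion q,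
        integrates pi D q pic
      & unitarily_equivalent pic rho].

End ReflectionPositivity.

(* Main.v *)
From HB Require Import structures.
From mathcomp Require Import all_boot all_order all_algebra.
From mathcomp Require Import sesquilinear complex ring lra.
From mathcomp Require Import all_classical all_reals all_analysis.
Require Import Defs.

Set Implicit Arguments.
Unset Strict Implicit.
Unset Printing Implicit Defensive.

Import Order.TTheory GRing.Theory Num.Theory.
Import numFieldNormedType.Exports.

Local Open Scope classical_set_scope.
Local Open Scope complex_scope.
Local Open Scope ring_scope.

(** A representation [pic] on [H] is realized on a space of polynomials: the
    twisted form of two polynomials in a real variable, with coefficients in
    [H], is the inner product of their values at the imaginary unit.

    For real [x <> 0] the dilation [(p, q, z) |-> (x p, q, x z)] is an automorphism
    of [G], and for [x = -1] it is [tau].  Its formal value at [x = 'i] sends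
    [P, Q, Z] to [i P, Q, i Z], which is the passage from [g] to [g^c].  Let
    [x_n] be a sequence of real nodes, invariant under a fixed point free
    involution [swap] of the indices with [x_(swap n) = - x_n], and let [G] act
    on the square summable sequences in [H], in the [n]-th coordinate by [pic]
    after the dilation by [x_n].  Permuting the coordinates by [swap] is a
    unitary involution [theta] that intertwines [pi g] and [pi (tau g)].

    Let [w_n] be complex weights, decaying faster than any power of the node,
    whose twisted moments are those of the point mass at [-'i]: the sum of
    [w_(swap n) * w_n^* * x_n ^ j] is [(- 'i) ^ j] for every [j].  The space
    [E_+] is the closed span of the sequences [mono j v], with [n]-th coordinate
    [w_n * x_n ^ j *: v].  On it [<theta f, g>] is by the moment condition the
    inner product of [q f] and [q g], where the bounded map [q] sends
    [mono j v] to ['i ^ j *: v], that is, evaluates the polynomial at ['i].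
    Hence the form is nonnegative on [E_+], and its completion is [H] with the
    quotient map [q] (lemmas [inner_theta], [q_surj]).

    If [v] is in the domain of the generator of [pic] along [P] or [Z], with
    value [w], then [mono j v] is in the domain of that of [pi], with value
    [mono j.+1 w]; along [Q] the value is [mono j w] (lemma [gen_mono]).  So
    [q] turns the generators of [pi] along [P] and [Z] into ['i] times those of
    [pic], and after the factor [- 'i] in the definition of [beta] one recovers
    the derived representation of [pic] (lemma [dpi_q]).  The invariant domain
    consists of polynomials whose coefficients lie in a dense subspace of [H]
    on which all words in the generators are defined.

    The realization rests on two constructions.  The first is the moment
    condition.  The coefficients of Euler's product
    [E z = (1 - z) (1 - z / 2) (1 - z / 4) ...] decay faster than any geometric
    sequence, and [E] vanishes at all powers [2 ^ j] but not at [1 / 2]; this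
    gives signed masses at [2 ^ n.+1 - 1] whose moments are those of the point
    mass at [-1] (lemma [mass_moment]), and the nodes are the square roots
    [+- sqrt (2 ^ n.+1 - 1)].  The second is the density of the subspace on
    which all words in the generators are defined: it contains the vectors
    smeared with smooth functions along [Z], then [P], then [Q] (lemma
    [garding_vector]), where the integrals are limits of Riemann sums.  That vectors of invariant subspaces have smooth orbit
    maps is lemma [smooth_of_invariant]. *)

(** * Real-valued norms over the complex numbers *)

Section RealNorm.
Variables (R : realType) (V : normedZmodType R[i]).
Implicit Types v w : V.

(** The norm of a space over [R[i]] takes values in [R[i]]; estimates are made
    with its real part. *)
Definition nrm v : R := complex.Re `|v|.

Lemma nrmE v : `|v| = (nrm v)%:C.
Proof.
by rewrite /nrm; have := normr_ge0 v; case: `|v| => a b; rewrite lecE /= => /andP[/eqP->].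
Qed.

Lemma nrm_ge0 v : 0 <= nrm v.
Proof. by have := normr_ge0 v; rewrite nrmE ler0c. Qed.

Lemma nrm0 : nrm (0 : V) = 0.
Proof. by rewrite /nrm normr0. Qed.

Lemma nrm_eq0 v : nrm v = 0 -> v = 0.
Proof. by move=> h; apply: normr0_eq0; rewrite nrmE h. Qed.

Lemma nrmN v : nrm (- v) = nrm v.
Proof. by rewrite /nrm normrN. Qed.

Lemma nrmB v w : nrm (v - w) = nrm (w - v).
Proof. by rewrite /nrm distrC. Qed.

Lemma nrmD v w : nrm (v + w) <= nrm v + nrm w.
Proof. by have := ler_normD v w; rewrite !nrmE -rmorphD lecR. Qed.

Lemma nrm_sum I (r : seq I) (P : pred I) (F : I -> V) :
  nrm (\sum_(i <- r | P i) F i) <= \sum_(i <- r | P i) nrm (F i).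
Proof.
elim/big_rec2: _ => [|i x y _ le]; first by rewrite nrm0.
by apply: le_trans (nrmD _ _) _; rewrite lerD2l.
Qed.

Lemma nrm_lip v w : `|nrm v - nrm w| <= nrm (v - w).
Proof.
rewrite ler_norml; apply/andP.
have := nrmD (v - w) w; have := nrmD (w - v) v; rewrite !subrK (nrmB w v); lra.
Qed.

Lemma nrm_le_tri u v w : nrm (u - w) <= nrm (u - v) + nrm (v - w).
Proof. by apply: le_trans (nrmD _ _); rewrite addrA subrK. Qed.

End RealNorm.

Lemma nrmZ (R : realType) (V : normedModType R[i]) (a : R[i]) (v : V) :
  nrm (a *: v) = nrm a * nrm v.
Proof. by rewrite /nrm normrZ !nrmE -rmorphM. Qed.

Lemma nrmM (R : realType) (a b : R[i]) : nrm (a * b) = nrm a * nrm b.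
Proof. by rewrite /nrm normrM !nrmE -rmorphM. Qed.

Lemma nrm_real (R : realType) (a : R) : nrm (a%:C) = `|a|.
Proof. by rewrite /nrm normc_def /= expr0n addr0 sqrtr_sqr. Qed.

Lemma nrmZr (R : realType) (V : normedModType R[i]) (a : R) (v : V) :
  nrm (a%:C *: v) = `|a| * nrm v.
Proof. by rewrite nrmZ nrm_real. Qed.

Lemma nrmX (R : realType) (a : R[i]) n : nrm (a ^+ n) = nrm a ^+ n.
Proof.
elim: n => [|n ih]; first by rewrite !expr0 -(rmorph1 (real_complex R)) nrm_real normr1.
by rewrite !exprS nrmM ih.
Qed.

Lemma nrm_conj (R : realType) (a : R[i]) : nrm (Num.conj a) = nrm a.
Proof. by rewrite /nrm norm_conjC. Qed.

Section RealNormTopology.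
Variables (R : realType) (V : normedModType R[i]).

Lemma cvg_nrmP (T : Type) (F : set_system T) (FF : Filter F) (f : T -> V) (l : V) :
  f x @[x --> F] --> l <->
  (forall e : R, 0 < e -> \forall x \near F, nrm (f x - l) <= e).
Proof.
split=> [/cvgrPdist_le h e e0|h].
  have e0' : (0 : R[i]) < e%:C by rewrite ltcR.
  by have := h _ e0'; apply: filterS => x; rewrite distrC nrmE lecR.
apply/cvgrPdist_le => -[a b]; rewrite ltcE /= => /andP[/eqP-> a0].
by have := h _ a0; apply: filterS => x; rewrite distrC nrmE lecR.
Qed.

Lemma filter_nrm_cvg (F : set_system V) (FF : Filter F) (l : V) :
  (forall e : R, 0 < e -> \forall x \near F, nrm (x - l) <= e) -> F --> l.
Proof. by move=> h; exact/(@cvg_nrmP _ F FF idfun l). Qed.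

Lemma cvg_nrm (T : Type) (F : set_system T) (FF : Filter F) (f : T -> V) (l : V) :
  f x @[x --> F] --> l -> nrm (f x) @[x --> F] --> nrm l.
Proof.
move=> /cvg_nrmP h; apply/cvgrPdist_le => /= e e0; have := h e e0.
apply: filterS => x; rewrite nrmB; apply: le_trans; exact: nrm_lip.
Qed.

Lemma nrm_le_cvg (T : Type) (F : set_system T) (FF : ProperFilter F) (f : T -> V)
    (l v : V) (M : R) :
  f x @[x --> F] --> l -> (\forall x \near F, nrm (f x - v) <= M) -> nrm (l - v) <= M.
Proof.
move=> fl; apply: cvgr_to_le.
apply: cvg_nrm; apply: cvgB => //; exact: cvg_cst.
Qed.

Lemma cauchy_nrmP (F : set_system V) (FF : Filter F) : cauchy F <->
  (forall e : R, 0 < e -> exists A : set V,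
    F A /\ forall x y, A x -> A y -> nrm (x - y) <= e).
Proof.
split=> [/cauchy_ballP Fc e e0|h].
  have e0' : (0 : R[i]) < (e / 2)%:C by rewrite ltcR divr_gt0.
  have [/= [A B] [/= FA FB]] := Fc _ e0'; rewrite -ball_normE => AB.
  exists (A `&` B); split=> [|x y [Ax Bx] [Ay By]]; first exact: filterI.
  have := AB (x, y) (conj Ax By); rewrite /= nrmE ltcR => /ltW/le_trans; apply.
  by rewrite ler_pdivrMr // ler_peMr ?(ltW e0) // ler1n.
apply/cauchy_ballP => -[e e']; rewrite ltcE /= => /andP[/eqP-> e0].
have [A [FA hA]] := h (e / 2) (divr_gt0 e0 (ltr0Sn _ _)).
exists (A, A) => //= -[x y] [/= Ax Ay]; rewrite -ball_normE /= nrmE ltcR.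
by apply: le_lt_trans (hA _ _ Ax Ay) _; rewrite ltr_pdivrMr // ltr_pMr // ltr1n.
Qed.

End RealNormTopology.

(** ** Completeness *)

Section ComplexComplete.
Variable R : realType.

Lemma nrm_ge_Re (a : R[i]) : `|complex.Re a| <= nrm a.
Proof. by have := normc_ge_Re a; rewrite nrmE lecR. Qed.

Lemma nrm_ge_Im (a : R[i]) : `|complex.Im a| <= nrm a.
Proof.
have -> : complex.Im a = - complex.Re (a * 'i%C) by rewrite ReiNIm opprK.
rewrite normrN (le_trans (nrm_ge_Re _)) // nrmM [nrm 'i%C]/nrm normc_def /=.
by rewrite expr0n expr1n add0r sqrtr1 mulr1.
Qed.

Lemma nrm_le_ReIm (a : R[i]) : nrm a <= `|complex.Re a| + `|complex.Im a|.
Proof.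
rewrite {1}[a]complexE (le_trans (nrmD _ _)) // nrmM !nrm_real lerD2l.
by rewrite [nrm 'i%C]/nrm normc_def /= expr0n expr1n add0r sqrtr1 mul1r.
Qed.

(** The real and imaginary parts of a Cauchy filter are Cauchy filters of real
    numbers. *)
Lemma complex_complete (F : set_system (R[i]^o : normedModType R[i])) :
  ProperFilter F -> cauchy F -> cvg F.
Proof.
move=> FF /cauchy_nrmP Fc.
have part (p : R[i]^o -> R) :
    (forall a b, `|p a - p b| <= nrm (a - b)) -> cvg (p x @[x --> F]).
  move=> pl; apply: cauchy_cvg; apply/cauchy_ballP => e e0.
  have [A [FA hA]] := Fc (e / 2) (divr_gt0 e0 (ltr0Sn _ _)).
  exists (p @` A, p @` A) => /=.
    have FpA : F (p @^-1` (p @` A)) by apply: filterS FA => x Ax; exists x.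
    by split.
  case=> _ _ [/= [x Ax <-] [y Ay <-]]; rewrite -ball_normE /=.
  apply: le_lt_trans (le_trans (pl _ _) (hA _ _ Ax Ay)) _.
  by rewrite ltr_pdivrMr // ltr_pMr // ltr1n.
have /cvg_ex[a ha] : cvg (complex.Re x @[x --> F]).
  apply: part => x y; apply: le_trans (nrm_ge_Re _).
  by case: x y => [? ?] [? ?].
have /cvg_ex[b hb] : cvg (complex.Im x @[x --> F]).
  apply: part => x y; apply: le_trans (nrm_ge_Im _).
  by case: x y => [? ?] [? ?].
apply: (@cvgP _ F (a +i* b : R[i]^o)); apply: filter_nrm_cvg => e e0.
have e2 : 0 < e / 2 by rewrite divr_gt0.
move: ha hb => /cvgrPdist_le/(_ _ e2) ha /cvgrPdist_le/(_ _ e2) hb.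
near=> x; apply: le_trans (nrm_le_ReIm _) _.
rewrite (splitr e) lerD //.
  have : `|a - complex.Re x| <= e / 2 by near: x; exact: ha.
  by rewrite distrC; congr (_ <= _); congr `|_|; move: (x) => [].
have : `|b - complex.Im x| <= e / 2 by near: x; exact: hb.
by rewrite distrC; congr (_ <= _); congr `|_|; move: (x) => [].
Unshelve. all: by end_near. Qed.

(** The complex numbers as a complete normed space over themselves, so that the
    theory of vector-valued series applies to scalar ones. *)
Definition scalars : Type := R[i].
HB.instance Definition _ := NormedModule.copy scalars (R[i]^o).
HB.instance Definition _ := Uniform_isComplete.Build scalars complex_complete.

End ComplexComplete.

(** * Absolutely convergent series *)

Definition asum (R : realType) (V : normedZmodType R[i]) (u : nat -> V) : Prop :=
  exists M : R, forall N, \sum_(0 <= n < N) nrm (u n) <= M.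

Section AbsoluteSeries.
Variables (R : realType) (V : completeNormedModType R[i]).
Implicit Types u v : nat -> V.

Lemma nonneg_series_cvg (b : nat -> R) (M : R) : (forall n, 0 <= b n) ->
  (forall N, \sum_(0 <= n < N) b n <= M) -> cvgn (series b).
Proof.
move=> b0 bM; apply: nondecreasing_is_cvgn.
  by apply: nondecreasing_series => n _ _; exact: b0.
exists M; move=> _ [N _ <-]; exact: bM.
Qed.

Lemma nonneg_series_tail (b : nat -> R) (M : R) : (forall n, 0 <= b n) ->
  (forall N, \sum_(0 <= n < N) b n <= M) ->
  forall e : R, 0 < e -> exists K, forall N, \sum_(K <= n < N) b n <= e.
Proof.
move=> b0 bM e e0.
have /cvg_ex[/= l hl] := nonneg_series_cvg b0 bM.
have le_l N : \sum_(0 <= n < N) b n <= l.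
  rewrite -(cvg_lim (@Rhausdorff R) hl).
  have := @nondecreasing_cvgn_le _ (series b); rewrite seriesEnat; apply.
    by move=> m n mn /=; rewrite [leRHS](@big_cat_nat _ _ _ m) //= lerDl sumr_ge0.
  by apply/cvg_ex; exists l; rewrite -seriesEnat.
move: hl => /cvgrPdist_le/(_ _ e0)[K _ hK]; exists K => N.
have [NK|KN] := leqP N K; first by rewrite big_geq // ltW.
have := hK K (leqnn K); rewrite seriesEnat /= => hKe.
have := le_l N; rewrite (@big_cat_nat _ _ _ K) //= ?(ltnW KN) // => h.
by move: hKe; rewrite ler_norml => /andP[_]; lra.
Qed.

(** Differences of partial sums are dominated by tails of the series of norms.
    *)
Lemma asum_cvg u : asum u -> cvgn (series u).
Proof.
case=> M uM; apply/cauchy_cvgP/cauchy_seriesP => -[e e'].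
rewrite ltcE /= => /andP[/eqP-> e0].
have e2 : 0 < e / 2 by rewrite divr_gt0.
have [K hK] := nonneg_series_tail (fun n => nrm_ge0 (u n)) uM e2.
exists ([set n | (K <= n)%N], setT) => /=.
  by split; [exists K|exact: filterT].
case=> m n /= [Km _]; rewrite nrmE ltcR.
apply: le_lt_trans (nrm_sum _ _ _) _.
apply: le_lt_trans (_ : _ <= e / 2) _; last by rewrite ltr_pdivrMr // ltr_pMr // ltr1n.
have [nm|mn] := leqP n m; first by rewrite big_geq // ltW.
apply: le_trans (hK n); rewrite [leRHS](@big_cat_nat _ _ _ m) //= ?(ltnW mn) //.
by rewrite lerDr sumr_ge0 // => *; exact: nrm_ge0.
Qed.

Definition vsum u : V := limn (series u).

Lemma vsumP u : asum u -> series u @ \oo --> vsum u.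
Proof. exact: asum_cvg. Qed.

Lemma vsum_lim u l : series u @ \oo --> l -> vsum u = l.
Proof. by move=> h; apply: cvg_lim h; exact: norm_hausdorff. Qed.

Lemma asumZ a u : asum u -> asum (fun n => a *: u n).
Proof.
move=> [M uM]; exists (nrm a * M) => N.
apply: le_trans (ler_wpM2l (nrm_ge0 _) (uM N)); rewrite mulr_sumr.
by apply: ler_sum => n _; rewrite nrmZ.
Qed.

Lemma vsumD u v : asum u -> asum v -> vsum (u \+ v) = vsum u + vsum v.
Proof. move=> /vsumP hu /vsumP hv; apply: vsum_lim.
by rewrite (_ : u \+ v = u + v) // seriesD; exact: cvgD. Qed.

Lemma vsumZ a u : asum u -> vsum (fun n => a *: u n) = a *: vsum u.
Proof. move=> /vsumP hu; apply: vsum_lim.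
by rewrite (_ : (fun n => a *: u n) = a *: u) // seriesZ; exact: cvgZr. Qed.

Lemma nrm_vsum_le u (M : R) :
  (forall N, \sum_(0 <= n < N) nrm (u n) <= M) -> nrm (vsum u) <= M.
Proof.
move=> uM; have := @vsumP u (ex_intro _ M uM).
move=> h; rewrite -(subr0 (vsum u)); apply: nrm_le_cvg h _.
apply: nearW => N; rewrite subr0 /=; apply: le_trans (uM N).
exact: nrm_sum.
Qed.

End AbsoluteSeries.

Section ScalarSeries.
Variable R : realType.

Lemma vsum_conj (u : nat -> scalars R) : asum u ->
  vsum (fun n => Num.conj (u n : R[i]) : scalars R) = Num.conj (vsum u : R[i]).
Proof.
move=> /vsumP us; apply: (@vsum_lim _ (scalars R)); apply/cvg_nrmP => e e0.
have /cvg_nrmP/(_ e e0) := us; apply: filterS => N.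
rewrite -[in nrm (_ - _ )]nrm_conj rmorphB; congr (nrm (_ - _) <= _).
by rewrite /= rmorph_sum.
Qed.

Lemma vsum_scalel (V : completeNormedModType R[i]) (u : nat -> scalars R) (v : V) :
  asum u -> vsum (fun n => (u n : R[i]) *: v) = (vsum u : R[i]) *: v.
Proof.
move=> /vsumP us; apply: vsum_lim.
have -> : series (fun n => (u n : R[i]) *: v) = (fun N => (series u N : R[i]) *: v).
  by apply/funext => N; rewrite /series /= scaler_suml.
exact: (@cvgZl _ V _ \oo _ _ _ _ us).
Qed.

End ScalarSeries.

(** * Inner products *)

Section DotForm.
Variables (C : numClosedFieldType) (U : lmodType C) (form : {dot U for Num.conj}).

(** Expand the square of the difference of [u] and its projection on the line
    of [v], which is nonnegative. *)
Lemma dot_cauchy_schwarz u v : `|form u v| ^+ 2 <= form u u * form v v.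
Proof.
have [->|v0] := eqVneq v 0.
  by rewrite (linear0r form u) (linear0r form 0) normr0 expr0n mulr0.
have vv0 : 0 < form v v by rewrite neq0_dnorm_gt0.
pose a := form u v / form v v.
have := dnorm_ge0 form (u - a *: v).
rewrite dnormB dnormZ linearZr_LR /= /a -mulrA.
have rv : Num.conj (form v v) = form v v by rewrite conj_Creal // ger0_real // ltW.
have e1 : Num.conj (form u v / form v v) * form u v = `|form u v| ^+ 2 / form v v.
  by rewrite rmorphM fmorphV /= rv mulrAC -normCKC.
rewrite e1 [Num.conj (_ / _)]rmorphM fmorphV /= rv rmorphXn /= conj_normC.
rewrite normf_div (ger0_norm (ltW vv0)).
have -> : `|form u v| / form v v * (`|form u v| / form v v * form v v)
    = `|form u v| ^+ 2 / form v v.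
  by field; rewrite gt_eqF.
rewrite opprD addrACA subrr addr0 subr_ge0 => h.
by rewrite -ler_pdivrMr.
Qed.

Lemma dot_triangle u v :
  sqrtC (form (u + v) (u + v)) <= sqrtC (form u u) + sqrtC (form v v).
Proof.
rewrite -(@ler_pXn2r _ 2) ?nnegrE ?addr_ge0 ?sqrtC_ge0 ?dnorm_ge0 //.
rewrite [leRHS]sqrrD !sqrtCK dnormD [leRHS]addrAC lerD2l.
apply: le_trans (_ : `|form u v| *+ 2 <= _).
  by rewrite mulr2n (le_trans (real_ler_norm _)) ?CrealE ?rmorphD /= ?conjCK
     1?addrC // (le_trans (ler_normD _ _)) // norm_conjC addrC.
rewrite lerMn2r /= -(@ler_pXn2r _ 2) ?nnegrE ?mulr_ge0 ?sqrtC_ge0 ?dnorm_ge0 //.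
by rewrite exprMn !sqrtCK dot_cauchy_schwarz.
Qed.

End DotForm.

Section HilbertInner.
Variables (R : realType) (H : hilbert R).
Implicit Types u v : H.

Lemma inner0l u : '<0, u> = 0 :> R[i].
Proof. exact: linear0l. Qed.

Lemma inner0r u : '<u, 0> = 0 :> R[i].
Proof. exact: linear0r. Qed.

Lemma innerDl u v w : '<u + v, w> = '<u, w> + '<v, w> :> R[i].
Proof. exact: linearDl. Qed.
Lemma innerDr u v w : '<u, v + w> = '<u, v> + '<u, w> :> R[i].
Proof. exact: linearDr. Qed.
Lemma innerBl u v w : '<u - v, w> = '<u, w> - '<v, w> :> R[i].
Proof. exact: linearBl. Qed.
Lemma innerBr u v w : '<u, v - w> = '<u, v> - '<u, w> :> R[i].
Proof. exact: linearBr. Qed.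
Lemma innerZl (a : R[i]) u v : '<a *: u, v> = a * '<u, v>.
Proof. by rewrite linearZl_LR. Qed.
Lemma innerZr (a : R[i]) u v : '<u, a *: v> = Num.conj a * '<u, v>.
Proof. by rewrite linearZr_LR. Qed.
Lemma innerC u v : '<u, v> = Num.conj '<v, u> :> R[i].
Proof. by rewrite hermC mul1r. Qed.

Lemma inner_nrm u : '<u, u> = (nrm u ^+ 2)%:C.
Proof. by rewrite innerE nrmE rmorphXn. Qed.

Lemma nrm_inner u v : nrm '<u, v> <= nrm u * nrm v.
Proof.
rewrite -(@ler_pXn2r _ 2) ?nnegrE ?mulr_ge0 ?nrm_ge0 // exprMn.
have := dot_cauchy_schwarz (inner H) u v.
by rewrite !inner_nrm nrmE -rmorphXn -rmorphM lecR.
Qed.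

End HilbertInner.

Lemma isometry_nrm (R : realType) (E F : hilbert R) (U : E -> F) :
  is_isometry U -> forall v, nrm (U v) = nrm v.
Proof.
move=> iU v; apply/eqP; rewrite -(@eqrXn2 _ 2) ?nrm_ge0 //; apply/eqP.
by have := iU v v; rewrite !inner_nrm => -[].
Qed.

(** * Square summable sequences in a Hilbert space *)

Definition square_summable (R : realType) (V : normedZmodType R[i]) (f : nat -> V) :=
  exists M : R, forall N, \sum_(0 <= n < N) nrm (f n) ^+ 2 <= M.

Section SquareSummable.
Variables (R : realType) (H : hilbert R).

Definition sqsum : {pred nat -> H} :=
  fun f => `[< square_summable f >].

Lemma nrmD_sq (V : normedZmodType R[i]) (u v : V) :
  nrm (u + v) ^+ 2 <= 2 * nrm u ^+ 2 + 2 * nrm v ^+ 2.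
Proof.
have h := nrmD u v; have h0 := nrm_ge0 (u + v).
apply: le_trans (_ : (nrm u + nrm v) ^+ 2 <= _).
  by rewrite ler_pXn2r ?nnegrE ?addr_ge0 ?nrm_ge0.
have := sqr_ge0 (nrm u - nrm v); nra.
Qed.

Lemma sqsum_submod : submod_closed sqsum.
Proof.
split; first by apply/asboolP; exists 0 => N; rewrite big1 // => n _; rewrite nrm0 expr0n.
move=> a f g /asboolP[M fM] /asboolP[L gL]; apply/asboolP.
exists (2 * (nrm a ^+ 2 * M) + 2 * L) => N.
apply: le_trans (_ : \sum_(0 <= n < N)
    (2 * (nrm a ^+ 2 * nrm (f n) ^+ 2) + 2 * nrm (g n) ^+ 2) <= _).
  by apply: ler_sum => n _; rewrite (le_trans (nrmD_sq _ _)) // nrmZ exprMn.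
rewrite big_split /= -!mulr_sumr lerD // ler_pM2l // ler_wpM2l //.
by rewrite exprn_ge0 // nrm_ge0.
Qed.

HB.instance Definition _ := GRing.isSubmodClosed.Build R[i] (nat -> H) sqsum sqsum_submod.

Record l2 := L2 { l2_fun :> nat -> H; _ : l2_fun \in sqsum }.

HB.instance Definition _ := [isSub for l2_fun].
HB.instance Definition _ := [Choice of l2 by <:].
HB.instance Definition _ := [SubChoice_isSubLmodule of l2 by <:].

Lemma l2_eq (f g : l2) : (forall n, f n = g n) -> f = g.
Proof. by move=> h; apply/val_inj/funext. Qed.

Lemma l2_sqsum (f : l2) : square_summable f.
Proof. exact/asboolP/(valP f). Qed.

Definition l2_inner (f g : l2) : R[i] :=
  vsum (fun n => '<f n, g n> : scalars R).

Lemma asum_inner (f g : l2) :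
  asum (fun n => '<f n, g n> : scalars R).
Proof.
have [M fM] := l2_sqsum f; have [L gL] := l2_sqsum g.
exists (M + L) => N; apply: le_trans (lerD (fM N) (gL N)).
rewrite -big_split; apply: ler_sum => n _ /=; apply: le_trans (nrm_inner _ _) _.
have := sqr_ge0 (nrm (f n) - nrm (g n)).
have := sqr_ge0 (nrm (f n)); have := sqr_ge0 (nrm (g n)); nra.
Qed.

Lemma l2_inner_Pl (a : R[i]) (f f' g : l2) :
  l2_inner (a *: f + f') g = a * l2_inner f g + l2_inner f' g.
Proof.
rewrite /l2_inner -[RHS]/(a *: (vsum _ : scalars R) + _ : scalars R) -vsumZ -?vsumD; first last.
- exact: asum_inner.
- exact: asum_inner.
- exact: (@asumZ _ (scalars R) a _ (asum_inner f g)).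
by apply: (congr1 (@vsum _ (scalars R))); apply/funext => n; rewrite /= innerDl innerZl.
Qed.

Lemma l2_innerC (f g : l2) : l2_inner f g = Num.conj (l2_inner g f).
Proof.
rewrite /l2_inner -vsum_conj; last exact: asum_inner.
by apply: (congr1 (@vsum _ (scalars R))); apply/funext => n; rewrite [LHS]innerC.
Qed.

Definition l2_sq (f : l2) : R := limn (series (fun n => nrm (f n) ^+ 2)).

Lemma l2_sq_cvg (f : l2) : series (fun n => nrm (f n) ^+ 2) @ \oo --> l2_sq f.
Proof.
have [M fM] := l2_sqsum f; apply: nonneg_series_cvg fM => n.
by rewrite exprn_ge0 // nrm_ge0.
Qed.

Lemma l2_sq_ge (f : l2) N : \sum_(0 <= n < N) nrm (f n) ^+ 2 <= l2_sq f.
Proof.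
have h : cvgn (series (fun n => nrm (f n) ^+ 2)) by exact: l2_sq_cvg.
apply: (nondecreasing_cvgn_le _ h N).
by apply: nondecreasing_series => n _ _; rewrite exprn_ge0 // nrm_ge0.
Qed.

Lemma l2_inner_sq (f : l2) : l2_inner f f = (l2_sq f)%:C.
Proof.
apply: (@vsum_lim _ (scalars R)); apply/cvg_nrmP => e e0.
have /cvgrPdist_le/(_ e e0) := @l2_sq_cvg f; apply: filterS => N.
rewrite distrC -nrm_real rmorphB; congr (nrm (_ - _) <= _).
by rewrite /= rmorph_sum; apply: eq_bigr => n _; rewrite inner_nrm.
Qed.

Lemma l2_inner_gt0 (f : l2) : f != 0 -> 0 < l2_inner f f.
Proof.
move=> f0; rewrite l2_inner_sq ltcR.
have [n fn] : exists n, f n != 0.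
  apply/not_existsP => h; move/eqP: f0; apply; apply: l2_eq => n.
  by apply/eqP; have /negP := h n; rewrite negbK.
apply: lt_le_trans (l2_sq_ge f n.+1).
rewrite big_nat_recr //= ltr_wpDl ?sumr_ge0 //; first by move=> *; rewrite exprn_ge0 ?nrm_ge0.
rewrite exprn_gt0 // lt_neqAle nrm_ge0 andbT eq_sym.
by apply: contraNneq fn => /nrm_eq0 ->.
Qed.

Lemma l2_inner_bilin : bilinear_for
  (GRing.Scale.Law.clone _ _ *%R _) (GRing.Scale.Law.clone _ _ (Num.conj \; *%R) _)
  l2_inner.
Proof.
split=> [g a f f'|f a g g']; first exact: l2_inner_Pl.
by rewrite l2_innerC l2_inner_Pl rmorphD rmorphM /= -!l2_innerC.
Qed.

HB.instance Definition _ := bilinear_isBilinear.Build R[i] l2 l2 R[i]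
  *%R (Num.conj \; *%R) l2_inner l2_inner_bilin.
Lemma l2_inner_herm (f g : l2) : l2_inner f g = (-1) ^+ false * Num.conj (l2_inner g f).
Proof. by rewrite mul1r -l2_innerC. Qed.
HB.instance Definition _ :=
  isHermitianSesquilinear.Build R[i] l2 false Num.conj l2_inner l2_inner_herm.
HB.instance Definition _ := isDotProduct.Build R[i] l2 l2_inner l2_inner_gt0.

Definition l2_norm (f : l2) : R[i] := sqrtC (l2_inner f f).

Lemma l2_normD f g : l2_norm (f + g) <= l2_norm f + l2_norm g.
Proof. exact: (dot_triangle l2_inner). Qed.

Lemma l2_normZ a f : l2_norm (a *: f) = `|a| * l2_norm f.
Proof. by rewrite /l2_norm (dnormZ l2_inner) sqrtCM ?nnegrE ?exprn_ge0 ?dnorm_ge0 // sqrCK. Qed.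

Lemma l2_norm_eq0 f : l2_norm f = 0 -> f = 0.
Proof. by move/eqP; rewrite (sqrt_dnorm_eq0 l2_inner) => /eqP. Qed.

HB.instance Definition _ := Lmodule_isNormed.Build R[i] l2 l2_normD l2_normZ l2_norm_eq0.

Lemma l2_nrm_sq (f : l2) : nrm f ^+ 2 = l2_sq f.
Proof.
apply: complexI; rewrite rmorphXn /= -nrmE -l2_inner_sq.
by rewrite /Num.norm /= /l2_norm sqrtCK.
Qed.

Lemma l2_nrm_ge (f : l2) N : \sum_(0 <= n < N) nrm (f n) ^+ 2 <= nrm f ^+ 2.
Proof. by rewrite l2_nrm_sq l2_sq_ge. Qed.

Lemma l2_nrm_le (f : l2) (M : R) : 0 <= M ->
  (forall N, \sum_(0 <= n < N) nrm (f n) ^+ 2 <= M ^+ 2) -> nrm f <= M.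
Proof.
move=> M0 h; rewrite -(@ler_pXn2r _ 2) ?nnegrE ?nrm_ge0 // l2_nrm_sq.
apply: (cvgr_to_le (@l2_sq_cvg f)); apply: nearW => N; exact: h.
Qed.

Lemma l2_nrm_coord (f : l2) n : nrm (f n) <= nrm f.
Proof.
rewrite -(@ler_pXn2r _ 2) ?nnegrE ?nrm_ge0 //; apply: le_trans (l2_nrm_ge f n.+1).
by rewrite big_nat_recr //= lerDr sumr_ge0 // => *; rewrite exprn_ge0 ?nrm_ge0.
Qed.

(** The coordinates of a Cauchy filter converge, and the Cauchy estimate passes
    to the limit in each partial sum of squares; the limit sequence is then
    within a square summable distance of the sequences of the filter. *)
Lemma l2_complete (F : set_system l2) : ProperFilter F -> cauchy F -> cvg F.
Proof.
move=> FF /cauchy_nrmP Fe.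
have lim_coord n : exists l : H, (x : l2) n @[x --> F] --> l.
  apply/cvg_ex; apply: cauchy_cvg; apply/cauchy_nrmP => e e0.
  have [A [FA hA]] := Fe e e0.
  exists ((fun f : l2 => f n) @` A); split.
    have : F ((fun f : l2 => f n) @^-1` ((fun f : l2 => f n) @` A)).
      by apply: filterS FA => f Af; exists f.
    by [].
  move=> _ _ [f Af <-] [g Ag <-].
  exact: le_trans (l2_nrm_coord (f - g) n) (hA f g Af Ag).
have [l hl] := choice lim_coord.
have key (e : R) : 0 < e -> exists A : set l2, F A /\
    forall f, A f -> forall N, \sum_(0 <= n < N) nrm (f n - l n) ^+ 2 <= e ^+ 2.
  move=> e0; have [A [FA hA]] := Fe e e0; exists A; split=> // f Af N.
  have cv : (\sum_(0 <= n < N) nrm ((f : l2) n - (x : l2) n) ^+ 2) @[x --> F] -->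
      \sum_(0 <= n < N) nrm (f n - l n) ^+ 2.
    elim: N => [|N ih]; first by under eq_fun do rewrite big_geq //;
      rewrite big_geq //; exact: cvg_cst.
    rewrite big_nat_recr //=; under eq_fun do rewrite big_nat_recr //=.
    have hN : nrm (f N - (x : l2) N) @[x --> F] --> nrm (f N - l N).
      by apply: cvg_nrm; apply: cvgB => //; exact: cvg_cst.
    exact: cvgD ih (cvgM hN hN).
  apply: (cvgr_to_le cv); apply: filterS FA => g Ag.
  apply: le_trans (l2_nrm_ge (f - g) N) _.
  by rewrite ler_pXn2r ?nnegrE ?nrm_ge0 ?(ltW e0) // hA.
have [A [FA hA]] := key 1 ltr01.
have [f Af] := filter_ex FA.
have lS : l \in sqsum.
  have -> : l = (f : nat -> H) - ((f : nat -> H) - l) by rewrite opprB addrC subrK.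
  rewrite rpredB //; first exact: (valP f).
  by apply/asboolP; exists (1 ^+ 2) => N; exact: hA.
apply: (@cvgP _ F (L2 lS)); apply: filter_nrm_cvg => e e0.
have [B [FB hB]] := key e e0; apply: filterS FB => g Bg.
by apply: l2_nrm_le (ltW e0) _ => N; exact: hB.
Qed.

HB.instance Definition _ := Uniform_isComplete.Build l2 l2_complete.

Lemma l2_innerE (f : l2) : l2_inner f f = `|f| ^+ 2.
Proof. by rewrite [RHS]sqrtCK. Qed.

Definition l2_hilbert : hilbert R := @Hilbert R l2 l2_inner l2_innerE.

End SquareSummable.

(** Square summable sequences are used only through their coordinates: these
    properties determine the space up to isomorphism. *)
Record l2_space (R : realType) (H : hilbert R) := L2Space {
  l2_hilb :> hilbert R;
  coord : nat -> {linear l2_hilb -> H};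
  of_seq : (nat -> H) -> l2_hilb;
  coord_inj : forall f g : l2_hilb, (forall n, coord n f = coord n g) -> f = g;
  of_seqK : forall f, square_summable f -> forall n, coord n (of_seq f) = f n;
  coord_asum : forall f g : l2_hilb,
    asum (fun n => '<coord n f, coord n g> : scalars R);
  coord_inner : forall f g : l2_hilb,
    '<f, g> = vsum (fun n => '<coord n f, coord n g> : scalars R);
  coord_ge : forall (f : l2_hilb) N,
    \sum_(0 <= n < N) nrm (coord n f) ^+ 2 <= nrm f ^+ 2;
  coord_le : forall (f : l2_hilb) (M : R), 0 <= M ->
    (forall N, \sum_(0 <= n < N) nrm (coord n f) ^+ 2 <= M ^+ 2) -> nrm f <= M
}.

Definition mk_linear (R : realType) (U V : lmodType R[i]) (f : U -> V)
    (f_lin : linear f) : {linear U -> V} :=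
  HB.pack f (GRing.isLinear.Build R[i] U V *:%R f f_lin).

Definition l2_of_seq (R : realType) (H : hilbert R) (f : nat -> H) : l2 H :=
  match pselect (f \in @sqsum R H) with left fS => L2 fS | right _ => 0 end.

Lemma l2_coord_linear (R : realType) (H : hilbert R) n :
  linear (fun f : l2 H => f n).
Proof. by []. Qed.

Lemma l2_of_seqK (R : realType) (H : hilbert R) (f : nat -> H) :
  square_summable f -> forall n, l2_of_seq f n = f n.
Proof.
move=> fS n; rewrite /l2_of_seq; case: pselect => // -[].
exact/asboolP.
Qed.

Definition ell2 (R : realType) (H : hilbert R) : l2_space H.
Proof.
exact: (@L2Space R H (l2_hilbert H) (fun n => mk_linear (@l2_coord_linear R H n))
  (@l2_of_seq R H) (@l2_eq R H) (@l2_of_seqK R H) (@asum_inner R H)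
  (fun _ _ => erefl) (@l2_nrm_ge R H) (@l2_nrm_le R H)).
Qed.

Section L2Convergence.
Variables (R : realType) (H : hilbert R) (S : l2_space H).

Lemma coord_sqsum (f : S) : square_summable (fun n => coord S n f).
Proof. by exists (nrm f ^+ 2) => N; exact: coord_ge. Qed.

(** A tail of the sequence [b] is small, which bounds the tail of the
    difference uniformly in [t]; finitely many coordinates remain, each of
    which converges. *)
Lemma l2_dominated_cvg (T : Type) (F : set_system T) (FF : Filter F)
    (f : T -> S) (l : S) (b : nat -> R) (M : R) :
  (forall N, \sum_(0 <= n < N) b n ^+ 2 <= M) ->
  (\forall t \near F, forall n, nrm (coord S n (f t) - coord S n l) <= b n) ->
  (forall n, coord S n (f t) @[t --> F] --> coord S n l) ->
  f t @[t --> F] --> l.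
Proof.
move=> bM fb fl; apply/cvg_nrmP => e e0.
have e2 : 0 < e ^+ 2 / 2 by rewrite divr_gt0 // exprn_gt0.
have [K hK] := nonneg_series_tail (fun n => sqr_ge0 (b n)) bM e2.
have head : \forall t \near F,
    \sum_(0 <= n < K) nrm (coord S n (f t) - coord S n l) ^+ 2 <= e ^+ 2 / 2.
  have e3 : 0 < e ^+ 2 / 2 / K.+1%:R by rewrite divr_gt0.
  have hn n : \forall t \near F,
      nrm (coord S n (f t) - coord S n l) ^+ 2 <= e ^+ 2 / 2 / K.+1%:R.
    have s0 : 0 < Num.sqrt (e ^+ 2 / 2 / K.+1%:R) by rewrite sqrtr_gt0.
    have /cvg_nrmP/(_ _ s0) := fl n; apply: filterS => t ht.
    rewrite -[leRHS]sqr_sqrtr ?(ltW e3) //.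
    by rewrite ler_pXn2r ?nnegrE ?nrm_ge0 // sqrtr_ge0.
  have hall : \forall t \near F, forall n, (n < K)%N ->
      nrm (coord S n (f t) - coord S n l) ^+ 2 <= e ^+ 2 / 2 / K.+1%:R.
    move: (e ^+ 2 / 2 / K.+1%:R) hn {e3} => c hn.
    elim: (K) => [|k ih]; first by apply: nearW.
    near=> t => n; rewrite ltnS leq_eqVlt => /predU1P[->|nk].
      by near: t; exact: hn.
    by move: n nk; near: t.
  apply: filterS hall => t ht.
  apply: le_trans (_ : \sum_(0 <= n < K) e ^+ 2 / 2 / K.+1%:R <= _).
    by rewrite !big_nat; apply: ler_sum => n /andP[_ nK]; exact: ht.
  rewrite big_const_nat subn0 iter_addr_0 -[leLHS](mulr_natr _ K) -[leLHS]mulrA ler_piMr ?(ltW e2) //.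
  by rewrite mulrC ler_pdivrMr // mul1r ler_nat.
near=> t; apply: coord_le (ltW e0) _ => N.
have part n : nrm (coord S n (f t - l)) = nrm (coord S n (f t) - coord S n l).
  by rewrite linearB.
under eq_bigr do rewrite part.
apply: le_trans (_ : \sum_(0 <= n < K + N)
    nrm (coord S n (f t) - coord S n l) ^+ 2 <= _).
  rewrite [leRHS](@big_cat_nat _ _ _ N) //= ?leq_addl // lerDl.
  by rewrite sumr_ge0 // => *; rewrite exprn_ge0 ?nrm_ge0.
rewrite (@big_cat_nat _ _ _ K) //= ?leq_addr // (splitr (e ^+ 2)).
rewrite lerD //; first by near: t.
apply: le_trans (hK (K + N)%N); apply: ler_sum => n _.
have : nrm (coord S n (f t) - coord S n l) <= b n by move: n; near: t.
move=> h; rewrite ler_pXn2r ?nnegrE ?nrm_ge0 //.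
exact: le_trans (nrm_ge0 _) h.
Unshelve. all: by end_near. Qed.

End L2Convergence.

(** * Infinitesimal generators and smooth vectors *)

Lemma near0W (R : realType) (A : R -> Prop) :
  (forall t, A t) -> \forall t \near (0 : R), A t.
Proof. by move=> h; exact: filterE. Qed.

Lemma near0P (R : realType) (A : R -> Prop) (d : R) : 0 < d ->
  (forall t, `|t| < d -> A t) -> \forall t \near (0 : R), A t.
Proof.
move=> d0 h; apply/nbhs_ballP; exists d => // t.
by rewrite -ball_normE /= sub0r normrN; exact: h.
Qed.

(** Identities in abelian groups: both sides are brought to a left-nested sum,
    in which each term is moved next to its opposite. *)
Ltac abel :=
  apply/eqP; rewrite -subr_eq0 -[eqbLHS]add0r !(opprD, opprK, addrA);
  repeat match goal with |- context [- ?x] =>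
    do ?[rewrite [_ + x + _]addrAC]; do ?[rewrite [_ - x + _]addrAC];
    rewrite addrK
  end; exact: eqxx.

Section LittleO.
Variables (R : realType) (V : normedModType R[i]).
Implicit Types u v : R -> V.

Definition small_o u :=
  forall e : R, 0 < e -> \forall t \near (0 : R), nrm (u t) <= e * `|t|.

Lemma small_oD u v : small_o u -> small_o v -> small_o (fun t => u t + v t).
Proof.
move=> hu hv e e0; have e2 : 0 < e / 2 by rewrite divr_gt0.
near=> t; apply: le_trans (nrmD _ _) _.
have h1 : nrm (u t) <= e / 2 * `|t| by near: t; exact: hu.
have h2 : nrm (v t) <= e / 2 * `|t| by near: t; exact: hv.
lra.
Unshelve. all: by end_near. Qed.

Lemma small_o_le u v : (\forall t \near (0 : R), nrm (u t) <= nrm (v t)) ->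
  small_o v -> small_o u.
Proof.
move=> uv hv e e0; near=> t; apply: (@le_trans _ _ (nrm (v t))); near: t => //.
exact: hv.
Unshelve. all: by end_near. Qed.

Lemma small_o_ext u v : (forall t, u t = v t) -> small_o v -> small_o u.
Proof. by move=> uv; apply: small_o_le; apply: near0W => t; rewrite uv. Qed.

Lemma small_oZ (a : R -> R[i]) (C : R) v :
  (\forall t \near (0 : R), nrm (a t) <= C) -> small_o v ->
  small_o (fun t => a t *: v t).
Proof.
move=> aC hv e e0.
have C0 : 0 < `|C| + 1 by rewrite ltr_wpDl.
have e1 : 0 < e / (`|C| + 1) by rewrite divr_gt0.
near=> t; rewrite nrmZ.
have h1 : nrm (v t) <= e / (`|C| + 1) * `|t| by near: t; exact: hv.
have h2 : nrm (a t) <= `|C| + 1.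
  apply: le_trans (_ : C <= _); first by near: t.
  by rewrite (le_trans (ler_norm _)) // lerDl.
apply: le_trans (ler_pM (nrm_ge0 _) (nrm_ge0 _) h2 h1) _.
by rewrite mulrA [_ * (e / _)]mulrC divfK // gt_eqF.
Unshelve. all: by end_near. Qed.

Lemma small_o_mul (v : R -> V) : v t @[t --> (0 : R)] --> (0 : V) ->
  small_o (fun t => t%:C *: v t).
Proof.
move=> /cvg_nrmP hv e e0; apply: filterS (hv e e0) => t.
by rewrite subr0 nrmZr mulrC => h; exact: ler_wpM2r.
Qed.

(** The first-order form of differentiability; it has no exceptional point and
    no division. *)
Lemma small_oP (f : R -> V) (w : V) : f 0 = 0 ->
  (t^-1)%:C *: f t @[t --> (0 : R)^'] --> w <-> small_o (fun t => f t - t%:C *: w).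
Proof.
move=> f0.
have key t : t != 0 -> nrm (f t - t%:C *: w) = `|t| * nrm ((t^-1)%:C *: f t - w).
  move=> t0; rewrite -nrmZr scalerBr scalerA -rmorphM /= divff //.
  by rewrite scale1r.
split=> [/cvg_nrmP h e e0|h].
  have /nbhs_ballP[d d0 hd] := h e e0.
  apply/nbhs_ballP; exists d => // t td.
  have [->|t0] := eqVneq t 0.
    by rewrite f0 scale0r subr0 nrm0 normr0 mulr0.
  by rewrite key // mulrC ler_wpM2r //; exact: hd.
apply/cvg_nrmP => e e0; have /nbhs_ballP[d d0 hd] := h e e0.
apply/nbhs_ballP; exists d => // t td t0.
have := hd t td; rewrite key // mulrC ler_pM2r // normr_gt0.
exact: t0.
Qed.

Lemma small_o_uniq (f : R -> V) (w w' : V) : f 0 = 0 ->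
  small_o (fun t => f t - t%:C *: w) -> small_o (fun t => f t - t%:C *: w') ->
  w = w'.
Proof.
by move=> f0 /(small_oP _ f0) h /(small_oP _ f0) h'; apply: cvg_unique h h'.
Qed.

End LittleO.

Section Generators.
Variables (R : realType) (E : hilbert R) (pi : heis R -> {linear E -> E}).
Hypothesis pi_rep : is_unitary_rep pi.
Implicit Types (g x y : heis R) (u v w : E).

Let P := basisP R.
Let Q := basisQ R.
Let Z := basisZ R.

Lemma rep_nrm g v : nrm (pi g v) = nrm v.
Proof. by have [iso _] := rep_unitary pi_rep g; exact: isometry_nrm. Qed.

Lemma rep0 v : pi 0 v = v.
Proof.
apply/eqP; rewrite -subr_eq0; apply/eqP/nrm_eq0.
by rewrite -(rep_nrm 0) linearB -(rep_mul pi_rep) heis_mul0 subrr nrm0.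
Qed.

Lemma repKV g v : pi g (pi (- g) v) = v.
Proof. by rewrite -(rep_mul pi_rep) heis_mulN rep0. Qed.

Lemma rep_addZ (s t : R) x v : pi ((s + t) *: x) v = pi (s *: x) (pi (t *: x) v).
Proof. by rewrite -(rep_mul pi_rep) heis_mulZ. Qed.

(** [v] is in the domain of the generator along [x], with value [w]; this
    first-order form composes better than limits of difference quotients. *)
Definition gen x v w := small_o (fun t => pi (t *: x) v - v - t%:C *: w).

Lemma genP x v w : orbit_quot pi x v t @[t --> (0 : R)^'] --> w <-> gen x v w.
Proof.
apply: (small_oP (f := fun t => pi (t *: x) v - v)).
by rewrite scale0r rep0 subrr.
Qed.

Lemma gen_uniq x v w w' : gen x v w -> gen x v w' -> w = w'.
Proof. by apply: small_o_uniq; rewrite scale0r rep0 subrr. Qed.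

Lemma gen_dpi x v w : gen x v w -> dpi pi x v = w.
Proof. by move=> /genP h; apply: cvg_lim h; exact: norm_hausdorff. Qed.

Lemma gen0 x : gen x 0 0.
Proof.
move=> e e0; apply: near0W => t.
by rewrite linear0 scaler0 !subr0 nrm0 mulr_ge0 // ltW.
Qed.

Lemma gen_lin x (a : R[i]) v v' w w' : gen x v w -> gen x v' w' ->
  gen x (a *: v + v') (a *: w + w').
Proof.
move=> h h'.
have ha : small_o (fun t => a *: (pi (t *: x) v - v - t%:C *: w)).
  by apply: (small_oZ (C := nrm a)) h; exact: near0W.
apply: small_o_le (small_oD ha h'); apply: near0W => t.
rewrite linearP scalerDr !scalerBr !scalerA (mulrC a).
apply: eq_ind (lexx _) _ _; congr (nrm _ <= nrm _).
abel.
Qed.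

Lemma genD x v v' w w' : gen x v w -> gen x v' w' -> gen x (v + v') (w + w').
Proof. by move=> h h'; have := gen_lin 1 h h'; rewrite !scale1r. Qed.

(** Reparametrisation: along a curve [a t *: x] with [a' 0 = c], the orbit of
    [v] has derivative [c *: w]. *)
Lemma gen_curve x v w (a : R -> R) (c C : R) : gen x v w ->
  (\forall t \near (0 : R), `|a t| <= C * `|t|) ->
  (forall e, 0 < e -> \forall t \near (0 : R), `|a t - t * c| <= e * `|t|) ->
  small_o (fun t => pi (a t *: x) v - v - t%:C *: (c%:C *: w)).
Proof.
move=> h aC ac.
have a0 : a t @[t --> (0 : R)] --> (0 : R).
  apply/cvgrPdist_le => e e0; near=> t; rewrite sub0r normrN.
  apply: le_trans (_ : C * `|t| <= _); first by near: t.
  have C0 : 0 < `|C| + 1 by rewrite ltr_wpDl.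
  apply: le_trans (_ : (`|C| + 1) * `|t| <= _).
    by rewrite ler_wpM2r // (le_trans (ler_norm _)) // lerDl.
  rewrite mulrC -ler_pdivlMr //; near: t.
  have d0 : 0 < e / (`|C| + 1) by rewrite divr_gt0.
  by apply: (near0P d0) => t /ltW.
have h1 : small_o (fun t => pi (a t *: x) v - v - (a t)%:C *: w).
  move=> e e0; have C0 : 0 < `|C| + 1 by rewrite ltr_wpDl.
  have e1 : 0 < e / (`|C| + 1) by rewrite divr_gt0.
  have ha : \forall t \near (0 : R),
    nrm (pi (a t *: x) v - v - (a t)%:C *: w) <= e / (`|C| + 1) * `|a t|.
    exact: (a0 _ (h _ e1)).
  near=> t; apply: le_trans (_ : e / (`|C| + 1) * `|a t| <= _); first by near: t.
  apply: le_trans (_ : e / (`|C| + 1) * ((`|C| + 1) * `|t|) <= _).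
    rewrite ler_wpM2l ?(ltW e1) //.
    apply: le_trans (_ : C * `|t| <= _); first by near: t.
    by rewrite ler_wpM2r // (le_trans (ler_norm _)) // lerDl.
  by rewrite mulrA divfK // gt_eqF.
have h2 : small_o (fun t => (a t - t * c)%:C *: w).
  move=> e e0; have w0 : 0 < nrm w + 1 by rewrite ltr_wpDl ?nrm_ge0.
  have e1 : 0 < e / (nrm w + 1) by rewrite divr_gt0.
  apply: filterS (ac _ e1) => t ht; rewrite nrmZr.
  apply: le_trans (ler_pM (normr_ge0 _) (nrm_ge0 _) ht (_ : _ <= nrm w + 1)) _.
    by rewrite lerDl.
  by rewrite mulrAC divfK // gt_eqF.
apply: small_o_le (small_oD h1 h2); apply: near0W => t.
by rewrite rmorphB rmorphM /= scalerBl scalerA addrA subrK.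
Unshelve. all: by end_near. Qed.

Lemma gen_scale x v w (c : R) : gen x v w -> gen (c *: x) v (c%:C *: w).
Proof.
move=> h.
apply: (small_o_ext (v := fun t => pi ((t * c) *: x) v - v - t%:C *: (c%:C *: w))).
  by move=> t; rewrite scalerA.
apply: (gen_curve (C := `|c|) h) => [|e e0]; apply: near0W => t.
  by rewrite normrM mulrC.
by rewrite subrr normr0 mulr_ge0 // ltW.
Qed.

(** Product rule for a curve of operators acting on a curve of vectors; strong
    continuity suffices for the first factor because it is isometric. *)
Lemma small_o_comp (g1 : R -> heis R) (W : R -> E) v a b :
  g1 t @[t --> (0 : R)] --> (0 : heis R) ->
  small_o (fun t => pi (g1 t) v - v - t%:C *: a) ->
  small_o (fun t => W t - v - t%:C *: b) ->
  small_o (fun t => pi (g1 t) (W t) - v - t%:C *: (a + b)).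
Proof.
move=> g10 h1 h2.
have hb : pi (g1 t) b @[t --> (0 : R)] --> pi 0 b.
  exact: cvg_comp g10 (@rep_cont _ _ _ pi_rep b (0 : heis R)).
have h3 : small_o (fun t => t%:C *: (pi (g1 t) b - b)).
  apply: small_o_mul; rewrite -(subrr b) -{3}(rep0 b).
  by apply: cvgB hb _; exact: cvg_cst.
have h2' : small_o (fun t => pi (g1 t) (W t - v - t%:C *: b)).
  by apply: small_o_le h2; apply: near0W => t; rewrite rep_nrm.
apply: small_o_le (small_oD (small_oD h1 h2') h3); apply: near0W => t.
have -> : pi (g1 t) (W t - v - t%:C *: b) =
    pi (g1 t) (W t) - pi (g1 t) v - t%:C *: pi (g1 t) b by rewrite !linearB linearZ.
rewrite scalerBr (scalerDr t%:C a b).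
by apply: eq_ind (lexx _) _ _; congr (nrm _ <= nrm _); abel.
Qed.

(** The element [exp t (p P + q Q + z Z)] is the product of [exp (t p P)], [exp
    (t q Q)] and [exp (s Z)] with [s - t z] of order [t ^ 2], and the
    derivative at the unit of a product of curves is the sum of their
    derivatives. *)
Lemma gen_comb v a b c (p q z : R) : gen P v a -> gen Q v b -> gen Z v c ->
  gen (heis_mk p q z) v (p%:C *: a + q%:C *: b + z%:C *: c).
Proof.
move=> ga gb gc; rewrite /gen -addrA.
pose s t : R := t * z - t ^+ 2 * (p * q / 2).
have eg t : t *: heis_mk p q z =
    heis_mul ((t * p) *: P) (heis_mul ((t * q) *: Q) (s t *: Z)).
  apply: heis_eq; rewrite /heis_mul /bracket /coordP /coordQ /coordZ /=;
  rewrite /GRing.scale /= /s; by field.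
apply: (small_o_ext (v := fun t => pi ((t * p) *: P) (pi ((t * q) *: Q)
    (pi (s t *: Z) v)) - v - t%:C *: (p%:C *: a + (q%:C *: b + z%:C *: c)))).
  by move=> t; rewrite eg !(rep_mul pi_rep).
have lin0 (x : heis R) (r : R) : (t * r) *: x @[t --> (0 : R)] --> (0 : heis R).
  rewrite -[X in _ --> X](scale0r x) -[X in X *: x](mul0r r).
  apply: cvgZl; apply: cvgMl; exact: cvg_id.
apply: small_o_comp => //.
  by apply: small_o_ext (gen_scale p ga) => t; rewrite scalerA.
apply: small_o_comp => //.
  by apply: small_o_ext (gen_scale q gb) => t; rewrite scalerA.
apply: (gen_curve (C := `|z| + `|p * q / 2|)) gc _ _.
  apply: (near0P ltr01) => t t1.
  rewrite /s (le_trans (ler_normB _ _)) // mulrDl !normrM [`|t| * `|z|]mulrC lerD2l.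
  by rewrite mulrC ler_wpM2l ?mulr_ge0 // ler_piMl // ltW.
move=> e e0; have d0 : 0 < e / (`|p * q / 2| + 1) by rewrite divr_gt0 // ltr_wpDl.
apply: (near0P d0) => t td.
rewrite /s addrAC subrr sub0r normrN normrM normrX expr2 mulrAC ler_wpM2r //.
apply: le_trans (_ : `|t| * (`|p * q / 2| + 1) <= _).
  by rewrite ler_wpM2l // lerDl.
by rewrite -ler_pdivlMr ?ltW // ltr_wpDl.
Qed.

(** Left translation turns the directional derivative at [g] into one at the
    unit; the bracket corrects for the chart being additive. *)
Lemma orbit_deriv v a b c g x : gen P v a -> gen Q v b -> gen Z v c ->
  small_o (fun t => pi (g + t *: x) v - pi g v - t%:C *:
    (pi g ((coordP x)%:C *: a + (coordQ x)%:C *: b + (coordZ x)%:C *: c)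
     - (2^-1 * (coordP g * coordQ x - coordQ g * coordP x))%:C *: pi g c)).
Proof.
move=> ga gb gc.
set om := 2^-1 * _.
have h := gen_comb (coordP x) (coordQ x) (coordZ x - om) ga gb gc.
have h' : small_o (fun t => pi g (pi (t *: heis_mk (coordP x) (coordQ x)
    (coordZ x - om)) v - v - t%:C *: ((coordP x)%:C *: a + (coordQ x)%:C *: b
    + (coordZ x - om)%:C *: c))).
  by apply: small_o_le h; apply: near0W => t; rewrite rep_nrm.
apply: small_o_ext h' => t.
rewrite [RHS]linearB [in RHS]linearB -(rep_mul pi_rep) /=; congr (_ - _ - _).
  congr (pi _ _); apply: heis_eq; rewrite /heis_mul /bracket /om /coordP /coordQ
    /coordZ /=; rewrite /GRing.scale /=; by field.
have -> : om%:C *: pi g c = pi g (om%:C *: c) by rewrite linearZ.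
rewrite -linearB [RHS]linearZ; congr (_ *: pi g _).
by rewrite rmorphB scalerBl addrA.
Qed.

End Generators.

Section SmoothVectors.
Variables (R : realType) (E : hilbert R).
Implicit Types F G : heis R -> E.

Lemma diff_quotP F g x w : diff_quot F g x t @[t --> (0 : R)^'] --> w <->
  small_o (fun t => F (g + t *: x) - F g - t%:C *: w).
Proof.
apply: (small_oP (f := fun t => F (g + t *: x) - F g)).
by rewrite scale0r addr0 subrr.
Qed.

Lemma is_CnS n F : is_Cn n.+1 F -> is_Cn n F.
Proof.
elim: n F => [|n ih] F [cF hF] //; split=> // x.
by have [F' [dF /ih cF']] := hF x; exists F'.
Qed.

Lemma is_CnD n F G : is_Cn n F -> is_Cn n G -> is_Cn n (fun g => F g + G g).
Proof.
elim: n F G => [|n ih] F G /=.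
  by move=> cF cG g; apply: cvgD; [exact: cF|exact: cG].
move=> [cF hF] [cG hG]; split; first by move=> g; apply: cvgD; [exact: cF|exact: cG].
move=> x; have [F' [dF cF']] := hF x; have [G' [dG cG']] := hG x.
exists (fun g => F' g + G' g); split; last exact: ih.
move=> g; have /diff_quotP h := dF g; have /diff_quotP h' := dG g.
apply/diff_quotP; apply: small_o_ext (small_oD h h') => t.
by rewrite scalerDr; abel.
Qed.

Lemma is_CnZ n F (a : R[i]) : is_Cn n F -> is_Cn n (fun g => a *: F g).
Proof.
elim: n F => [|n ih] F /=; first by move=> cF g; apply: cvgZr; exact: cF.
move=> [cF hF]; split; first by move=> g; apply: cvgZr; exact: cF.
move=> x; have [F' [dF cF']] := hF x; exists (fun g => a *: F' g).
split; last exact: ih.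
move=> g; have /diff_quotP h := dF g; apply/diff_quotP.
apply: small_o_ext (small_oZ (near0W (fun t => lexx (nrm a))) h) => t.
by rewrite !scalerBr !scalerA mulrC.
Qed.

(** Left invariant vector fields have coefficients that are affine in the
    chart, so that derivatives of orbit maps are sums of orbit maps times such
    coefficients. *)
Lemma is_Cn_linear_mul n F (l : heis R -> R) :
  (forall g x t, l (g + t *: x) = l g + t * l x) -> continuous l ->
  is_Cn n F -> is_Cn n (fun g => (l g)%:C *: F g).
Proof.
move=> l_lin l_cont.
have lF_cont G : continuous G -> continuous (fun g => (l g)%:C *: G g).
  move=> cG g; apply: cvgZ; last exact: cG.
  apply/(@cvg_nrmP R (R[i]^o : normedModType R[i])) => e e0.
  have /cvgrPdist_le/(_ _ e0) := @l_cont g; apply: filterS => y.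
  by rewrite -rmorphB nrm_real distrC.
elim: n F => [|n ih] F; first exact: lF_cont.
move=> cnF; case: (cnF) => [cF hF]; split; first exact: lF_cont.
move=> x; have [F' [dF cF']] := hF x.
exists (fun g => (l x)%:C *: F g + (l g)%:C *: F' g); split; last first.
  by apply: is_CnD; [apply/is_CnZ/is_CnS|exact: ih].
move=> g; have /diff_quotP h := dF g; apply/diff_quotP.
have h1 := small_oZ (near0W (fun t => lexx (nrm (l g)%:C))) h.
have h2 : small_o (fun t => t%:C *: ((l x)%:C *: (F (g + t *: x) - F g))).
  apply: small_o_mul; rewrite -[X in _ --> X](scaler0 _ (l x)%:C); apply: cvgZr.
  rewrite -[X in _ --> X](subrr (F g)); apply: cvgB; last exact: cvg_cst.
  have hx : g + t *: x @[t --> (0 : R)] --> g.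
    rewrite -[X in _ --> X](addr0 g); apply: cvgD; first exact: cvg_cst.
    by rewrite -[X in _ --> X](scale0r x); apply: cvgZl; exact: cvg_id.
  exact: cvg_comp hx (@cF g).
apply: small_o_ext (small_oD h1 h2) => t.
rewrite l_lin rmorphD rmorphM /= scalerDl !scalerBr scalerDr !scalerA.
by rewrite [(l g)%:C * _]mulrC; abel.
Qed.

(** Vectors in a subspace that the generators along [P], [Q] and [Z] map to
    itself are smooth: the derivatives of their orbit maps are again orbit maps
    of vectors of the subspace, with coefficients affine in the chart. *)
Lemma smooth_of_invariant (pi : heis R -> {linear E -> E}) (V : set E) :
  is_unitary_rep pi -> is_subspace V ->
  (forall v, V v -> exists a b c, [/\ V a, V b & V c] /\
    [/\ gen pi (basisP R) v a, gen pi (basisQ R) v b & gen pi (basisZ R) v c]) ->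
  V `<=` smooth_vectors pi.
Proof.
move=> pi_rep Vsub Vinv v Vv n.
have VD u w (r : R[i]) : V u -> V w -> V (r *: u + w).
  move=> Vu Vw; have [_ h] := Vsub; apply/set_mem; apply: h; exact/mem_set.
have V0 : V 0 by have [h _] := Vsub; exact: set_mem.
elim: n v Vv => [|n ih] v Vv /=; first exact: rep_cont.
split; first exact: rep_cont.
move=> x; have [a [b [c [[Va Vb Vc] [ga gb gc]]]]] := Vinv v Vv.
pose d := (coordP x)%:C *: a + (coordQ x)%:C *: b + (coordZ x)%:C *: c.
have Vd : V d.
  rewrite /d -addrA; apply: (VD) => //; apply: (VD) => //.
  by rewrite -[_ *: c]addr0; apply: VD.
pose l g := - (2^-1 * (coordP g * coordQ x - coordQ g * coordP x)) : R.
exists (fun g => pi g d + (l g)%:C *: pi g c); split.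
  move=> g; apply/diff_quotP.
  apply: small_o_ext (orbit_deriv pi_rep g x ga gb gc) => t.
  by rewrite /l rmorphN scaleNr.
apply: is_CnD; first exact: ih.
apply: is_Cn_linear_mul; last exact: ih.
  move=> g y t; rewrite /l /coordP /coordQ /= /GRing.scale /=; ring.
move=> g; apply: cvgN; apply: cvgMr; apply: cvgB; apply: cvgMl;
  rewrite /coordP /coordQ.
  by apply: (cvg_comp (fun g : heis R => g.1) fst); [exact: cvg_fst|exact: cvg_fst].
by apply: (cvg_comp (fun g : heis R => g.1) snd); [exact: cvg_fst|exact: cvg_snd].
Qed.

End SmoothVectors.

(** * Test functions on the line *)

Section SmoothFunctions.
Variable R : realType.
Implicit Types f g : R -> R.

Fixpoint Csmooth n f : Prop :=
  match n with
  | 0%N => True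
  | n'.+1 => exists f', (forall s : R, is_derive s (1 : R) f (f' s)) /\ Csmooth n' f'
  end.

Definition smooth f := forall n, Csmooth n f.

Lemma smooth_derive f : smooth f ->
  exists f', (forall s : R, is_derive s (1 : R) f (f' s)) /\ smooth f'.
Proof.
move=> fs; have [f' [df _]] := fs 1%N; exists f'; split=> // n.
have [f'' [df' fn]] := fs n.+1; suff -> : f' = f'' by [].
apply/funext => s; have h := df s; have h' := df' s.
by rewrite -(@derive_val _ _ _ _ _ _ _ h) -(@derive_val _ _ _ _ _ _ _ h').
Qed.

Lemma CsmoothS n f : Csmooth n.+1 f -> Csmooth n f.
Proof. by elim: n f => [//|n ih] f [f' [df /ih ?]]; exists f'. Qed.

Lemma CsmoothD n f g : Csmooth n f -> Csmooth n g -> Csmooth n (f \+ g).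
Proof.
elim: n f g => [//|n ih] f g [f' [df fn]] [g' [dg gn]].
by exists (f' \+ g'); split; [move=> s; exact: is_deriveD|exact: ih].
Qed.

Lemma CsmoothM n f g : Csmooth n f -> Csmooth n g -> Csmooth n (f \* g).
Proof.
elim: n f g => [//|n ih] f g fS gS.
have [f' [df fn]] := fS; have [g' [dg gn]] := gS.
exists ((f \* g') \+ (g \* f')); split; first by move=> s; exact: is_deriveM.
by apply: CsmoothD; apply: ih => //; exact: CsmoothS.
Qed.

Lemma Csmooth_cst n (c : R) : Csmooth n (cst c).
Proof.
elim: n c => [//|n ih] c; exists (cst 0); split; last exact: ih.
by move=> s; exact: is_derive_cst.
Qed.

Lemma Csmooth_id n : Csmooth n (@idfun R).
Proof.
case: n => [//|n]; exists (cst 1); split; last exact: Csmooth_cst.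
by move=> s; exact: is_derive_id.
Qed.

Lemma is_derive_affine (a b s : R) :
  is_derive s (1 : R) (fun u : R => a * u + b) a.
Proof.
have h := is_deriveD (is_deriveZ a (is_derive_id s (1 : R))) (is_derive_cst b s (1 : R)).
by apply: (is_derive_eq h); rewrite addr0 /GRing.scale /= mulr1.
Qed.

Lemma Csmooth_affine n f (a b : R) : Csmooth n f ->
  Csmooth n (fun s => f (a * s + b)).
Proof.
elim: n f => [//|n ih] f [f' [df fn]].
exists (cst a \* (fun s => f' (a * s + b))); split; last first.
  by apply: CsmoothM; [exact: Csmooth_cst|exact: ih].
move=> s; have h := df (a * s + b).
have := @is_derive1_comp R f (fun u => a * u + b) s _ _ h (is_derive_affine a b s).
by rewrite mulrC.
Qed.

(** ** A flat function: [exp (-1/x)] times a polynomial in [1/x] *)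

Definition flat (p : {poly R}) (x : R) : R :=
  if 0 < x then p.[x^-1] * expR (- x^-1) else 0.

(** A single term of the exponential series is at most its sum. *)
Lemma pow_le_expR n (y : R) : 0 <= y -> y ^+ n <= n`!%:R * expR y.
Proof.
move=> y0; case: n => [|n].
  by rewrite expr0 fact0 mul1r -expR0 ler_expR.
rewrite mulrC -ler_pdivrMr ?ltr0n ?fact_gt0 //.
by apply: le_trans (expR_ge1Dxn n y0); rewrite lerDr.
Qed.

Lemma poly_le_expR (p : {poly R}) :
  exists2 C, 0 <= C & forall y, 0 <= y -> `|p.[y]| <= C * expR y.
Proof.
elim/poly_ind: p => [|p c [C C0 hC]].
  by exists 0 => // y _; rewrite horner0 normr0 mul0r.
have [D D0 hD] : exists2 D, 0 <= D & forall y, 0 <= y -> `|(p * 'X).[y]| <= D * expR y.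
  exists (\sum_(i < size p) `|p`_i| * i.+1`!%:R).
    by apply: sumr_ge0 => i _; rewrite mulr_ge0.
  move=> y y0; rewrite hornerMX horner_coef mulr_suml.
  apply: le_trans (ler_norm_sum _ _ _) _; rewrite mulr_suml; apply: ler_sum => i _.
  rewrite -mulrA -exprSr normrM -mulrA ler_wpM2l // ger0_norm ?exprn_ge0 //.
  exact: pow_le_expR.
exists (D + `|c|) => [|y y0]; first by rewrite addr_ge0.
rewrite hornerD hornerC mulrDl (le_trans (ler_normD _ _)) // lerD ?hD //.
by rewrite ler_peMr // -expR0 ler_expR.
Qed.

Lemma flat_le_sqr (p : {poly R}) : exists2 C, 0 <= C & forall x, `|flat p x| <= C * x ^+ 2.
Proof.
have [C C0 hC] := poly_le_expR (p * 'X ^+ 2); exists C => // x.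
rewrite /flat; case: ifPn => x0; last by rewrite normr0 mulr_ge0 // sqr_ge0.
have /hC : 0 <= x^-1 by rewrite invr_ge0 ltW.
rewrite hornerM hornerXn normrM [`|_ ^+ 2|]ger0_norm ?sqr_ge0 // => h.
rewrite normrM (ger0_norm (expR_ge0 _)) expRN -ler_pdivlMr ?invr_gt0 ?expR_gt0 // invrK.
rewrite exprVn ler_pdivrMr ?exprn_gt0 // in h.
by rewrite mulrAC.
Qed.

(** At positive arguments this is the chain rule. At the origin, the function
    is bounded by a multiple of [x ^ 2], so that its difference quotients tend
    to 0. The derivative has the same form, which gives smoothness by
    induction. *)
Lemma flat_derive (p : {poly R}) (x : R) :
  is_derive x (1 : R) (flat p) (flat ('X ^+ 2 * (p - p^`())) x).
Proof.
have [x0|x0|<-] := ltgtP 0 x.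
- rewrite {2}/flat x0.
  apply: (@near_eq_is_derive R R R (fun x => p.[x^-1] * expR (- x^-1)) (flat p)).
    by near=> y; rewrite /flat ifT //; near: y; exact: lt_nbhsr.
  have xN0 : x != 0 by rewrite gt_eqF.
  have dV : is_derive x (1 : R) (fun y : R => y^-1) (- x ^- 2).
    by have := @is_deriveV R id x 1 1 xN0 (is_derive_id x (1 : R)); rewrite /GRing.scale /= mulr1.
  have d1 : is_derive x (1 : R) (fun y => p.[y^-1]) (p^`().[x^-1] * - x ^- 2).
    exact: (@is_derive1_comp R (horner p) (fun y => y^-1) x _ _ (is_derive_poly p x^-1) dV).
  have d2 : is_derive x (1 : R) (fun y => expR (- y^-1)) (expR (- x^-1) * (x ^- 2)).
    have dN : is_derive x (1 : R) (fun y : R => - y^-1) (x ^- 2).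
      by have := is_deriveN dV; rewrite opprK.
    exact: (@is_derive1_comp R expR (fun y => - y^-1) x _ _ (is_derive_expR (- x^-1)) dN).
  have := is_deriveM d1 d2; rewrite /GRing.scale /= => h.
  apply: (is_derive_eq h).
  rewrite !hornerE /= exprVn; ring.
- rewrite {2}/flat ltNge ltW //=.
  apply: (@near_eq_is_derive _ _ _ (cst 0)) => //.
  by near=> y; rewrite /flat ltNge ltW //=; near: y; exact: lt_nbhsl.
rewrite {2}/flat ltxx.
have [C C0 hC] := flat_le_sqr p.
have h : (h^-1 *: (flat p (h *: 1 + 0) - flat p 0)) @[h --> (0 : R)^'] --> (0 : R).
  apply/cvgrPdist_le => e e0.
  have C1 : 0 < C + 1 by rewrite ltr_wpDl.
  have d0 : 0 < e / (C + 1) by rewrite divr_gt0.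
  apply/nbhs_ballP; exists (e / (C + 1)) => //= t; rewrite -ball_normE /= sub0r normrN => td t0.
  rewrite sub0r normrN addr0 [flat p 0]/flat ltxx subr0 /GRing.scale /= mulr1 normrM normfV.
  rewrite mulrC ler_pdivrMr ?normr_gt0 //.
  apply: le_trans (hC t) _; rewrite -real_normK ?num_real // expr2 mulrA ler_wpM2r //.
  apply: le_trans (_ : (C + 1) * `|t| <= _); first by rewrite ler_wpM2r // lerDl.
  by rewrite mulrC -ler_pdivlMr // ltW.
apply: DeriveDef; first by apply/cvg_ex; exists 0.
by apply: cvg_lim h.
Unshelve. all: by end_near. Qed.

Lemma Csmooth_flat n p : Csmooth n (flat p).
Proof.
elim: n p => [//|n ih] p; exists (flat ('X ^+ 2 * (p - p^`()))); split; last exact: ih.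
exact: flat_derive.
Qed.

(** ** Compactly supported smooth functions *)

(** The support is well inside the interval [-2, 2[ of integration below, so
    that translates by at most 1/2 have the same integral. *)
Definition test_fun f := smooth f /\ forall s, 1 < `|s| -> f s = 0.

Definition bump (r : R) (s : R) := flat 1 (r + s) * flat 1 (r - s).

Lemma bump_test r : 0 < r <= 1 -> test_fun (bump r).
Proof.
move=> /andP[r0 r1]; split=> [n|s s1].
  have -> : bump r = (fun s => flat 1 (1 * s + r)) \* (fun s => flat 1 (-1 * s + r)).
    by apply/funext => s; rewrite /bump /= mul1r mulN1r addrC (addrC r).
  by apply: CsmoothM; apply: Csmooth_affine; exact: Csmooth_flat.
rewrite /bump /flat; have [s0|s0] := ltP 0 s.
  by rewrite [X in _ * X]ifF ?mulr0 //; move: s1; rewrite gtr0_norm //; lra.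
by rewrite ifF ?mul0r //; move: s1; rewrite ler0_norm //; lra.
Qed.

Lemma bump_supp r s : r <= `|s| -> bump r s = 0.
Proof.
rewrite /bump /flat => rs; have [s0|s0] := ltP 0 s.
  by rewrite [X in _ * X]ifF ?mulr0 //; move: rs; rewrite gtr0_norm //; lra.
by rewrite ifF ?mul0r //; move: rs; rewrite ler0_norm //; lra.
Qed.

Lemma bump_ge0 r s : 0 <= bump r s.
Proof.
by rewrite mulr_ge0 // /flat; case: ifP => // _; rewrite hornerC mul1r expR_ge0.
Qed.

Lemma bump_lower r : 0 < r ->
  exists2 m, 0 < m & forall s, `|s| <= r / 2 -> m <= bump r s.
Proof.
move=> r0; exists (expR (- (r / 2)^-1) ^+ 2); first by rewrite exprn_gt0 // expR_gt0.
have r2 : 0 < r / 2 by rewrite divr_gt0.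
have key x : r / 2 <= x -> expR (- (r / 2)^-1) <= flat 1 x.
  move=> rx; have x0 : 0 < x by exact: lt_le_trans rx.
  by rewrite /flat x0 hornerC mul1r ler_expR lerN2 lef_pV2.
move=> s; rewrite ler_norml => /andP[s1 s2].
rewrite expr2 /bump; apply: ler_pM; rewrite ?expR_ge0 //; apply: key; lra.
Qed.

Lemma smooth_continuous f : smooth f -> continuous f.
Proof.
move=> /smooth_derive[f' [df _]] s.
by apply: differentiable_continuous; apply/derivable1_diffP; have := df s; case.
Qed.

Lemma test_derive f : test_fun f ->
  exists f', (forall s : R, is_derive s (1 : R) f (f' s)) /\ test_fun f'.
Proof.
move=> [/smooth_derive[f' [df fs]] f0]; exists f'; split=> //; split=> // s s1.
have h : is_derive s (1 : R) f 0.
  apply: (@near_eq_is_derive _ _ _ (cst 0)) => //.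
  have e0 : 0 < `|s| - 1 by rewrite subr_gt0.
  apply/nbhs_ballP; exists (`|s| - 1) => // t; rewrite -ball_normE /= => st.
  apply/esym/f0; have := ler_distD t s 0; rewrite !subr0; lra.
by have h' := df s; rewrite -(@derive_val _ _ _ _ _ _ _ h') (@derive_val _ _ _ _ _ _ _ h).
Qed.

Lemma test_bounded f : test_fun f -> exists2 M, 0 <= M & forall s, `|f s| <= M.
Proof.
move=> [/smooth_continuous fc f0].
have cn : continuous (fun s => `|f s|) by move=> s; apply: cvg_norm; exact: fc.
have [//|c _ hc] := @EVT_max R (fun s => `|f s|) (-1) 1 _ (continuous_subspaceT cn).
exists `|f c| => // s; have [s1|s1] := leP `|s| 1.
  by apply: hc; rewrite in_itv /= -ler_norml.
by rewrite f0 // normr0.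
Qed.

Lemma derive_lipschitz f f' (M : R) : (forall s : R, is_derive s (1 : R) f (f' s)) ->
  (forall s, `|f' s| <= M) -> forall s t, `|f t - f s| <= M * `|t - s|.
Proof.
move=> df fM s t.
wlog st : s t / s <= t.
  by move=> h; have [/h//|/ltW/h] := leP s t; rewrite distrC (distrC t).
have fc : {within `[s, t], continuous f}.
  apply: continuous_subspaceT => x; apply: differentiable_continuous.
  by apply/derivable1_diffP; have := df x; case.
have [c _ ->] := MVT_segment st (fun x _ => df x) fc.
by rewrite normrM ler_wpM2r.
Qed.

Lemma test_lipschitz f : test_fun f ->
  exists2 M, 0 <= M & forall s t, `|f t - f s| <= M * `|t - s|.
Proof.
move=> /test_derive[f' [df /test_bounded[M M0 fM]]]; exists M => //.
exact: derive_lipschitz fM.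
Qed.

(** The mean value theorem for the remainder as a function of [t], whose
    derivative is bounded by the Lipschitz constant of [f'] times [`|t|]. *)
Lemma test_taylor f f' : test_fun f -> (forall s : R, is_derive s (1 : R) f (f' s)) ->
  exists2 M, 0 <= M & forall s t, `|f (s + t) - f s - t * f' s| <= M * `|t| ^+ 2.
Proof.
move=> ft df.
have f't : test_fun f'.
  have [g [dg gt]] := test_derive ft; suff -> : f' = g by [].
  apply/funext => s; have h := df s; have h' := dg s.
  by rewrite -(@derive_val _ _ _ _ _ _ _ h) -(@derive_val _ _ _ _ _ _ _ h').
have [M M0 hM] := test_lipschitz f't; exists M => // s t.
pose g u := f (s + u) - u * f' s.
have dg u : is_derive u (1 : R) g (f' (s + u) - f' s).
  have d1 : is_derive u (1 : R) (fun u => f (s + u)) (f' (s + u)).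
    have dsh : is_derive u (1 : R) (fun u : R => s + u) 1.
      by apply: (is_derive_eq (is_deriveD (is_derive_cst s u (1 : R))
        (is_derive_id u (1 : R)))); rewrite add0r.
    by have := is_derive1_comp (df (s + u)) dsh; rewrite mulr1.
  have d2 : is_derive u (1 : R) (fun u : R => u * f' s) (f' s).
    by apply: is_derive_eq; rewrite scaler0 add0r /GRing.scale /= mulr1.
  exact: is_deriveB d1 d2.
have gc (a b : R) : {within `[a, b], continuous g}.
  apply: continuous_subspaceT => x; apply: differentiable_continuous.
  by apply/derivable1_diffP; have := dg x; case.
have -> : f (s + t) - f s - t * f' s = g t - g 0.
  by rewrite /g addr0 mul0r subr0; ring.
have bound c : `|c| <= `|t| -> `|f' (s + c) - f' s| <= M * `|t|.
  move=> ct; apply: le_trans (hM _ _) _; rewrite ler_wpM2l //.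
  by rewrite addrAC subrr add0r.
have [t0|t0] := leP 0 t.
  have [c] := MVT_segment t0 (fun x _ => dg x) (gc _ _).
  rewrite in_itv /= => /andP[c0 ct] ->; rewrite subr0 normrM expr2 mulrA ler_wpM2r //.
  by apply: bound; rewrite !ger0_norm.
have [c] := MVT_segment (ltW t0) (fun x _ => dg x) (gc _ _).
rewrite in_itv /= => /andP[tc c0] e; rewrite distrC e sub0r normrM normrN expr2 mulrA.
by rewrite ler_wpM2r //; apply: bound; rewrite !ler0_norm ?(ltW t0) // lerN2.
Qed.

Lemma test_mul_id f : test_fun f -> test_fun (fun s => s * f s).
Proof.
move=> [fs f0]; split=> [n|s s1]; last by rewrite f0 // mulr0.
exact: CsmoothM (@Csmooth_id n) (fs n).
Qed.

Lemma test_scale (a : R) f : test_fun f -> test_fun (fun s => a * f s).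
Proof.
move=> [fs f0]; split=> [n|s s1]; last by rewrite f0 // mulr0.
exact: CsmoothM (Csmooth_cst n a) (fs n).
Qed.

End SmoothFunctions.

(** * Vector-valued integrals *)

Section Integral.
Variables (R : realType) (V : completeNormedModType R[i]).
Implicit Types f g : R -> V.

Definition mesh N : R := 2^-1 ^+ N.

Lemma mesh_gt0 N : 0 < mesh N.
Proof. by rewrite exprn_gt0 // invr_gt0. Qed.

Lemma mesh_small (d : R) : 0 < d -> exists N, forall M, (N <= M)%N -> mesh M <= d.
Proof.
move=> d0; exists (Num.Def.archi_bound d^-1) => M hM.
have := upper_nthrootP hM; rewrite /mesh exprVn => h.
by rewrite -[leRHS]invrK lef_pV2 ?posrE ?invr_gt0 ?exprn_gt0 // ltW.
Qed.

Lemma mesh_mul N : mesh N * (2 ^ N)%:R = 1.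
Proof. by rewrite /mesh natrX -exprMn mulVf // expr1n. Qed.

Lemma meshD N m : mesh (N + m) = mesh N * mesh m.
Proof. exact: exprD. Qed.

(** Dyadic Riemann sums over the interval [-2, 2[ *)
Definition riemann N f : V :=
  (mesh N)%:C *: \sum_(0 <= k < 2 ^ N.+2) f (- 2 + k%:R * mesh N).

Definition uniformly_continuous f :=
  forall e : R, 0 < e -> exists2 d, 0 < d &
    forall s t, `|s - t| <= d -> nrm (f s - f t) <= e.

Lemma nrm_riemann N f (b : R -> R) : (forall s, nrm (f s) <= b s) ->
  nrm (riemann N f) <= mesh N * \sum_(0 <= k < 2 ^ N.+2) b (- 2 + k%:R * mesh N).
Proof.
move=> fb; rewrite nrmZr ger0_norm ?(ltW (mesh_gt0 N)) // ler_wpM2l ?(ltW (mesh_gt0 N)) //.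
by apply: le_trans (nrm_sum _ _ _) _; apply: ler_sum.
Qed.

Lemma riemann_le N f (M : R) : (forall s, nrm (f s) <= M) -> nrm (riemann N f) <= 4 * M.
Proof.
move=> fM; apply: le_trans (nrm_riemann N fM) _.
rewrite big_const_nat subn0 iter_addr_0 -(mulr_natr M) mulrCA !expnS mulnA natrM.
by rewrite [_ * (4%:R * _)]mulrCA mesh_mul mulr1 mulrC.
Qed.

Lemma riemannD N f g : riemann N (fun s => f s + g s) = riemann N f + riemann N g.
Proof. by rewrite /riemann big_split scalerDr. Qed.

Lemma riemannZ N (a : R[i]) f : riemann N (fun s => a *: f s) = a *: riemann N f.
Proof. by rewrite /riemann -scaler_sumr !scalerA mulrC. Qed.

Lemma riemannB N f g : riemann N (fun s => f s - g s) = riemann N f - riemann N g.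
Proof. by rewrite /riemann sumrB scalerBr. Qed.

(** Each value of the coarse sum is repeated [2 ^ m] times, and then compared
    with the values of the fine sum in the same cell. *)
Lemma riemann_refine N m f (e : R) :
  (forall s t, `|s - t| <= mesh N -> nrm (f s - f t) <= e) ->
  nrm (riemann (N + m) f - riemann N f) <= 4 * e.
Proof.
move=> fe.
have e0 : 0 <= e by apply: le_trans (fe 0 0 _); rewrite ?nrm_ge0 // subrr normr0 ltW ?mesh_gt0.
have -> : riemann N f = (mesh (N + m))%:C *: \sum_(0 <= i < 2 ^ N.+2)
    \sum_(i * 2 ^ m <= j < i.+1 * 2 ^ m) f (- 2 + i%:R * mesh N).
  have e1 i : \sum_(i * 2 ^ m <= j < i.+1 * 2 ^ m) f (- 2 + i%:R * mesh N) =
      ((2 ^ m)%:R : R)%:C *: f (- 2 + i%:R * mesh N).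
    by rewrite big_const_nat -mulnBl subSnn mul1n iter_addr_0 rmorph_nat scaler_nat.
  under eq_bigr do rewrite e1.
  by rewrite -scaler_sumr scalerA -rmorphM meshD -mulrA mesh_mul mulr1.
rewrite /riemann (_ : 2 ^ (N + m).+2 = 2 ^ N.+2 * 2 ^ m)%N; last by rewrite -expnD.
rewrite big_nat_mul -scalerBr -sumrB nrmZr ger0_norm ?(ltW (mesh_gt0 _)) //.
apply: le_trans (_ : mesh (N + m) * (((2 ^ N.+2) * 2 ^ m)%:R * e) <= _); last first.
  rewrite -expnD !addSn !expnS !natrM mulrA mulrCA -!mulrA.
  have := mesh_mul (N + m); set a := mesh _; set b := _%:R => ab.
  have -> : 2 * (a * (2 * (b * e))) = 4 * e * (a * b) by ring.
  by rewrite ab mulr1.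
rewrite ler_wpM2l ?(ltW (mesh_gt0 _)) //; apply: le_trans (nrm_sum _ _ _) _.
apply: le_trans (_ : \sum_(0 <= i < 2 ^ N.+2) (2 ^ m)%:R * e <= _); last first.
  by rewrite big_const_nat subn0 iter_addr_0 natrM -[leLHS]mulr_natl mulrA.
apply: ler_sum => i _; rewrite -sumrB; apply: le_trans (nrm_sum _ _ _) _.
apply: le_trans (_ : \sum_(i * 2 ^ m <= j < i.+1 * 2 ^ m) e <= _); last first.
  by rewrite big_const_nat -mulnBl subSnn mul1n iter_addr_0 mulr_natl.
rewrite !big_nat; apply: ler_sum => j /andP[ij ji]; apply: fe.
have e2 (a b : R) : - 2 + a - (- 2 + b) = a - b by ring.
have hN : mesh N = (2 ^ m)%:R * (mesh N * mesh m).
  by rewrite mulrCA [_ * mesh m]mulrC mesh_mul mulr1.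
rewrite e2 meshD; move: hN; set h := mesh N * mesh m => ->.
have h0 : 0 < h by rewrite mulr_gt0 ?mesh_gt0.
rewrite mulrA -mulrBl normrM (gtr0_norm h0) ler_pM2r // -natrM ger0_norm ?subr_ge0 ?ler_nat //.
by rewrite lerBlDr -natrD ler_nat; move: ji; rewrite mulSn => /ltnW.
Qed.

Definition integral f : V := lim (riemann N f @[N --> \oo]).

Lemma integral_cvg f : uniformly_continuous f -> riemann N f @[N --> \oo] --> integral f.
Proof.
move=> fu; suff : cvg (riemann N f @[N --> \oo]) by [].
apply: cauchy_cvg; apply/cauchy_nrmP => e e0.
have e8 : 0 < e / 8 by rewrite divr_gt0.
have [d d0 hd] := fu _ e8; have [N hN] := mesh_small d0.
have near_N k : nrm (riemann (N + k) f - riemann N f) <= 4 * (e / 8).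
  by apply: riemann_refine => s t st; apply/hd/(le_trans st)/hN.
exists [set riemann k f | k in [set k | (N <= k)%N]]; split.
  by exists N => // k Nk; exists k.
move=> _ _ [k Nk <-] [l Nl <-]; apply: le_trans (nrm_le_tri _ (riemann N f) _) _.
have := near_N (k - N)%N; have := near_N (l - N)%N; rewrite !subnKC //.
rewrite (nrmB (riemann N f)); lra.
Qed.

Lemma integral_lim f l : riemann N f @[N --> \oo] --> l -> integral f = l.
Proof. by move=> h; apply: cvg_lim h; exact: norm_hausdorff. Qed.

Lemma uniformly_continuousD f g : uniformly_continuous f -> uniformly_continuous g ->
  uniformly_continuous (fun s => f s + g s).
Proof.
move=> fu gu e e0; have e2 : 0 < e / 2 by rewrite divr_gt0.
have [d d0 hd] := fu _ e2; have [c c0 hc] := gu _ e2.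
exists (Num.min d c) => [|s t]; first by rewrite lt_min d0.
rewrite le_min => /andP[/hd h1 /hc h2].
rewrite opprD addrACA; apply: le_trans (nrmD _ _) _; lra.
Qed.

Lemma uniformly_continuousZ (a : R[i]) f : uniformly_continuous f ->
  uniformly_continuous (fun s => a *: f s).
Proof.
move=> fu e e0; have a0 : 0 < nrm a + 1 by rewrite ltr_wpDl ?nrm_ge0.
have e2 : 0 < e / (nrm a + 1) by rewrite divr_gt0.
have [d d0 hd] := fu _ e2; exists d => // s t /hd h.
rewrite -scalerBr nrmZ mulrC; apply: le_trans (ler_pM _ _ h (_ : _ <= nrm a + 1)) _;
  rewrite ?nrm_ge0 // ?lerDl //.
by rewrite divfK // gt_eqF.
Qed.

Lemma integralD f g : uniformly_continuous f -> uniformly_continuous g ->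
  integral (fun s => f s + g s) = integral f + integral g.
Proof.
move=> /integral_cvg hf /integral_cvg hg; apply: integral_lim.
by under eq_fun do rewrite riemannD; exact: cvgD.
Qed.

Lemma integralZ (a : R[i]) f : uniformly_continuous f ->
  integral (fun s => a *: f s) = a *: integral f.
Proof.
move=> /integral_cvg hf; apply: integral_lim.
by under eq_fun do rewrite riemannZ; exact: cvgZr.
Qed.

Lemma integral_le f (M : R) : uniformly_continuous f ->
  (forall s, nrm (f s) <= M) -> nrm (integral f) <= 4 * M.
Proof.
move=> /integral_cvg hf fM; rewrite -[integral f]subr0.
by apply: nrm_le_cvg hf _; apply: nearW => N; rewrite subr0; exact: riemann_le.
Qed.

Lemma integral_isometry (L : {linear V -> V}) f : (forall v, nrm (L v) = nrm v) ->
  uniformly_continuous f -> L (integral f) = integral (fun s => L (f s)).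
Proof.
move=> Ln /integral_cvg /cvg_nrmP hf; apply/esym/integral_lim/cvg_nrmP => e e0.
apply: filterS (hf e e0) => N; rewrite -Ln linearB; congr (nrm (_ - _) <= _).
by rewrite /riemann linearZ /= linear_sum.
Qed.

Lemma uniformly_continuous_shift (t : R) f : uniformly_continuous f ->
  uniformly_continuous (fun s => f (s + t)).
Proof.
move=> fu e /fu[d d0 hd]; exists d => // s s' ss'.
by apply: hd; rewrite opprD addrACA subrr addr0.
Qed.

Lemma sum_shift (F : nat -> V) m j : (forall k, (k < j)%N -> F k = 0) ->
  (forall k, (m <= k)%N -> F k = 0) ->
  \sum_(0 <= k < m) F (k + j)%N = \sum_(0 <= k < m) F k.
Proof.
move=> F1 F2; rewrite -[in LHS](subnK (leq0n m)).
have -> : \sum_(0 <= k < m - 0 + 0) F (k + j)%N = \sum_(j <= k < m + j) F k.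
  by rewrite subn0 addn0 -{2}[j]add0n big_addn addnK.
have [mj|jm] := leqP m j.
  rewrite !big_nat big1 => [|k /andP[jk _]]; last by apply: F2; exact: leq_trans jk.
  by rewrite big1 // => k /andP[_ km]; apply: F1; exact: leq_trans mj.
rewrite (@big_cat_nat _ _ _ m) //= ?leq_addr ?(ltnW jm) //.
rewrite [X in _ + X]big_nat [X in _ + X]big1 => [|k /andP[mk _]]; last exact: F2.
rewrite [RHS](@big_cat_nat _ _ _ j) //= ?(ltnW jm) // [X in _ = X + _]big_nat.
by rewrite [X in _ = X + _]big1 ?addr0 ?add0r // => k /andP[_ kj]; exact: F1.
Qed.

(** The shift is approximated by a multiple of the mesh, for which the Riemann
    sums only lose terms outside of the support. *)
Lemma integral_shift_ge0 (t : R) f : 0 <= t <= 2^-1 -> uniformly_continuous f ->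
  (forall s, 3 / 2 < `|s| -> f s = 0) ->
  integral (fun s => f (s + t)) = integral f.
Proof.
move=> /andP[t0 t1] fu f0; apply/eqP; rewrite -subr_eq0; apply/eqP/nrm_eq0/eqP.
rewrite eq_le nrm_ge0 andbT; apply/ler_addgt0Pr => e e0; rewrite add0r.
have e4 : 0 < e / 4 by rewrite divr_gt0.
have [d d0 hd] := fu _ e4; have [N hN] := mesh_small d0.
rewrite -[_ - _]subr0.
have hc : riemann N (fun s => f (s + t)) - riemann N f @[N --> \oo] -->
    integral (fun s => f (s + t)) - integral f.
  apply: cvgB; last exact: integral_cvg.
  exact/integral_cvg/uniformly_continuous_shift.
apply: (@nrm_le_cvg R V nat \oo _ _ _ 0 e hc).
exists N => // M NM; rewrite /= subr0.
pose j := Num.truncn (t * (2 ^ M)%:R).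
have t2 : 0 <= t * (2 ^ M)%:R by rewrite mulr_ge0.
have /andP[j1 j2] := truncn_itv t2; rewrite -/j in j1 j2.
have M0 := mesh_gt0 M; have MM := mesh_mul M.
have et : t * (2 ^ M)%:R * mesh M = t by rewrite -mulrA [_ * mesh M]mulrC MM mulr1.
have tj1 : j%:R * mesh M <= t by rewrite -[leRHS]et ler_pM2r.
have tj2 : t <= j%:R * mesh M + mesh M.
  by rewrite -[leLHS]et -[X in _ + X]mul1r -mulrDl natr1 ler_pM2r // ltW.
have eN : (2 ^ M.+2)%:R * mesh M = 4.
  by rewrite !expnS mulnA natrM -mulrA [_ * mesh M]mulrC MM mulr1.
have -> : riemann M f = riemann M (fun s => f (s + j%:R * mesh M)).
  rewrite /riemann; congr (_ *: _).
  rewrite -[LHS](@sum_shift (fun k => f (- 2 + k%:R * mesh M)) _ j) => [|k kj|k mk].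
  - by apply: eq_bigr => k _; rewrite natrD mulrDl addrA.
  - have kt : k%:R * mesh M <= 2^-1.
      by apply: le_trans t1; apply: le_trans tj1; rewrite ler_pM2r // ler_nat ltnW.
    have : k%:R * mesh M + mesh M <= 2^-1.
      apply: le_trans t1; apply: le_trans tj1.
      by rewrite -[X in _ + X]mul1r -mulrDl natr1 ler_pM2r // ler_nat.
    by move=> h; apply: f0; rewrite ltr0_norm; lra.
  - have h : 4 <= k%:R * mesh M by rewrite -eN ler_pM2r // ler_nat.
    by apply: f0; rewrite ger0_norm; lra.
rewrite -riemannB (_ : e = 4 * (e / 4)); last by field.
apply: riemann_le => s; apply: hd.
rewrite opprD addrACA subrr add0r ger0_norm ?subr_ge0 //.
by apply: le_trans (hN M NM); lra.
Qed.

Lemma integral_shift (t : R) f : `|t| <= 2^-1 -> uniformly_continuous f ->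
  (forall s, 3 / 2 < `|s| -> f s = 0) -> (forall s, 3 / 2 < `|s| -> f (s + t) = 0) ->
  integral (fun s => f (s + t)) = integral f.
Proof.
move=> th fu f0 ft0; have [t0|t0] := leP 0 t.
  by apply: integral_shift_ge0 => //; rewrite t0 -[t]ger0_norm.
have h : 0 <= - t <= 2^-1 by rewrite oppr_ge0 ltW //= -ltr0_norm.
have := integral_shift_ge0 h (uniformly_continuous_shift t fu) ft0.
by under [in LHS]eq_fun do rewrite subrK.
Qed.

End Integral.

(** * Garding vectors *)

Section Garding.
Variables (R : realType) (E : hilbert R) (pi : heis R -> {linear E -> E}).
Hypothesis pi_rep : is_unitary_rep pi.
Implicit Types (u v w : E) (f : R -> R).

Let P := basisP R.
Let Q := basisQ R.
Let Z := basisZ R.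

Lemma orbit_near0 x v (e : R) : 0 < e ->
  exists2 d, 0 < d & forall t, `|t| <= d -> nrm (pi (t *: x) v - v) <= e.
Proof.
move=> e0.
have hx : t *: x @[t --> (0 : R)] --> (0 : heis R).
  by rewrite -[X in _ --> X](scale0r x); apply: cvgZl; exact: cvg_id.
have h : pi (t *: x) v @[t --> (0 : R)] --> pi 0 v.
  exact: cvg_comp hx (@rep_cont _ _ _ pi_rep v (0 : heis R)).
have /cvg_nrmP/(_ e e0) := h; rewrite (rep0 pi_rep).
move=> /nbhs_ballP[d /= d0 hd]; exists (d / 2); first by rewrite divr_gt0.
move=> t td; apply: hd; rewrite -ball_normE /= sub0r normrN.
by apply: le_lt_trans td _; rewrite ltr_pdivrMr // ltr_pMr // ltr1n.
Qed.

Lemma test_orbit_uc x f v : test_fun f ->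
  uniformly_continuous (fun s => (f s)%:C *: pi (s *: x) v).
Proof.
move=> ft e e0.
have [M M0 fM] := test_bounded ft; have [L L0 fL] := test_lipschitz ft.
have M1 : 0 < M + 1 by rewrite ltr_wpDl.
have e1 : 0 < e / 2 / (M + 1) by rewrite !divr_gt0.
have [d d0 hd] := orbit_near0 x v e1.
have c0 : 0 < L * nrm v + 1 by rewrite ltr_wpDl // mulr_ge0 // nrm_ge0.
exists (Num.min d (e / 2 / (L * nrm v + 1))); first by rewrite lt_min d0 !divr_gt0.
move=> s t; rewrite le_min => /andP[std ste].
have -> : (f s)%:C *: pi (s *: x) v - (f t)%:C *: pi (t *: x) v =
    (f s)%:C *: (pi (s *: x) v - pi (t *: x) v) + (f s - f t)%:C *: pi (t *: x) v.
  by rewrite scalerBr rmorphB /= scalerBl addrA subrK.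
apply: le_trans (nrmD _ _) _; rewrite (splitr e) lerD // nrmZr.
  have -> : pi (s *: x) v - pi (t *: x) v = pi (t *: x) (pi ((s - t) *: x) v - v).
    by rewrite linearB -(rep_addZ pi_rep) [t + _]addrC subrK.
  rewrite (rep_nrm pi_rep).
  apply: le_trans (ler_pM (normr_ge0 _) (nrm_ge0 _) (_ : _ <= M + 1) (hd _ std)) _.
    by apply: le_trans (fM s) _; rewrite lerDl.
  by rewrite mulrC divfK // gt_eqF.
rewrite (rep_nrm pi_rep) distrC.
apply: le_trans (ler_wpM2r (nrm_ge0 v) (fL _ _)) _; rewrite distrC.
rewrite mulrAC; apply: le_trans (ler_wpM2r (normr_ge0 _) (_ : _ <= L * nrm v + 1)) _.
  by rewrite lerDl.
by rewrite mulrC -ler_pdivlMr.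
Qed.

Definition smear x f v : E := integral (fun s => (f s)%:C *: pi (s *: x) v).

(** Everything about generators on smeared vectors reduces to a bound on the
    integrand that is uniform in the integration variable. *)
Lemma gen_smear y x f v g (r : R -> R -> E) : test_fun f ->
  uniformly_continuous g ->
  (\forall t \near (0 : R), uniformly_continuous (r t) /\
     pi (t *: y) (smear x f v) - smear x f v - t%:C *: integral g = integral (r t)) ->
  (forall e, 0 < e -> \forall t \near (0 : R), forall s, nrm (r t s) <= e * `|t|) ->
  gen pi y (smear x f v) (integral g).
Proof.
move=> ft gu h1 h2 e e0; have e4 : 0 < e / 4 by rewrite divr_gt0.
apply: filterS2 h1 (h2 _ e4) => t [ru ->] hr.
by apply: le_trans (integral_le ru hr) _; rewrite mulrA (mulrC 4) divfK.
Qed.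

Lemma smear_isometry y x f v : test_fun f ->
  pi y (smear x f v) = integral (fun s => (f s)%:C *: pi y (pi (s *: x) v)).
Proof.
move=> ft; rewrite /smear (integral_isometry (rep_nrm pi_rep y) (test_orbit_uc x v ft)).
by under eq_fun do rewrite linearZ.
Qed.

Lemma uc_isometry (L : {linear E -> E}) (g : R -> E) :
  (forall v, nrm (L v) = nrm v) -> uniformly_continuous g ->
  uniformly_continuous (fun s => L (g s)).
Proof.
move=> Ln gu e /gu[d d0 hd]; exists d => // s t /hd.
by rewrite -linearB Ln.
Qed.

(** Differentiating a smeared vector along its own direction falls on the test
    function. *)
Lemma gen_smear_self x f f' v : test_fun f -> test_fun f' ->
  (forall s : R, is_derive s (1 : R) f (f' s)) ->
  gen pi x (smear x f v) (- smear x f' v).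
Proof.
move=> ft f't df; have [M M0 hM] := test_taylor ft df.
have fu := test_orbit_uc x v ft; have f'u := test_orbit_uc x v f't.
have eN : - smear x f' v = integral (fun s => (-1) *: ((f' s)%:C *: pi (s *: x) v)).
  by rewrite integralZ // scaleN1r.
rewrite eN; apply: (gen_smear (r := fun t s =>
  (f (s - t) - f s + t * f' s)%:C *: pi (s *: x) v)) => //.
- exact: uniformly_continuousZ.
- apply: (near0P (d := 2^-1)) => [|t /ltW t2]; first by rewrite invr_gt0.
  have shu : uniformly_continuous (fun s => (f (s - t))%:C *: pi (s *: x) v).
    have := uniformly_continuous_shift (- t) (uc_isometry (rep_nrm pi_rep (t *: x)) fu).
    move=> h e /h[d d0 hd]; exists d => // s s' /hd.
    by rewrite !linearZ /= -!(rep_addZ pi_rep) !(addrC t) !subrK.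
  have er s : (f (s - t) - f s + t * f' s)%:C *: pi (s *: x) v =
      ((f (s - t))%:C *: pi (s *: x) v + (-1) *: ((f s)%:C *: pi (s *: x) v)) +
      t%:C *: ((f' s)%:C *: pi (s *: x) v).
    by rewrite rmorphD rmorphB rmorphM /= scalerDl scalerBl scaleN1r scalerA.
  have u1 := uniformly_continuousZ (-1) fu.
  have u2 := uniformly_continuousZ t%:C f'u.
  split.
    move=> e /(uniformly_continuousD (uniformly_continuousD shu u1) u2)[d d0 hd].
    by exists d => // s s' /hd; rewrite !er.
  under [in RHS]eq_fun do rewrite er.
  rewrite integralD //; last exact: uniformly_continuousD.
  rewrite integralD // !integralZ // scaleN1r scaleN1r scalerN opprK.
  congr (_ - _ + _); rewrite smear_isometry //.
  rewrite -(integral_shift t2 shu) => [|s s1|s s1].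
  + by congr integral; apply/funext => s; rewrite addrK -(rep_addZ pi_rep) addrC.
  + have [_ ->] := ft; first by rewrite scale0r.
    have := ler_distD t s 0; rewrite !subr0; lra.
  + have [_ ->] := ft; first by rewrite scale0r.
    by rewrite addrK; lra.
move=> e e0; have c0 : 0 < M * nrm v + 1 by rewrite ltr_wpDl // mulr_ge0 // nrm_ge0.
apply: (near0P (d := e / (M * nrm v + 1))) => [|t te s]; first by rewrite divr_gt0.
rewrite nrmZr (rep_nrm pi_rep).
have := hM s (- t); rewrite mulNr opprK normrN => h.
apply: le_trans (ler_wpM2r (nrm_ge0 v) h) _.
rewrite expr2 mulrAC mulrA ler_wpM2r //.
apply: le_trans (ler_wpM2r (normr_ge0 t) (_ : _ <= M * nrm v + 1)) _.
  by rewrite lerDl.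
by rewrite mulrC -ler_pdivlMr // ltW.
Qed.

(** [P] moves past [exp (s Q)] at the price of [s Z]. *)
Lemma gen_smearQ_P f u a c : test_fun f -> gen pi P u a -> gen pi Z u c ->
  gen pi P (smear Q f u) (smear Q f a + smear Q (fun s => s * f s) c).
Proof.
move=> ft ga gc; have sft := test_mul_id ft.
have [M M0 fM] := test_bounded ft.
have uu := test_orbit_uc Q u ft; have ua := test_orbit_uc Q a ft.
have uc := test_orbit_uc Q c sft.
rewrite /smear -(integralD ua uc).
pose r0 t s := pi (t *: P) (pi ((t * s) *: Z) u - u - (t * s)%:C *: c) +
  (pi (t *: P) u - u - t%:C *: a) + (t * s)%:C *: (pi (t *: P) c - c).
have comm t s v : pi (t *: P) (pi (s *: Q) v) =
    pi (s *: Q) (pi (t *: P) (pi ((t * s) *: Z) v)).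
  rewrite -!(rep_mul pi_rep); congr (pi _ _).
  apply: heis_eq; rewrite /heis_mul /bracket /coordP /coordQ /coordZ /=;
    rewrite /GRing.scale /=; by field.
apply: (gen_smear (r := fun t s => (f s)%:C *: pi (s *: Q) (r0 t s))) => //.
- exact: uniformly_continuousD.
- apply: near0W => t.
  have er s : (f s)%:C *: pi (s *: Q) (r0 t s) =
      (pi (t *: P) ((f s)%:C *: pi (s *: Q) u) + (-1) *: ((f s)%:C *: pi (s *: Q) u)) +
      (- t)%:C *: ((f s)%:C *: pi (s *: Q) a + (s * f s)%:C *: pi (s *: Q) c).
    have -> : r0 t s = pi (t *: P) (pi ((t * s) *: Z) u) - u - t%:C *: a - (t * s)%:C *: c.
      rewrite /r0 !linearB linearZ /=; abel.
    rewrite !linearB !linearZ /= -comm !(rmorphN, rmorphM) /=.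
    rewrite !(scalerN, scalerDr, scalerBr, scalerA, mulrN, mulr1, mulNr, scaleNr).
    rewrite [(f s)%:C * t%:C]mulrC [(f s)%:C * (t%:C * s%:C)]mulrC -[t%:C * _ * _]mulrA.
    abel.
  have u1 := uc_isometry (rep_nrm pi_rep (t *: P)) uu.
  have u2 := uniformly_continuousZ (-1) uu.
  have u3 := uniformly_continuousZ (- t)%:C (uniformly_continuousD ua uc).
  split.
    move=> e /(uniformly_continuousD (uniformly_continuousD u1 u2) u3)[d d0 hd].
    by exists d => // s s' /hd; rewrite !er.
  under [in RHS]eq_fun do rewrite er.
  have uac := uniformly_continuousD ua uc.
  rewrite (integralD (uniformly_continuousD u1 u2) u3) (integralD u1 u2).
  rewrite (integralZ _ uu) (integralZ _ uac).
  by rewrite scaleN1r rmorphN scaleNr (integral_isometry (rep_nrm pi_rep _) uu).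
move=> e e0; have M1 : 0 < M + 1 by rewrite ltr_wpDl.
have e1 : 0 < e / (M + 1) / 3 by rewrite !divr_gt0.
have /nbhs_ballP[d /= d0 hd] := gc _ e1.
have [d' d'0 hd'] := orbit_near0 P c e1.
near=> t => s; have [s1|s1] := ltP 1 `|s|.
  by have [_ ->] := ft; rewrite // scale0r nrm0 mulr_ge0 // ltW.
have b1 : nrm (pi ((t * s) *: Z) u - u - (t * s)%:C *: c) <= e / (M + 1) / 3 * `|t|.
  have tsd : ball (0 : R) d (t * s).
    rewrite -ball_normE /= sub0r normrN normrM.
    apply: le_lt_trans (_ : `|t| < d); first by rewrite ler_piMr.
    by near: t; apply: (near0P d0).
  apply: le_trans (hd _ tsd) _; rewrite ler_wpM2l ?(ltW e1) // normrM.
  by rewrite ler_piMr.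
have b2 : nrm (pi (t *: P) u - u - t%:C *: a) <= e / (M + 1) / 3 * `|t|.
  by near: t; exact: ga.
have b3 : nrm ((t * s)%:C *: (pi (t *: P) c - c)) <= e / (M + 1) / 3 * `|t|.
  rewrite nrmZr mulrC; apply: ler_pM; rewrite ?nrm_ge0 //; last by rewrite normrM ler_piMr.
  by apply: hd'; near: t; apply: (near0P d'0) => t /ltW.
rewrite nrmZr (rep_nrm pi_rep).
have b : nrm (r0 t s) <= e / (M + 1) * `|t|.
  apply: le_trans (nrmD _ _) _; apply: le_trans (lerD (nrmD _ _) (lexx _)) _.
  rewrite (rep_nrm pi_rep); lra.
apply: le_trans (ler_pM (normr_ge0 _) (nrm_ge0 _) (_ : _ <= M + 1) b) _.
  by apply: le_trans (fM s) _; rewrite lerDl.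
by rewrite mulrA [_ * (e / _)]mulrC divfK // gt_eqF.
Unshelve. all: by end_near. Qed.

(** Generators along a commuting direction pass under the integral. *)
Lemma gen_smear_comm x y f u w : test_fun f ->
  (forall t s v, pi (t *: y) (pi (s *: x) v) = pi (s *: x) (pi (t *: y) v)) ->
  gen pi y u w -> gen pi y (smear x f u) (smear x f w).
Proof.
move=> ft comm gw; have [M M0 fM] := test_bounded ft.
have uu := test_orbit_uc x u ft; have uw := test_orbit_uc x w ft.
apply: (gen_smear (r := fun t s =>
  (f s)%:C *: pi (s *: x) (pi (t *: y) u - u - t%:C *: w))) => //.
- apply: near0W => t.
  have er s : (f s)%:C *: pi (s *: x) (pi (t *: y) u - u - t%:C *: w) =
      (pi (t *: y) ((f s)%:C *: pi (s *: x) u) + (-1) *: ((f s)%:C *: pi (s *: x) u)) +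
      (- t)%:C *: ((f s)%:C *: pi (s *: x) w).
    rewrite !linearB !linearZ /= -comm !rmorphN /=.
    rewrite !(scalerN, scalerBr, scalerA, mulrN, mulr1, mulNr, scaleNr).
    rewrite [(f s)%:C * t%:C]mulrC.
    abel.
  have u1 := uc_isometry (rep_nrm pi_rep (t *: y)) uu.
  have u2 := uniformly_continuousZ (-1) uu.
  have u3 := uniformly_continuousZ (- t)%:C uw.
  split.
    move=> e /(uniformly_continuousD (uniformly_continuousD u1 u2) u3)[d d0 hd].
    by exists d => // s s' /hd; rewrite !er.
  under [in RHS]eq_fun do rewrite er.
  rewrite integralD //; last exact: uniformly_continuousD.
  rewrite integralD // !integralZ //.
  by rewrite scaleN1r rmorphN scaleNr (integral_isometry (rep_nrm pi_rep _) uu).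
move=> e e0; have M1 : 0 < M + 1 by rewrite ltr_wpDl.
have e1 : 0 < e / (M + 1) by rewrite divr_gt0.
apply: filterS (gw _ e1) => t ht s; rewrite nrmZr (rep_nrm pi_rep).
apply: le_trans (ler_pM (normr_ge0 _) (nrm_ge0 _) (_ : _ <= M + 1) ht) _.
  by apply: le_trans (fM s) _; rewrite lerDl.
by rewrite mulrA [_ * (e / _)]mulrC divfK // gt_eqF.
Qed.

Lemma gen_smear_dir x f : test_fun f ->
  exists2 f', test_fun f' & forall v, gen pi x (smear x f v) (smear x f' v).
Proof.
move=> ft; have [f' [df f't]] := test_derive ft.
exists (fun s => -1 * f' s) => [|v]; first exact: test_scale.
suff -> : smear x (fun s => -1 * f' s) v = - smear x f' v by exact: gen_smear_self.
rewrite -[RHS]scaleN1r /smear -integralZ; last exact: test_orbit_uc.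
by congr integral; apply/funext => s; rewrite rmorphM rmorphN1 scalerA.
Qed.

(** Narrow normalised bumps are an approximate identity. *)
Lemma smear_approx x v (e : R) : 0 < e ->
  exists2 f, test_fun f & nrm (smear x f v - v) <= e.
Proof.
move=> e0; have [d d0 hd] := orbit_near0 x v e0.
pose r := Num.min d 1.
have r0 : 0 < r by rewrite lt_min d0 ltr01.
have bt : test_fun (bump r) by apply: bump_test; rewrite r0 ge_min lexx orbT.
have [m m0 hm] := bump_lower r0.
have r2 : 0 < r / 2 by rewrite divr_gt0.
have [a ha] := mesh_small r2.
pose S N : R := mesh R N * \sum_(0 <= k < 2 ^ N.+2) bump r (- 2 + k%:R * mesh R N).
have bu : uniformly_continuous (fun s => (bump r s)%:C : scalars R).
  move=> e' e'0; have [L L0 hL] := test_lipschitz bt.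
  have L1 : 0 < L + 1 by rewrite ltr_wpDl.
  exists (e' / (L + 1)) => [|s t st]; first by rewrite divr_gt0.
  rewrite -rmorphB nrm_real; apply: le_trans (hL t s) _.
  apply: le_trans (ler_wpM2r (normr_ge0 _) (_ : _ <= L + 1)) _; first by rewrite lerDl.
  by rewrite mulrC -ler_pdivlMr.
have S0 N : 0 <= S N.
  by rewrite mulr_ge0 ?(ltW (mesh_gt0 R N)) // sumr_ge0 // => *; exact: bump_ge0.
have eS N : riemann N (fun s => (bump r s)%:C : scalars R) = (S N)%:C.
  by rewrite /riemann /S rmorphM rmorph_sum.
pose c := nrm (integral (fun s => (bump r s)%:C : scalars R)).
have Sc : S N @[N --> \oo] --> c.
  have -> : S = (fun N => nrm (riemann N (fun s => (bump r s)%:C : scalars R))).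
    by apply/funext => N; rewrite eS nrm_real ger0_norm.
  exact: cvg_nrm _ (integral_cvg bu).
have Slow N : (a <= N)%N -> mesh R a * m <= S N.
  move=> aN; have M0 := mesh_gt0 R N; have MM := mesh_mul R N.
  have -> : mesh R a = mesh R N * (2 ^ (N - a))%:R.
    by rewrite -{1}(subnKC aN) meshD -mulrA mesh_mul mulr1.
  rewrite -mulrA ler_wpM2l ?(ltW M0) //.
  have le1 : (2 ^ N.+1 + 2 ^ (N - a) <= 2 ^ N.+2)%N.
    rewrite (expnS _ N.+1) mul2n -addnn leq_add2l leq_pexp2l //.
    by rewrite (leq_trans (leq_subr _ _)).
  rewrite [leRHS](@big_cat_nat _ _ _ (2 ^ N.+1)%N) //= ?leq_pexp2l //.
  rewrite [X in _ <= _ + X](@big_cat_nat _ _ _ (2 ^ N.+1 + 2 ^ (N - a))%N) //= ?leq_addr //.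
  rewrite -[leLHS]add0r lerD ?sumr_ge0 // => [*|]; first exact: bump_ge0.
  rewrite -[leLHS]addr0 lerD ?sumr_ge0 // => [|*]; last exact: bump_ge0.
  apply: le_trans (_ : \sum_(2 ^ N.+1 <= k < 2 ^ N.+1 + 2 ^ (N - a)) m <= _).
    by rewrite big_const_nat addKn iter_addr_0 mulr_natl.
  rewrite !big_nat; apply: ler_sum => k /andP[k1 k2]; apply: hm.
  have e2 : 2 = (2 ^ N.+1)%:R * mesh R N.
    by rewrite expnS natrM -mulrA [_ * mesh R N]mulrC MM mulr1.
  have -> : - 2 + k%:R * mesh R N = (k - 2 ^ N.+1)%:R * mesh R N.
    by rewrite natrB // mulrBl -e2 addrC.
  rewrite normrM (gtr0_norm M0) ger0_norm //.
  apply: le_trans (ha a (leqnn a)).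
  have -> : mesh R a = (2 ^ (N - a))%:R * mesh R N.
    by rewrite -{2}(subnKC aN) meshD mulrCA [_ * mesh R (N - a)]mulrC mesh_mul mulr1.
  by rewrite ler_pM2r // ler_nat leq_subLR ltnW.
have c0 : 0 < c.
  apply: lt_le_trans (_ : mesh R a * m <= _); first by rewrite mulr_gt0 // mesh_gt0.
  by apply: (cvgr_to_ge Sc); exists a.
exists (fun s => c^-1 * bump r s); first exact: test_scale.
have vu := test_orbit_uc x v bt.
have -> : smear x (fun s => c^-1 * bump r s) v = (c^-1)%:C *: smear x (bump r) v.
  rewrite /smear -integralZ //.
  by congr integral; apply/funext => s; rewrite rmorphM scalerA.
have -> : (c^-1)%:C *: smear x (bump r) v - v = (c^-1)%:C *: (smear x (bump r) v - c%:C *: v).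
  by rewrite scalerBr scalerA -rmorphM mulVf ?gt_eqF // scale1r.
rewrite nrmZr gtr0_norm ?invr_gt0 // mulrC ler_pdivrMr //.
have hc : nrm (riemann N (fun s => (bump r s)%:C *: pi (s *: x) v) - (S N)%:C *: v)
    @[N --> \oo] --> nrm (smear x (bump r) v - c%:C *: v).
  apply: cvg_nrm; apply: cvgB; first exact: integral_cvg.
  apply: cvgZl; apply/(@cvg_nrmP R (R[i]^o : normedModType R[i])) => e' e'0.
  have /cvgrPdist_le/(_ _ e'0) := Sc; apply: filterS => N.
  by rewrite -rmorphB nrm_real distrC.
have heS : e * S N @[N --> \oo] --> e * c by apply: cvgM Sc; exact: cvg_cst.
apply: (ler_cvg_to hc heS).
apply: nearW => N.
have -> : (S N)%:C *: v = riemann N (fun s => (bump r s)%:C *: v).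
  by rewrite /riemann -scaler_suml scalerA -rmorph_sum -rmorphM.
rewrite -riemannB; apply: le_trans (nrm_riemann N (b := fun s => e * bump r s) _) _.
  move=> s; rewrite -scalerBr nrmZr ger0_norm ?bump_ge0 //.
  have [sr|sr] := ltP `|s| r; last by rewrite bump_supp // mul0r mulr0.
  rewrite mulrC ler_wpM2r ?bump_ge0 //; apply: hd.
  by apply: le_trans (ltW sr) _; rewrite ge_min lexx.
by rewrite -mulr_sumr mulrCA.
Qed.

(** Vectors on which all words of length at most [n] in the generators are
    defined; their intersection is the largest subspace invariant under the
    generators. *)
Fixpoint diff_vector n : set E :=
  match n with
  | 0%N => setT
  | n'.+1 => [set v | exists a b c, [/\ gen pi P v a, gen pi Q v b & gen pi Z v c] /\
      [/\ diff_vector n' a, diff_vector n' b & diff_vector n' c]]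
  end.

Definition generator_core : set E := [set v | forall n, diff_vector n v].

Lemma diff_vector_lin n (a : R[i]) u v : diff_vector n u -> diff_vector n v ->
  diff_vector n (a *: u + v).
Proof.
elim: n a u v => [//|n ih] a u v [x [y [z [[gx gy gz] [dx dy dz]]]]].
move=> [x' [y' [z' [[gx' gy' gz'] [dx' dy' dz']]]]].
exists (a *: x + x'), (a *: y + y'), (a *: z + z').
by split; split; by [exact: gen_lin|exact: ih].
Qed.

Lemma diff_vector0 n : diff_vector n 0.
Proof.
elim: n => [//|n ih]; exists 0, 0, 0.
by split; split=> //; exact: gen0.
Qed.

Lemma generator_core_subspace : is_subspace generator_core.
Proof.
split=> [|a u v /set_mem hu /set_mem hv]; apply/mem_set => n.
  exact: diff_vector0.
exact: diff_vector_lin.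
Qed.

Lemma generator_core_inv v : generator_core v -> exists a b c,
  [/\ generator_core a, generator_core b & generator_core c] /\
  [/\ gen pi P v a, gen pi Q v b & gen pi Z v c].
Proof.
move=> hv; have [a [b [c [[ga gb gc] _]]]] := hv 1%N.
exists a, b, c; split=> //.
have h n : [/\ diff_vector n a, diff_vector n b & diff_vector n c].
  have [a' [b' [c' [[ga' gb' gc'] hn]]]] := hv n.+1.
  by rewrite (gen_uniq pi_rep ga ga') (gen_uniq pi_rep gb gb') (gen_uniq pi_rep gc gc').
by split=> n; have [] := h n.
Qed.

Lemma central t s (x : heis R) v : pi (t *: Z) (pi (s *: x) v) = pi (s *: x) (pi (t *: Z) v).
Proof.
rewrite -!(rep_mul pi_rep); congr (pi _ _).
apply: heis_eq; rewrite /heis_mul /bracket /coordP /coordQ /coordZ /=;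
  rewrite /GRing.scale /=; by ring.
Qed.

(** The generator along [Q] differentiates [f], and the central one along [Z]
    passes to the inside and differentiates [h]. The generator along [P] passes
    the smearing along [Q] at the price of the generator along [Z] with [f]
    multiplied by the variable, and then differentiates [g]. In each case the
    result is a sum of vectors of the same form. *)
Lemma garding_vector f g h v : test_fun f -> test_fun g -> test_fun h ->
  generator_core (smear Q f (smear P g (smear Z h v))).
Proof.
move=> ft gt ht n; elim: n f g h v ft gt ht => [//|n ih] f g h v ft gt ht.
have [f' f't df] := gen_smear_dir Q ft.
have [g' g't dg] := gen_smear_dir P gt.
have [h' h't dh] := gen_smear_dir Z ht.
have dZ1 := gen_smear_comm gt (fun t s => central t s P) (dh v).
have dZ2 := gen_smear_comm ft (fun t s => central t s Q) dZ1.
do 3 eexists; split; split.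
- exact: gen_smearQ_P ft (dg _) dZ1.
- exact: df.
- exact: dZ2.
- rewrite -[smear Q f _]scale1r; apply: diff_vector_lin; apply: ih => //.
  exact: test_mul_id.
- exact: ih.
- exact: ih.
Qed.

(** Approximate identities are applied along [Z], [P] and [Q] in turn. *)
Lemma generator_core_dense v (e : R) : 0 < e ->
  exists2 u, generator_core u & nrm (u - v) <= e.
Proof.
move=> e0; have e3 : 0 < e / 3 by rewrite divr_gt0.
have [h ht hv] := smear_approx Z v e3; set v1 := smear Z h v in hv.
have [g gt gv] := smear_approx P v1 e3; set v2 := smear P g v1 in gv.
have [f ft fv] := smear_approx Q v2 e3.
exists (smear Q f v2); first exact: garding_vector.
apply: le_trans (nrm_le_tri _ v2 _) _.
apply: le_trans (lerD (lexx _) (nrm_le_tri _ v1 _)) _; lra.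
Qed.

End Garding.

(** * A discrete measure with the moments of a point mass at -1 *)

Section EulerSeries.
Variable R : realType.

Lemma halving_sum_bounded (u : nat -> R) K : (forall n, 0 <= u n) ->
  (forall n, (K <= n)%N -> u n.+1 <= u n / 2) ->
  exists M, forall N, \sum_(0 <= n < N) u n <= M.
Proof.
move=> u0 uK; exists (\sum_(0 <= n < K) u n + 2 * u K) => N.
have tail m : \sum_(K <= n < K + m) u n + 2 * u (K + m)%N <= 2 * u K.
  elim: m => [|m ih]; first by rewrite addn0 big_geq // add0r.
  rewrite addnS big_nat_recr ?leq_addr //=.
  have := uK (K + m)%N (leq_addr _ _); lra.
apply: le_trans (_ : \sum_(0 <= n < K + N) u n <= _).
  by rewrite [leRHS](@big_cat_nat _ _ _ N) //= ?leq_addl // lerDl sumr_ge0.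
rewrite (@big_cat_nat _ _ _ K) //= ?leq_addr // lerD2l.
by apply: le_trans (tail N); rewrite lerDl mulr_ge0.
Qed.

Lemma bounded_sum_cvg0 (u : nat -> R) M : (forall n, 0 <= u n) ->
  (forall N, \sum_(0 <= n < N) u n <= M) -> u n @[n --> \oo] --> (0 : R).
Proof. by move=> u0 uM; apply: cvg_series_cvg_0; exact: nonneg_series_cvg uM. Qed.

(** Coefficients of Euler's product of the factors [1 - z / 2 ^ n], which
    vanishes at every power of 2 with exponent at least 0. *)
Fixpoint euler (n : nat) : R :=
  match n with
  | 0%N => 1
  | n'.+1 => - euler n' * (2 / (2 ^+ n - 1))
  end.

Definition euler_sum N (z : R) : R := \sum_(0 <= n < N) euler n * z ^+ n.

Lemma pow2_gt1 n : 1 < 2 ^+ n.+1 :> R.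
Proof. by rewrite exprn_egt1 // ltr1n. Qed.

Lemma norm_eulerS n : `|euler n.+1| = `|euler n| * (2 / (2 ^+ n.+1 - 1)).
Proof.
by rewrite [euler n.+1]/= normrM normrN [`|_ / _|]gtr0_norm // divr_gt0 // subr_gt0 pow2_gt1.
Qed.

(** The equation [E z = (1 - z) * E (z / 2)] of the product, for truncated sums
    of its expansion; the last term is the error of truncation. *)
Lemma euler_functional N (z : R) : euler_sum N.+1 z =
  (1 - z) * euler_sum N.+1 (z / 2) + z * (euler N * (z / 2) ^+ N).
Proof.
rewrite /euler_sum; elim: N => [|N ih].
  by rewrite !big_nat1 /= !expr0 !mulr1; ring.
rewrite big_nat_recr //= [in RHS]big_nat_recr //= ih !exprMn !exprVn.
have h := pow2_gt1 N; have h2 : 2 ^+ N != 0 :> R by rewrite expf_neq0.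
have h1 : 2 ^+ N.+1 - 1 != 0 :> R by rewrite subr_eq0 gt_eqF.
move: h1; rewrite !exprS => h1.
set X := \sum_(_ <= _ < _) _; field.
by rewrite h1 h2.
Qed.

(** The ratio of consecutive coefficients tends to 0. *)
Lemma euler_decay b : exists M, forall N,
  \sum_(0 <= n < N) `|euler n| * (2 ^+ b) ^+ n <= M.
Proof.
apply: (@halving_sum_bounded _ b.+2) => [n|n bn]; first by rewrite mulr_ge0 // exprn_ge0 // exprn_ge0.
rewrite norm_eulerS [(2 ^+ b) ^+ n.+1]exprS -mulrA -[leRHS]mulrA ler_wpM2l //.
have h := pow2_gt1 n; have d0 : 0 < 2 ^+ n.+1 - 1 :> R by rewrite subr_gt0.
rewrite mulrA [leRHS]mulrC ler_wpM2r ?exprn_ge0 //.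
rewrite mulrAC ler_pdivrMr //.
have : 2 ^+ b.+2 <= 2 ^+ n :> R by rewrite ler_eXn2l // ltr1n.
have : 1 <= 2 ^+ b :> R by rewrite exprn_ege1 // ler1n.
rewrite !exprS; lra.
Qed.

Lemma euler_le2 n : `|euler n| <= 2.
Proof.
have h1 : `|euler 1| = 2.
  by rewrite norm_eulerS normr1 expr1; field.
case: n => [|n]; first by rewrite normr1 ler1n.
elim: n => [|n ih]; first by rewrite h1.
apply: le_trans ih; rewrite norm_eulerS ler_piMr //.
have : 4 <= 2 ^+ n.+2 :> R.
  by rewrite !exprS; have : 1 <= 2 ^+ n :> R by [rewrite exprn_ege1 // ler1n]; lra.
by move=> h; rewrite ler_pdivrMr; lra.
Qed.

Lemma euler_term_cvg0 b : euler n * (2 ^+ b) ^+ n @[n --> \oo] --> (0 : R).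
Proof.
have [M hM] := euler_decay b.
apply/norm_cvg0P.
have := bounded_sum_cvg0 _ hM.
under [in X in _ -> X]eq_fun do rewrite normrM [`|_ ^+ _|]ger0_norm ?exprn_ge0 //.
by apply => n; rewrite mulr_ge0 // !exprn_ge0.
Qed.

Lemma euler_sum_cvgS (z l : R) : euler_sum N.+1 z @[N --> \oo] --> l ->
  euler_sum N z @[N --> \oo] --> l.
Proof. by move=> h; rewrite -(cvg_shiftS (fun N => euler_sum N z)). Qed.

(** The functional equation gives the zero at [1], and carries a zero at [2 ^
    j] to one at [2 ^ j.+1]. *)
Lemma euler_sum_pow2 j : euler_sum N (2 ^+ j) @[N --> \oo] --> (0 : R).
Proof.
have term k : euler n * (2 ^+ k / 2) ^+ n @[n --> \oo] --> (0 : R).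
  case: k => [|k].
    apply/norm_cvg0P; have h0 : `|euler n * (2 ^+ 0) ^+ n| @[n --> \oo] --> (0 : R).
      by apply/norm_cvg0P; exact: euler_term_cvg0.
    apply: (squeeze_cvgr _ (cvg_cst 0) h0); apply: nearW => n; rewrite normr_ge0 /=.
    rewrite !normrM ler_wpM2l // expr0 expr1n normr1 mul1r normrX exprn_ile1 //.
    by rewrite ger0_norm ?invr_ge0 // invf_le1 ?ler1n.
  by rewrite exprSr mulfK //; exact: euler_term_cvg0.
elim: j => [|j ih]; apply: euler_sum_cvgS.
  under eq_fun do rewrite euler_functional expr0 subrr mul0r add0r mul1r.
  by have := term 0%N; rewrite expr0.
under eq_fun do rewrite euler_functional.
have h1 : (1 - 2 ^+ j.+1) * euler_sum N.+1 (2 ^+ j.+1 / 2) @[N --> \oo] -->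
    (1 - 2 ^+ j.+1) * (0 : R).
  apply: cvgM; first exact: cvg_cst.
  rewrite [2 ^+ j.+1]exprSr mulfK //.
  by rewrite (cvg_shiftS (fun N => euler_sum N (2 ^+ j))).
have h2 : 2 ^+ j.+1 * (euler N * (2 ^+ j.+1 / 2) ^+ N) @[N --> \oo] --> 2 ^+ j.+1 * (0 : R).
  by apply: cvgM (term j.+1); exact: cvg_cst.
by have := cvgD h1 h2; rewrite !mulr0 addr0; apply.
Qed.

Lemma euler_sum_half_cvg : cvg (euler_sum N (2^-1) @[N --> \oo]).
Proof.
have [M hM] := euler_decay 0.
have : cvgn (series (fun n => `|euler n * 2^-1 ^+ n|)).
  apply: (nonneg_series_cvg (M := M)) => // N; apply: le_trans (hM N).
  apply: ler_sum => n _; rewrite normrM ler_wpM2l // expr0 expr1n normrX exprn_ile1 //.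
  by rewrite ger0_norm ?invr_ge0 // invf_le1 ?ler1n.
exact: normed_cvg.
Qed.

Definition euler_half : R := lim (euler_sum N (2^-1) @[N --> \oo]).

(** By the functional equation, [E (1 / 2)] is half of [E (1 / 4)]; as the
    coefficients are at most 2 in absolute value, the latter is at least [1 - 2
    (1/4 + 1/16 + ...)], which is 1/3. *)
Lemma euler_half_gt0 : 0 < euler_half.
Proof.
have quarter N : 3^-1 + 2 / 3 * 4^-1 ^+ N <= euler_sum N.+1 (2^-1 / 2).
  elim: N => [|N ih]; first by rewrite /euler_sum big_nat1 /= !expr0; lra.
  rewrite /euler_sum big_nat_recr //=.
  have e4 : 2^-1 / 2 = 4^-1 :> R by field.
  have : - (2 * 4^-1 ^+ N.+1) <= euler N.+1 * (2^-1 / 2) ^+ N.+1.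
    rewrite e4 -mulNr ler_wpM2r ?exprn_ge0 ?invr_ge0 //.
    by have := euler_le2 N.+1; rewrite ler_norml => /andP[].
  move: ih; rewrite /euler_sum /= [4^-1 ^+ N.+1]exprS; lra.
apply: lt_le_trans (_ : 12^-1 <= _); first by rewrite invr_gt0.
apply: (cvgr_to_ge euler_sum_half_cvg).
(* The truncation error is at most half of 1/24, which leaves 1/6 - 1/48. *)
have e24 : 0 < 24^-1 :> R by rewrite invr_gt0.
have := euler_term_cvg0 0 => /cvgrPdist_le/(_ _ e24)[K _ hK].
exists K.+1 => // -[//|N] /= KN.
rewrite euler_functional.
have := quarter N; have : 0 <= 4^-1 ^+ N :> R by rewrite exprn_ge0 // invr_ge0.
have := hK N KN; rewrite sub0r normrN expr0 expr1n mulr1.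
have : `|euler N * (2^-1 / 2) ^+ N| <= `|euler N|.
  rewrite normrM ler_piMr // normrX exprn_ile1 // ger0_norm; lra.
move=> h1 h2; have := le_trans h1 h2.
rewrite ler_norml => /andP[]; lra.
Qed.

(** ** Masses and nodes *)

(** Signed masses with total mass 1, which is what the division by the value of
    Euler's series at 1/2 achieves. *)
Definition mass n : R := euler n * 2^-1 ^+ n / euler_half.
Definition square_node n : R := 2 ^+ n.+1 - 1.

Lemma square_node_ge1 n : 1 <= square_node n.
Proof.
rewrite /square_node exprS; have : 1 <= 2 ^+ n :> R by rewrite exprn_ege1 // ler1n.
lra.
Qed.

(** In the coordinate [u = 1 + square_node] the measure has the moments of a
    point mass at the origin, because Euler's series vanishes at [2 ^ j]. *)
Lemma mass_moment m j : \sum_(0 <= n < N) mass n * square_node n ^+ m * (2 ^+ n.+1) ^+ j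
  @[N --> \oo] --> ((-1) ^+ m * (j == 0)%:R : R).
Proof.
elim: m j => [|m ih] j.
  rewrite expr0 mul1r.
  case: j => [|j].
    have h : euler_sum N 2^-1 / euler_half @[N --> \oo] --> euler_half / euler_half.
      by apply: cvgM; [exact: euler_sum_half_cvg|exact: cvg_cst].
    have e N : \sum_(0 <= n < N) mass n * square_node n ^+ 0 * (2 ^+ n.+1) ^+ 0 =
        euler_sum N 2^-1 / euler_half.
      by rewrite mulr_suml; apply: eq_bigr => n _; rewrite !expr0 !mulr1.
    under eq_fun do rewrite e.
    by move: h; rewrite divff ?(lt0r_neq0 euler_half_gt0) //; apply.
  have e N : \sum_(0 <= n < N) mass n * square_node n ^+ 0 * (2 ^+ n.+1) ^+ j.+1 =
      euler_sum N (2 ^+ j) * (2 ^+ j.+1 / euler_half).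
    rewrite mulr_suml; apply: eq_bigr => n _; rewrite expr0 mulr1 /mass.
    have -> : (2 ^+ n.+1) ^+ j.+1 = 2 ^+ n * (2 ^+ j) ^+ n * 2 ^+ j.+1 :> R.
      by rewrite -!exprM -!exprD; congr (_ ^+ _); rewrite mulnS mulSn; ring.
    have : 2 ^+ n != 0 :> R by rewrite expf_neq0.
    have : euler_half != 0 by rewrite gt_eqF // euler_half_gt0.
    by rewrite exprVn => h1 h2; field; rewrite h1 h2.
  under eq_fun do rewrite e.
  have h : euler_sum N (2 ^+ j) * (2 ^+ j.+1 / euler_half) @[N --> \oo] -->
      0 * (2 ^+ j.+1 / euler_half).
    by apply: cvgM; [exact: euler_sum_pow2|exact: cvg_cst].
  by move: h; rewrite mul0r; apply.
have e N : \sum_(0 <= n < N) mass n * square_node n ^+ m.+1 * (2 ^+ n.+1) ^+ j =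
    \sum_(0 <= n < N) mass n * square_node n ^+ m * (2 ^+ n.+1) ^+ j.+1 -
    \sum_(0 <= n < N) mass n * square_node n ^+ m * (2 ^+ n.+1) ^+ j.
  rewrite -sumrB; apply: eq_bigr => n _.
  by rewrite exprSr [X in _ = _ - X]/= [(2 ^+ n.+1) ^+ j.+1]exprSr {2}/square_node; ring.
under eq_fun do rewrite e.
have -> : (-1) ^+ m.+1 * (j == 0)%:R =
    (-1) ^+ m * (j.+1 == 0)%:R - (-1) ^+ m * (j == 0)%:R :> R.
  by rewrite exprS mulr0 sub0r mulN1r mulNr.
by apply: cvgB; exact: ih.
Qed.

Lemma mass_decay m : exists M, forall N,
  \sum_(0 <= n < N) `|mass n| * square_node n ^+ m <= M.
Proof.
have [M hM] := euler_decay m.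
exists (2 ^+ m / euler_half * M) => N.
have h0 := euler_half_gt0.
apply: le_trans (ler_wpM2l _ (hM N)); last by rewrite divr_ge0 ?exprn_ge0 // ltW.
rewrite mulr_sumr; apply: ler_sum => n _.
rewrite /mass !normrM normfV (gtr0_norm h0) [`|2^-1 ^+ n|]ger0_norm ?exprn_ge0 ?invr_ge0 //.
have -> : `|euler n| * 2^-1 ^+ n / euler_half * square_node n ^+ m =
  2^-1 ^+ n * (`|euler n| / euler_half * square_node n ^+ m) by ring.
apply: le_trans (_ : `|euler n| / euler_half * square_node n ^+ m <= _).
  rewrite ler_piMl ?exprn_ile1 ?invr_ge0 ?invf_le1 ?ler1n //.
  rewrite mulr_ge0 ?divr_ge0 ?(ltW h0) // exprn_ge0 //.
  by apply: le_trans (square_node_ge1 n).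
have -> : 2 ^+ m / euler_half * (`|euler n| * (2 ^+ m) ^+ n) =
    `|euler n| / euler_half * (2 ^+ n.+1) ^+ m.
  by rewrite -!exprM mulSn exprD mulnC; ring.
rewrite ler_wpM2l ?divr_ge0 ?(ltW h0) // lerXn2r ?nnegrE ?exprn_ge0 //.
  by apply: le_trans (square_node_ge1 n).
by rewrite /square_node gerBl.
Qed.

End EulerSeries.

(** * Reflection-symmetric nodes and weights on the line *)

Definition swap (n : nat) : nat := if odd n then n.-1 else n.+1.

Lemma swap_double k : swap k.*2 = k.*2.+1.
Proof. by rewrite /swap odd_double. Qed.

Lemma swap_doubleS k : swap k.*2.+1 = k.*2.
Proof. by rewrite /swap /= odd_double. Qed.

Lemma half_doubleS k : k.*2.+1./2 = k.
Proof. exact: (half_bit_double k true). Qed.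

Lemma double_ind (A : nat -> Prop) :
  (forall k, A k.*2) -> (forall k, A k.*2.+1) -> forall n, A n.
Proof.
move=> h0 h1 n; rewrite -(odd_double_half n).
by case: odd; [exact: h1|exact: h0].
Qed.

Lemma swapK : involutive swap.
Proof.
by elim/double_ind => k; rewrite ?swap_double ?swap_doubleS ?swap_double.
Qed.

Lemma sum_double (V : nmodType) (u : nat -> V) N :
  \sum_(0 <= n < N.*2) u n = \sum_(0 <= k < N) (u k.*2 + u k.*2.+1).
Proof.
elim: N => [|N ih]; first by rewrite !big_geq.
by rewrite doubleS !big_nat_recr //= ih addrA.
Qed.

Lemma cvg_double : n.*2 @[n --> \oo] --> \oo.
Proof.
move=> A [n _ nA]; exists n => // m /= nm; apply: nA => /=.
by rewrite -addnn (leq_trans nm) // leq_addr.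
Qed.

Section PairedSeries.
Variables (R : realType) (V : completeNormedModType R[i]).

Lemma vsum_pairs (u : nat -> V) (l : V) : asum u ->
  \sum_(0 <= k < N) (u k.*2 + u k.*2.+1) @[N --> \oo] --> l -> vsum u = l.
Proof.
move=> /vsumP us ul.
have h : series u N.*2 @[N --> \oo] --> vsum u by exact: cvg_comp cvg_double us.
have e : (fun N => series u N.*2) = (fun N => \sum_(0 <= k < N) (u k.*2 + u k.*2.+1)).
  by apply/funext => N; exact: sum_double.
by rewrite e in h; exact: cvg_unique h ul.
Qed.

Lemma sum_swap_le (u : nat -> R) N : (forall n, 0 <= u n) ->
  \sum_(0 <= n < N) u (swap n) <= \sum_(0 <= n < N.*2) u n.
Proof.
move=> u0; apply: le_trans (_ : \sum_(0 <= n < N.*2) u (swap n) <= _).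
  by rewrite -addnn [leRHS](@big_cat_nat _ _ _ N) //= ?leq_addl // lerDl sumr_ge0.
rewrite !sum_double; apply: ler_sum => k _.
by rewrite swap_double swap_doubleS addrC.
Qed.

Lemma asum_swap (u : nat -> V) : asum u -> asum (fun n => u (swap n)).
Proof.
move=> [M uM]; exists M => N; apply: le_trans (uM N.*2).
by apply: (@sum_swap_le (fun n => nrm (u n))) => n; exact: nrm_ge0.
Qed.

Lemma vsum_swap (u : nat -> V) : asum u -> vsum (fun n => u (swap n)) = vsum u.
Proof.
move=> us; apply/esym/vsum_pairs => //.
have : series (fun n => u (swap n)) N.*2 @[N --> \oo] --> vsum (fun n => u (swap n)).
  exact: cvg_comp cvg_double (vsumP (asum_swap us)).
have -> : (fun N => series (fun n => u (swap n)) N.*2) =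
    (fun N => \sum_(0 <= k < N) (u k.*2 + u k.*2.+1)).
  apply/funext => N; rewrite /series /= sum_double; apply: eq_bigr => k _.
  by rewrite swap_double swap_doubleS addrC.
by [].
Qed.

End PairedSeries.

Section Nodes.
Variable R : realType.

Definition pos_node k : R := Num.sqrt (square_node R k).

Definition node n : R := if odd n then - pos_node n./2 else pos_node n./2.

(** Chosen so that [weight (swap n) * Num.conj (weight n)] is half of the mass
    at the square of the node, times [1 - 'i / node].  A pair of opposite nodes
    [+- x] then contributes [mass * x ^ j] to the moment of an even order [j],
    and [- 'i * mass * x ^ j.-1] to that of an odd order. *)
Definition weight n : R[i] :=
  let a := mass R n./2 in
  if odd n then
    (Num.sg a * Num.sqrt `|a|)%:C * ((1 -i* (pos_node n./2)^-1) / 2)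
  else (Num.sqrt `|a|)%:C.

Lemma node_double k : node k.*2 = pos_node k.
Proof. by rewrite /node odd_double doubleK. Qed.

Lemma node_doubleS k : node k.*2.+1 = - pos_node k.
Proof. by rewrite /node half_doubleS [odd _]/= odd_double. Qed.

Lemma node_swap n : node (swap n) = - node n.
Proof.
elim/double_ind: n => k; rewrite ?swap_doubleS ?swap_double.
  by rewrite node_doubleS node_double.
by rewrite node_double node_doubleS opprK.
Qed.

Lemma pos_node_sqr k : pos_node k ^+ 2 = square_node R k.
Proof. by rewrite sqr_sqrtr // (le_trans _ (square_node_ge1 R k)). Qed.

Lemma pos_node_ge1 k : 1 <= pos_node k.
Proof. by rewrite -sqrtr1 ler_sqrt ?square_node_ge1 // (le_trans _ (square_node_ge1 R k)). Qed.

Lemma node_sqr n : node n ^+ 2 = square_node R n./2.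
Proof. by rewrite /node; case: ifP => _; rewrite ?sqrrN pos_node_sqr. Qed.

Lemma nrm_weight_sqr n : nrm (weight n) ^+ 2 <= `|mass R n./2|.
Proof.
rewrite /weight; case: ifP => _; last by rewrite nrm_real ger0_norm ?sqrtr_ge0 // sqr_sqrtr.
rewrite nrmM nrm_real normrM (ger0_norm (sqrtr_ge0 _)) !exprMn sqr_sqrtr //.
set k := n./2; have h1 := pos_node_ge1 k.
have h2 : `|Num.sg (mass R k)| ^+ 2 <= 1.
  by rewrite exprn_ile1 // normr_sg; case: (_ != 0).
have h3 : nrm ((1 -i* (pos_node k)^-1) / 2) ^+ 2 <= 1.
  rewrite exprn_ile1 ?nrm_ge0 //.
  have e2 : 2 = (2 : R)%:C by rewrite rmorph_nat.
  rewrite e2 -fmorphV nrmM nrm_real ger0_norm ?invr_ge0 // ler_pdivrMr // mul1r.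
  apply: le_trans (nrm_le_ReIm _) _ => /=; rewrite normr1 normrN ger0_norm ?invr_ge0.
    by have : (pos_node k)^-1 <= 1 by [rewrite invf_le1 // (lt_le_trans ltr01)]; lra.
  exact: le_trans h1.
apply: le_trans (ler_wpM2l _ h3) _; first by rewrite mulr_ge0 // exprn_ge0.
by rewrite mulr1 ler_piMl.
Qed.

Lemma weight_decay j : exists M, forall N,
  \sum_(0 <= n < N) nrm (weight n * (node n)%:C ^+ j) ^+ 2 <= M.
Proof.
have [M hM] := mass_decay R j; exists (2 * M) => N.
apply: le_trans (_ : \sum_(0 <= n < N.*2) `|mass R n./2| * square_node R n./2 ^+ j <= _).
  rewrite -addnn [leRHS](@big_cat_nat _ _ _ N) //= ?leq_addl //.
  have pos n : 0 <= `|mass R n./2| * square_node R n./2 ^+ j.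
    by rewrite mulr_ge0 // exprn_ge0 // (le_trans _ (square_node_ge1 R _)).
  rewrite -[leLHS]addr0 lerD ?sumr_ge0 //; apply: ler_sum => n _.
  rewrite nrmM exprMn nrmX nrm_real -exprM mulnC exprM real_normK ?num_real // node_sqr.
  by rewrite ler_wpM2r ?nrm_weight_sqr // exprn_ge0 // (le_trans _ (square_node_ge1 R _)).
rewrite sum_double.
under eq_bigr do rewrite doubleK half_doubleS -mulr2n -mulr_natl.
by rewrite -mulr_sumr ler_wpM2l.
Qed.

Lemma weight_pair k : weight k.*2.+1 * Num.conj (weight k.*2) =
  (mass R k)%:C * ((1 -i* (pos_node k)^-1) / 2).
Proof.
rewrite /weight half_doubleS doubleK [odd k.*2.+1]/= odd_double /=.
have -> : Num.conj (Num.sqrt `|mass R k|)%:C = (Num.sqrt `|mass R k|)%:C :> R[i].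
  by rewrite conj_Creal // realE ler0c sqrtr_ge0.
rewrite mulrAC -rmorphM -mulrA -expr2 sqr_sqrtr //.
by rewrite -numEsg.
Qed.

(** The product of two numbers is at most the sum of their squares. *)
Lemma weight_moment_asum j :
  asum (fun n => weight (swap n) * Num.conj (weight n) * (node n)%:C ^+ j : scalars R).
Proof.
have [M hM] := weight_decay j; have [M0 hM0] := weight_decay 0.
exists (M0 + M) => N; apply: le_trans (lerD (hM0 N.*2) (hM N)).
have h0 := @sum_swap_le R (fun n => nrm (weight n * (node n)%:C ^+ 0) ^+ 2) N (fun n => sqr_ge0 _).
apply: le_trans (lerD h0 (lexx _)); rewrite -big_split; apply: ler_sum => n _ /=.
have -> : nrm (weight (swap n) * Num.conj (weight n) * (node n)%:C ^+ j) =
    nrm (weight (swap n)) * nrm (weight n * (node n)%:C ^+ j).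
  by rewrite !nrmM nrm_conj mulrA.
rewrite expr0 mulr1.
have := sqr_ge0 (nrm (weight (swap n)) - nrm (weight n * (node n)%:C ^+ j)).
have := sqr_ge0 (nrm (weight (swap n))); have := sqr_ge0 (nrm (weight n * (node n)%:C ^+ j)).
nra.
Qed.

(** Summing over the pairs of opposite nodes reduces this to moments of the
    masses at the squares of the nodes, which are [(-1) ^ m]. *)
Lemma weight_moment j :
  vsum (fun n => weight (swap n) * Num.conj (weight n) * (node n)%:C ^+ j : scalars R)
  = (- 'i%C) ^+ j.
Proof.
apply: (@vsum_pairs _ (scalars R)); first exact: weight_moment_asum.
(* The remainder of [(- 'i) ^ j] after the even powers. *)
pose c : R[i] := if odd j then - 'i%C else 1.
have pairE k : weight (swap k.*2) * Num.conj (weight k.*2) * (node k.*2)%:C ^+ j +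
    weight (swap k.*2.+1) * Num.conj (weight k.*2.+1) * (node k.*2.+1)%:C ^+ j =
    c * (mass R k * square_node R k ^+ j./2 * (2 ^+ k.+1) ^+ 0)%:C.
  rewrite swap_double swap_doubleS node_double node_doubleS expr0 mulr1.
  have -> : weight k.*2 * Num.conj (weight k.*2.+1) =
      Num.conj (weight k.*2.+1 * Num.conj (weight k.*2)).
    by rewrite rmorphM /= conjCK mulrC.
  rewrite weight_pair.
  have x0 : pos_node k != 0 by rewrite gt_eqF // (lt_le_trans ltr01) // pos_node_ge1.
  move: (mass R k) => a; set x := pos_node k in x0 *.
  have eW s : a%:C * ((1 +i* s) / 2) = (a / 2) +i* (a * s / 2) :> R[i].
    have e2 : 2 = (2 : R)%:C :> R[i] by rewrite rmorph_nat.
    rewrite e2 -fmorphV; apply/eqP; rewrite eq_complex /=.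
    by apply/andP; split; apply/eqP; ring.
  have -> : Num.conj (a%:C * ((1 -i* x^-1) / 2)) = a%:C * ((1 +i* x^-1) / 2) :> R[i].
    rewrite !eW -[LHS]/((a / 2) -i* (a * - x^-1 / 2)).
    by rewrite mulrN mulNr opprK.
  have -> : (- x)%:C ^+ j = (-1) ^+ j * x%:C ^+ j :> R[i].
    by rewrite -exprMn mulN1r rmorphN.
  have ej : x%:C ^+ j = x%:C ^+ odd j * (square_node R k ^+ j./2)%:C :> R[i].
    rewrite -{1}(odd_double_half j) exprD; congr (_ * _).
    by rewrite -mul2n exprM -rmorphXn pos_node_sqr rmorphXn.
  rewrite ej -signr_odd /c (rmorphM _ a) /=; set y := (_ ^+ j./2)%:C.
  have ->: 1 -i* x^-1 = 1 - 'i%C * x%:C^-1.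
    by rewrite -fmorphV; simpc.
  have ->: 1 +i* x^-1 = 1 + 'i%C * x%:C^-1.
    by rewrite -fmorphV; simpc.
  have xC0 : x%:C != 0 :> R[i] by rewrite fmorph_eq0.
  case: (odd j); rewrite ?expr0 ?expr1; field => //.
under eq_fun do under eq_bigr do rewrite pairE.
under eq_fun do rewrite -mulr_sumr -rmorph_sum.
have -> : (- 'i%C) ^+ j = c * ((-1) ^+ j./2 * (0%N == 0)%:R : R)%:C.
  rewrite eqxx mulr1 -{1}(odd_double_half j) exprD -mul2n exprM sqrrN sqr_i.
  by rewrite rmorphXn rmorphN1; congr (_ * _); rewrite /c; case: odd; rewrite ?expr1 ?expr0.
apply: (@cvgZr _ (scalars R)); apply/cvg_nrmP => e e0.
have /cvgrPdist_le/(_ _ e0) := @mass_moment R j./2 0; apply: filterS => N.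
by rewrite -rmorphB nrm_real distrC.
Qed.

End Nodes.

(** * The euclidean realization *)

Section Closures.
Variables (R : realType) (V : normedModType R[i]).
Implicit Types (A : set V) (f g : V).

Lemma closure_nrmP A f :
  closure A f <-> forall e : R, 0 < e -> exists2 g, A g & nrm (g - f) <= e.
Proof.
split=> [Af e e0|Af B].
  have e0' : (0 : R[i]) < e%:C by rewrite ltcR.
  have [g [Ag]] := Af _ (nbhsx_ballx f _ e0').
  rewrite -ball_normE /= nrmE ltcR => fg.
  by exists g => //; rewrite nrmB ltW.
move=> /nbhs_ballP[[e e'] /=]; rewrite ltcE /= => /andP[/eqP-> e0] fB.
have [g Ag gf] := Af (e / 2) (divr_gt0 e0 (ltr0Sn _ _)).
exists g; split=> //; apply: fB; rewrite -ball_normE /= nrmE ltcR nrmB.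
by apply: le_lt_trans gf _; rewrite ltr_pdivrMr // ltr_pMr // ltr1n.
Qed.

(** Identities between bounded forms are proved on dense subspaces and extended
    by this lemma. *)
Lemma lipschitz_closure_eq0 (phi : V -> R[i]) (C : R) A :
  (forall f g, nrm (phi f - phi g) <= C * nrm (f - g)) ->
  (forall f, A f -> phi f = 0) -> forall f, closure A f -> phi f = 0.
Proof.
move=> phiC phiA f /closure_nrmP Af; apply/nrm_eq0/eqP.
rewrite eq_le nrm_ge0 andbT; apply/ler_addgt0Pr => e e0; rewrite add0r.
have C0 : 0 < `|C| + 1 by rewrite ltr_wpDl.
have [g Ag gf] := Af (e / (`|C| + 1)) (divr_gt0 e0 C0).
have := phiC g f; rewrite (phiA _ Ag) sub0r nrmN => h.
apply: le_trans h _; apply: le_trans (_ : (`|C| + 1) * nrm (g - f) <= _).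
  by rewrite ler_wpM2r ?nrm_ge0 // (le_trans (ler_norm _)) // lerDl.
by rewrite mulrC -ler_pdivlMr.
Qed.

End Closures.

Section Realization.
Variables (R : realType) (H : hilbert R) (pic : heis R -> {linear H -> H}).
Hypothesis pic_rep : is_unitary_rep pic.

Let E := ell2 H.
Let P := basisP R.
Let Q := basisQ R.
Let Z := basisZ R.
Local Notation x_ n := (node R n).
Local Notation w_ n := (weight R n).

(** ** The representation on square summable sequences *)

(** For [r != 0] an automorphism of [G] that fixes [exp (R Q)]; the one for
    [r = -1] is [tau]. *)
Definition dilate (r : R) (g : heis R) : heis R :=
  heis_mk (r * coordP g) (coordQ g) (r * coordZ g).

Lemma dilate_mul r g h : dilate r (heis_mul g h) = heis_mul (dilate r g) (dilate r h).
Proof.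
apply: heis_eq; rewrite /dilate /heis_mul /bracket /coordP /coordQ /coordZ /=;
  rewrite /GRing.scale /=; ring.
Qed.

Lemma dilateN r g : dilate r (- g) = - dilate r g.
Proof. by apply: heis_eq; rewrite /dilate /coordP /coordQ /coordZ /= ?mulrN. Qed.

Lemma dilate_tau r g : dilate r (tau g) = dilate (- r) g.
Proof. by apply: heis_eq; rewrite /dilate /tau /coordP /coordQ /coordZ /= ?mulrN ?mulNr. Qed.

Lemma dilate_continuous r : continuous (dilate r).
Proof.
move=> g; rewrite /dilate /heis_mk.
have cP : coordP x @[x --> g] --> coordP g.
  by apply: (cvg_comp (fun g : heis R => g.1) fst); [exact: cvg_fst|exact: cvg_fst].
have cQ : coordQ x @[x --> g] --> coordQ g.
  by apply: (cvg_comp (fun g : heis R => g.1) snd); [exact: cvg_fst|exact: cvg_snd].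
have cZ : coordZ x @[x --> g] --> coordZ g by exact: cvg_snd.
have hP : r * coordP x @[x --> g] --> r * coordP g by apply: cvgMr.
have hZ : r * coordZ x @[x --> g] --> r * coordZ g by apply: cvgMr.
exact: cvg_pair (cvg_pair hP cQ) hZ.
Qed.

Lemma rep_fun_summable g (f : E) :
  square_summable (fun n => pic (dilate (x_ n) g) (coord E n f)).
Proof.
have [M hM] := coord_sqsum f; exists M => N; apply: le_trans (hM N).
by apply: ler_sum => n _; rewrite (rep_nrm pic_rep).
Qed.

Definition rep_fun g (f : E) : E := of_seq E (fun n => pic (dilate (x_ n) g) (coord E n f)).

Lemma coord_rep_fun g f n : coord E n (rep_fun g f) = pic (dilate (x_ n) g) (coord E n f).
Proof. by rewrite of_seqK //; exact: rep_fun_summable. Qed.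

Lemma rep_fun_linear g : linear (rep_fun g).
Proof. by move=> a f f'; apply: coord_inj => n; rewrite !(linearP, coord_rep_fun). Qed.

Definition pi g : {linear E -> E} := mk_linear (rep_fun_linear g).

Lemma coord_pi g f n : coord E n (pi g f) = pic (dilate (x_ n) g) (coord E n f).
Proof. exact: coord_rep_fun. Qed.

Lemma pi_mul g h f : pi (heis_mul g h) f = pi g (pi h f).
Proof.
by apply: coord_inj => n; rewrite !coord_pi dilate_mul (rep_mul pic_rep).
Qed.

(** The continuity of orbit maps is dominated convergence: each coordinate
    converges, and the norms of the coordinates do not depend on the group
    element. *)
Lemma pi_rep : is_unitary_rep pi.
Proof.
split=> [g||f g].
- split=> [f f'|f].
    rewrite !coord_inner; apply: (congr1 (@vsum _ (scalars R))); apply/funext => n.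
    by rewrite !coord_pi; have [+ _] := rep_unitary pic_rep (dilate (x_ n) g); apply.
  exists (pi (- g) f); apply: coord_inj => n.
  by rewrite !coord_pi dilateN (repKV pic_rep).
- exact: pi_mul.
- have [M hM] := coord_sqsum f.
  apply: (@l2_dominated_cvg R H E _ _ _ _ _ (fun n => 2 * nrm (coord E n f)) (4 * M)) => [N||n].
  + under eq_bigr do rewrite exprMn; rewrite -mulr_sumr -natrX.
    by rewrite ler_wpM2l.
  + apply: nearW => h n; rewrite !coord_pi.
    by apply: le_trans (nrmD _ _) _; rewrite nrmN !(rep_nrm pic_rep); lra.
  + under eq_fun do rewrite coord_pi; rewrite coord_pi.
    exact: cvg_comp (@dilate_continuous _ g) (@rep_cont _ _ _ pic_rep _ _).
Qed.

(** ** The reflection *)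

Lemma theta_summable (f : E) : square_summable (fun n => coord E (swap n) f).
Proof.
have [M hM] := coord_sqsum f; exists M => N; apply: le_trans (hM N.*2).
by apply: (@sum_swap_le R (fun n => nrm (coord E n f) ^+ 2)) => n; exact: sqr_ge0.
Qed.

Definition theta_fun (f : E) : E := of_seq E (fun n => coord E (swap n) f).

Lemma coord_theta_fun f n : coord E n (theta_fun f) = coord E (swap n) f.
Proof. by rewrite of_seqK //; exact: theta_summable. Qed.

Lemma theta_fun_linear : linear theta_fun.
Proof. by move=> a f f'; apply: coord_inj => n; rewrite !(linearP, coord_theta_fun). Qed.

Definition theta : {linear E -> E} := mk_linear theta_fun_linear.

Lemma coord_theta f n : coord E n (theta f) = coord E (swap n) f.
Proof. exact: coord_theta_fun. Qed.

Lemma thetaK f : theta (theta f) = f.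
Proof. by apply: coord_inj => n; rewrite !coord_theta swapK. Qed.

Lemma theta_unitary : is_unitary theta.
Proof.
split=> [f f'|f]; last by exists (theta f); rewrite thetaK.
rewrite !coord_inner -[RHS]vsum_swap; last exact: coord_asum.
by apply: (congr1 (@vsum _ (scalars R))); apply/funext => n; rewrite !coord_theta.
Qed.

Lemma theta_pi g f : pi (tau g) f = theta (pi g (theta f)).
Proof.
apply: coord_inj => n; rewrite coord_theta !coord_pi coord_theta swapK.
by rewrite node_swap dilate_tau.
Qed.

(** ** Polynomial sequences *)

Lemma mono_summable j (v : H) : square_summable (fun n => (w_ n * (x_ n)%:C ^+ j) *: v).
Proof.
have [M hM] := weight_decay R j; exists (M * nrm v ^+ 2) => N.
under eq_bigr do rewrite nrmZ exprMn; rewrite -mulr_suml.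
by rewrite ler_wpM2r ?exprn_ge0 ?nrm_ge0.
Qed.

Definition mono_fun j (v : H) : E := of_seq E (fun n => (w_ n * (x_ n)%:C ^+ j) *: v).

Lemma coord_mono_fun j v n : coord E n (mono_fun j v) = (w_ n * (x_ n)%:C ^+ j) *: v.
Proof. by rewrite of_seqK //; exact: mono_summable. Qed.

Lemma mono_fun_linear j : linear (mono_fun j).
Proof.
move=> a u v; apply: coord_inj => n; rewrite linearP !coord_mono_fun.
by rewrite scalerDr !scalerA mulrC.
Qed.

Definition mono j : {linear H -> E} := mk_linear (mono_fun_linear j).

Lemma coord_mono j v n : coord E n (mono j v) = (w_ n * (x_ n)%:C ^+ j) *: v.
Proof. exact: coord_mono_fun. Qed.

Lemma mono_bounded j : exists2 C, 0 <= C & forall v, nrm (mono j v) <= C * nrm v.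
Proof.
have [M hM] := weight_decay R j.
have M0 : 0 <= M by have := hM 0; rewrite big_geq.
exists (M + 1) => [|v]; first by rewrite addr_ge0.
apply: coord_le => [|N]; first by rewrite mulr_ge0 ?nrm_ge0 // addr_ge0.
under eq_bigr do rewrite coord_mono nrmZ exprMn; rewrite -mulr_suml exprMn.
rewrite ler_wpM2r ?exprn_ge0 ?nrm_ge0 //; apply: le_trans (hM N) _; nra.
Qed.

(** The polynomial functions of the node with coefficients in [A], times the
    weight *)
Inductive poly_seq (A : set H) : E -> Prop :=
| PolySeq0 : poly_seq A 0
| PolySeqD j v f : A v -> poly_seq A f -> poly_seq A (mono j v + f).

Lemma poly_seq_lin A (a : R[i]) f g : is_subspace A ->
  poly_seq A f -> poly_seq A g -> poly_seq A (a *: f + g).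
Proof.
move=> [A0 AD] Af Ag; elim: Af => [|j v f' Av Af' ih]; first by rewrite scaler0 add0r.
rewrite scalerDr -addrA -linearZ /=; apply: PolySeqD => //.
rewrite -[_ *: _]addr0; apply/set_mem/AD => //; exact/mem_set.
Qed.

Lemma poly_seq_mono A j v : A v -> poly_seq A (mono j v).
Proof. by move=> Av; rewrite -[mono j v]addr0; apply: PolySeqD => //; exact: PolySeq0. Qed.

Lemma poly_seq_subspace A : is_subspace A -> is_subspace (poly_seq A).
Proof.
move=> As; split=> [|a f g /set_mem Af /set_mem Ag]; apply/mem_set.
  exact: PolySeq0.
exact: poly_seq_lin.
Qed.

Lemma poly_seq_sub A B : A `<=` B -> poly_seq A `<=` poly_seq B.
Proof.
move=> AB f; elim=> [|j v f' Av _ ih]; first exact: PolySeq0.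
by apply: PolySeqD => //; exact: AB.
Qed.

Definition plus : set E := closure (poly_seq setT).

Lemma setT_subspace : is_subspace (setT : set H).
Proof. by split=> [|a u v _ _]; apply/mem_set. Qed.

Lemma closure_subspace (A : set E) : is_subspace A -> is_subspace (closure A).
Proof.
move=> [A0 AD]; split=> [|a f g /set_mem/closure_nrmP Af /set_mem/closure_nrmP Ag].
  by apply/mem_set/subset_closure/set_mem.
apply/mem_set/closure_nrmP => e e0.
have a1 : 0 < nrm a + 1 by rewrite ltr_wpDl ?nrm_ge0.
have e2 : 0 < e / 2 by rewrite divr_gt0.
have [f' Af' ff'] := Af _ (divr_gt0 e2 a1); have [g' Ag' gg'] := Ag _ e2.
exists (a *: f' + g'); first by apply/set_mem/AD; exact/mem_set.
rewrite opprD addrACA -scalerBr (splitr e); apply: le_trans (nrmD _ _) _; rewrite lerD //.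
rewrite nrmZ mulrC; apply: le_trans (ler_pM (nrm_ge0 _) (nrm_ge0 _) ff' (_ : _ <= nrm a + 1)) _.
  by rewrite lerDl.
by rewrite divfK // gt_eqF.
Qed.

(** The fixed points of [tau] form [exp (R Q)], on which dilations are trivial. *)
Lemma pi_mono h j v : fix_tau h -> pi h (mono j v) = mono j (pic h v).
Proof.
move=> hh; apply: coord_inj => n; rewrite coord_pi !coord_mono linearZ /=.
congr (_ *: pic _ _).
have N0 (r : R) : - r = r -> r = 0 by lra.
have p0 : coordP h = 0 by apply: N0; exact: (congr1 (@coordP R) hh).
have z0 : coordZ h = 0 by apply: N0; exact: (congr1 (@coordZ R) hh).
by apply: heis_eq; rewrite /dilate /= /coordP /coordZ /= -/(coordP h) -/(coordZ h) ?p0 ?z0 ?mulr0.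
Qed.

Lemma pi_plus h f : fix_tau h -> plus f -> plus (pi h f).
Proof.
move=> hh /closure_nrmP hf; apply/closure_nrmP => e /hf[g gP gf].
exists (pi h g); last by rewrite -linearB (rep_nrm pi_rep).
elim: gP {gf} => [|j v g' _ _ ih]; first by rewrite linear0; exact: PolySeq0.
by rewrite linearD (pi_mono _ _ hh); exact: PolySeqD.
Qed.

Lemma fix_tauN (h : heis R) : fix_tau h -> fix_tau (- h).
Proof.
move=> hh; rewrite /fix_tau /= -{2}hh.
by apply: heis_eq; rewrite /tau /coordP /coordQ /coordZ.
Qed.

(** ** The quotient map *)

Lemma q_asum (f : E) : asum (fun n => Num.conj (w_ (swap n)) *: coord E n f).
Proof.
have [M hM] := weight_decay R 0; exists (M + nrm f ^+ 2) => N.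
apply: le_trans (lerD (hM N.*2) (coord_ge f N)).
have h0 := @sum_swap_le R (fun n => nrm (w_ n * (x_ n)%:C ^+ 0) ^+ 2) N (fun n => sqr_ge0 _).
apply: le_trans (lerD h0 (lexx _)); rewrite -big_split; apply: ler_sum => n _ /=.
rewrite nrmZ nrm_conj expr0 mulr1.
have := sqr_ge0 (nrm (w_ (swap n)) - nrm (coord E n f)).
have := sqr_ge0 (nrm (w_ (swap n))); have := sqr_ge0 (nrm (coord E n f)); nra.
Qed.

(** On polynomial sequences this is evaluation at ['i] of the polynomial, by
    the moments of the weights. *)
Definition q_fun (f : E) : H := vsum (fun n => Num.conj (w_ (swap n)) *: coord E n f).

Lemma q_fun_linear : linear q_fun.
Proof.
move=> a f g; rewrite /q_fun -vsumZ; last exact: q_asum.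
rewrite -vsumD; [|exact/asumZ/q_asum|exact: q_asum].
congr vsum; apply/funext => n /=.
by rewrite linearP scalerDr !scalerA mulrC.
Qed.

Definition q : {linear E -> H} := mk_linear q_fun_linear.

(** The estimate by the sum of squares is not homogeneous, so it is made on the
    unit ball. *)
Lemma q_bounded : exists2 C, 0 <= C & forall f, nrm (q f) <= C * nrm f.
Proof.
have [M hM] := weight_decay R 0.
have M0 : 0 <= M by have := hM 0; rewrite big_geq.
exists (M + 1) => [|f]; first by rewrite addr_ge0.
have unit_bound g : nrm g <= 1 -> nrm (q g) <= M + 1.
  move=> g1; apply: nrm_vsum_le => N.
  have g2 : nrm g ^+ 2 <= 1 by rewrite exprn_ile1 ?nrm_ge0.
  apply: le_trans (lerD (hM N.*2) (le_trans (coord_ge g N) g2)).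
  have h0 := @sum_swap_le R (fun n => nrm (w_ n * (x_ n)%:C ^+ 0) ^+ 2) N (fun n => sqr_ge0 _).
  apply: le_trans (lerD h0 (lexx _)); rewrite -big_split; apply: ler_sum => n _ /=.
  rewrite nrmZ nrm_conj expr0 mulr1.
  have := sqr_ge0 (nrm (w_ (swap n)) - nrm (coord E n g)).
  have := sqr_ge0 (nrm (w_ (swap n))); have := sqr_ge0 (nrm (coord E n g)); nra.
have [/nrm_eq0 ->|f0] := eqVneq (nrm f) 0; first by rewrite linear0 !nrm0 mulr0.
have fp : 0 < nrm f by rewrite lt_neqAle eq_sym f0 nrm_ge0.
have := unit_bound ((nrm f)^-1%:C *: f).
rewrite linearZ /= !nrmZr gtr0_norm ?invr_gt0 // mulVf // => /(_ (lexx _)).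
by rewrite mulrC ler_pdivrMr.
Qed.

Lemma conj_i : Num.conj 'i%C = - 'i%C :> R[i].
Proof. by rewrite -[LHS]/(0 -i* 1) -[RHS]/(- 0 -i* 1) oppr0. Qed.

Lemma conj_real (r : R) : Num.conj r%:C = r%:C :> R[i].
Proof. by rewrite conj_Creal // realE !lecE /= eqxx /= le_total. Qed.

(** Conjugating the moments of a point mass at [-'i] gives powers of ['i]. *)
Lemma q_mono j v : q (mono j v) = 'i%C ^+ j *: v.
Proof.
have -> : 'i%C ^+ j = Num.conj (vsum (fun n => w_ (swap n) * Num.conj (w_ n) *
    (x_ n)%:C ^+ j : scalars R) : R[i]).
  by rewrite weight_moment rmorphXn /= rmorphN /= conj_i opprK.
rewrite -vsum_conj; last exact: weight_moment_asum.
rewrite -vsum_scalel.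
  congr vsum; apply/funext => n; rewrite coord_mono scalerA; congr (_ *: _).
  by rewrite !rmorphM /= conjCK rmorphXn /= conj_real mulrA.
have [M hM] := weight_moment_asum R j; exists M => N; apply: le_trans (hM N).
by apply: ler_sum => n _; rewrite nrm_conj.
Qed.

(** Both sides are ['i ^ j * (- 'i) ^ l] times the inner product of [u] and
    [v]: on the left as the twisted moment of order [j + l], with the sign
    [(-1) ^ j] from the reflection of the nodes. *)
Lemma inner_theta_mono j l u v :
  '<theta (mono j u), mono l v> = '<q (mono j u), q (mono l v)>.
Proof.
rewrite !q_mono innerZl innerZr coord_inner.
have -> : (fun n => '<coord E n (theta (mono j u)), coord E n (mono l v)> : scalars R) =
    (fun n => ((-1) ^+ j * '<u, v>) *: (w_ (swap n) * Num.conj (w_ n) *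
       (x_ n)%:C ^+ (j + l) : scalars R)).
  apply/funext => n; rewrite coord_theta !coord_mono node_swap innerZl innerZr.
  have -> : (- x_ n)%:C ^+ j = (-1) ^+ j * (x_ n)%:C ^+ j :> R[i].
    by rewrite -exprMn mulN1r rmorphN.
  rewrite rmorphM rmorphXn /= conj_real exprD.
  by rewrite -[RHS]/(_ * _); ring.
rewrite vsumZ; last exact: weight_moment_asum.
rewrite weight_moment -[LHS]/(_ * _) rmorphXn /= conj_i exprD.
have -> : 'i%C ^+ j = (-1) ^+ j * (- 'i%C) ^+ j :> R[i].
  by rewrite -exprMn mulN1r opprK.
ring.
Qed.

Lemma inner_theta_poly f g : poly_seq setT f -> poly_seq setT g ->
  '<theta f, g> = '<q f, q g>.
Proof.
move=> hf hg; elim: hf => [|j u f' _ _ ihf].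
  by rewrite (linear0 theta) (linear0 q) !inner0l.
rewrite (linearD q) (linearD theta) !innerDl ihf; congr (_ + _).
elim: hg => [|l v g' _ _ ihg].
  by rewrite (linear0 q) !inner0r.
by rewrite (linearD q) !innerDr ihg inner_theta_mono.
Qed.

Lemma theta_nrm f : nrm (theta f) = nrm f.
Proof. by have [iso _] := theta_unitary; exact: isometry_nrm. Qed.

(** Reflection positivity: the twisted form is the inner product of the images
    under [q]. Both forms are bounded, so that the identity extends from
    polynomial sequences to their closure. *)
Lemma inner_theta f g : plus f -> plus g -> '<theta f, g> = '<q f, q g>.
Proof.
have [C C0 qC] := q_bounded.
pose phi f g : R[i] := '<theta f, g> - '<q f, q g>.
have phi_le u v : nrm (phi u v) <= (1 + C ^+ 2) * (nrm u * nrm v).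
  apply: le_trans (nrmD _ _) _; rewrite nrmN mulrDl mul1r lerD //.
    by apply: le_trans (nrm_inner _ _) _; rewrite theta_nrm.
  apply: le_trans (nrm_inner _ _) _.
  apply: le_trans (ler_pM (nrm_ge0 _) (nrm_ge0 _) (qC u) (qC v)) _.
  by rewrite expr2 mulrACA.
have one f' : poly_seq setT f' -> forall g', plus g' -> phi f' g' = 0.
  move=> hf; apply: (lipschitz_closure_eq0 (C := (1 + C ^+ 2) * nrm f')) => [u v|u hu].
    rewrite -mulrA (_ : _ - _ = phi f' (u - v)) //.
    by rewrite /phi (linearB q) !innerBr; ring.
  by rewrite /phi inner_theta_poly // subrr.
move=> hf hg; apply/eqP; rewrite -subr_eq0 -/(phi f g); apply/eqP; move: f hf.
apply: (lipschitz_closure_eq0 (C := (1 + C ^+ 2) * nrm g)) => [u v|u hu]; last exact: one.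
rewrite -mulrA [nrm g * _]mulrC (_ : _ - _ = phi (u - v) g) //.
by rewrite /phi (linearB q) (linearB theta) !innerBl; ring.
Qed.

(** ** Generators *)

(** Near the origin this is differentiability of the orbit; elsewhere the three
    terms are bounded separately, the representation being isometric. The bound
    for all [s] dominates the difference quotients at all nodes at once. *)
Lemma gen_bound y v w : gen pic y v w ->
  exists C, forall s : R, nrm (pic (s *: y) v - v - s%:C *: w) <= C * `|s|.
Proof.
move=> /(_ 1 ltr01)/nbhs_ballP[d /= d0 hd].
exists (1 + 2 * nrm v / d + nrm w) => s.
have [sd|sd] := ltP `|s| d.
  have := hd s; rewrite -ball_normE /= sub0r normrN => /(_ sd) h.
  apply: le_trans h _; rewrite ler_wpM2r // -addrA lerDl addr_ge0 ?nrm_ge0 //.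
  by rewrite divr_ge0 ?mulr_ge0 ?nrm_ge0 // ltW.
apply: le_trans (nrmD _ _) _; rewrite nrmN nrmZr.
apply: le_trans (lerD (nrmD _ _) (lexx _)) _; rewrite nrmN (rep_nrm pic_rep).
have h : 2 * nrm v <= 2 * nrm v / d * `|s|.
  by rewrite -mulrA ler_peMr ?mulr_ge0 ?nrm_ge0 // mulrC ler_pdivlMr // mul1r.
rewrite !mulrDl mul1r; have := normr_ge0 s; lra.
Qed.

(** In the coordinate of the node [r] the one-parameter group along [y] runs
    with speed [r ^ k], which multiplies the generator by that power of the
    node. *)
Lemma gen_mono k y j v w :
  (forall r t : R, dilate r (t *: y) = (t * r ^+ k) *: y) ->
  gen pic y v w -> gen pi y (mono j v) (mono (j + k) w).
Proof.
move=> dil hg; have [C hC] := gen_bound hg.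
have C0 : 0 <= C by have := hC 1; rewrite normr1 mulr1; apply: le_trans; exact: nrm_ge0.
have [M hM] := weight_decay R (j + k).
have coordE n t : coord E n (orbit_quot pi y (mono j v) t) =
    (w_ n * (x_ n)%:C ^+ j) *: orbit_quot pic (x_ n ^+ k *: y) v t.
  rewrite /orbit_quot linearZ /= linearB /= coord_pi !coord_mono linearZ /=.
  by rewrite -scalerBr dil !scalerA mulrC.
have monoE n : coord E n (mono (j + k) w) =
    (w_ n * (x_ n)%:C ^+ j) *: ((x_ n ^+ k)%:C *: w).
  by rewrite coord_mono scalerA exprD mulrA rmorphXn.
apply/(genP pi_rep).
apply: (@l2_dominated_cvg R H E _ _ _ _ _
  (fun n => C * nrm (w_ n * (x_ n)%:C ^+ (j + k))) (C ^+ 2 * M)) => [N||n].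
- under eq_bigr do rewrite exprMn; rewrite -mulr_sumr.
  by rewrite ler_wpM2l ?exprn_ge0.
- near=> t; have t0 : t != 0 by near: t; exact: nbhs_dnbhs_neq.
  move=> n; rewrite coordE monoE -scalerBr nrmZ exprD mulrA.
  rewrite [nrm (_ * _ * _ ^+ k)]nrmM mulrCA.
  rewrite ler_wpM2l ?nrm_ge0 // -(rmorphXn (real_complex R)) nrm_real.
  have -> : orbit_quot pic (x_ n ^+ k *: y) v t - (x_ n ^+ k)%:C *: w =
      (t^-1)%:C *: (pic ((t * x_ n ^+ k) *: y) v - v - (t * x_ n ^+ k)%:C *: w).
    rewrite /orbit_quot [RHS]scalerBr !scalerA -rmorphM mulrA mulVf // mul1r.
    by [].
  rewrite nrmZr normrV ?unitfE // mulrC ler_pdivrMr ?normr_gt0 //.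
  by apply: le_trans (hC _) _; rewrite normrM -mulrA [`|t| * _]mulrC.
- under eq_fun do rewrite coordE; rewrite monoE.
  by apply: cvgZr; apply/(genP pic_rep)/gen_scale.
Unshelve. all: by end_near. Qed.

Lemma gen_monoP j v w : gen pic P v w -> gen pi P (mono j v) (mono j.+1 w).
Proof.
rewrite -addn1; apply: gen_mono => r t.
by apply: heis_eq; rewrite /dilate /P /basisP /coordP /coordQ /coordZ /= /GRing.scale /=; ring.
Qed.

Lemma gen_monoZ j v w : gen pic Z v w -> gen pi Z (mono j v) (mono j.+1 w).
Proof.
rewrite -addn1; apply: gen_mono => r t.
by apply: heis_eq; rewrite /dilate /Z /basisZ /coordP /coordQ /coordZ /= /GRing.scale /=; ring.
Qed.

Lemma gen_monoQ j v w : gen pic Q v w -> gen pi Q (mono j v) (mono j w).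
Proof.
rewrite -[j in mono j w]addn0; apply: gen_mono => r t.
by apply: heis_eq; rewrite /dilate /Q /basisQ /coordP /coordQ /coordZ /= /GRing.scale /=; ring.
Qed.

Definition poly_core : set E := poly_seq (generator_core pic).

(** The factor ['i] between [q (mono j.+1 v)] and [q (mono j v)] turns the
    generators of [pi] along [P] and [Z] into multiples of those of [pic]. *)
Lemma poly_core_gens f : poly_core f -> exists a b c, [/\ poly_core a, poly_core b & poly_core c] /\
  [/\ gen pi P f a, gen pi Q f b & gen pi Z f c] /\
  [/\ gen pic P (q f) (- 'i%C *: q a), gen pic Q (q f) (q b)
    & gen pic Z (q f) (- 'i%C *: q c)].
Proof.
elim=> [|j v f' hv _ [a [b [c [[ha hb hc] [[ga gb gc] [ga' gb' gc']]]]]]].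
  exists 0, 0, 0; rewrite (linear0 q) scaler0.
  by split; [split; exact: PolySeq0|split; split; exact: gen0].
have [x [y [z [[hx hy hz] [gx gy gz]]]]] := generator_core_inv pic_rep hv.
have qS w : - 'i%C *: q (mono j.+1 w) = q (mono j w).
  rewrite !q_mono scalerA exprS mulrA; congr (_ *: _).
  by rewrite mulNr -expr2 sqr_i opprK mul1r.
have qgen y0 w (g : gen pic y0 v w) : gen pic y0 (q (mono j v)) (q (mono j w)).
  rewrite !q_mono -[_ *: v]addr0 -[_ *: w]addr0.
  by apply: gen_lin => //; exact: gen0.
exists (mono j.+1 x + a), (mono j y + b), (mono j.+1 z + c); split.
  by split; apply: PolySeqD.
split; first by split; apply: genD => //; [exact: gen_monoP|exact: gen_monoQ|exact: gen_monoZ].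
rewrite !(linearD q) !scalerDr !qS.
by split; apply: genD => //; exact: qgen.
Qed.

Lemma poly_core_subspace : is_subspace poly_core.
Proof. exact/poly_seq_subspace/(generator_core_subspace pic). Qed.

Lemma poly_core_plus : poly_core `<=` plus.
Proof. by move=> f hf; apply: subset_closure; exact: poly_seq_sub hf. Qed.

Lemma poly_core_smooth : poly_core `<=` smooth_vectors pi.
Proof.
apply: (smooth_of_invariant pi_rep poly_core_subspace) => f.
by move=> /poly_core_gens[a [b [c [? [? _]]]]]; exists a, b, c.
Qed.

(** The coefficients of a polynomial sequence are approximated in the core of
    [pic]; the map [mono j] is bounded. *)
Lemma plus_poly_core : plus `<=` closure poly_core.
Proof.
rewrite ((closure_id (closure poly_core)).1 (@closed_closure _ _)).
apply: closure_subset => f.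
have [cl0 clD] := closure_subspace poly_core_subspace.
elim=> [|j v g _ _ ih]; first exact/set_mem.
rewrite -[mono j v]scale1r; apply/set_mem/clD; apply/mem_set => //.
apply/closure_nrmP => e e0; have [C C0 hC] := mono_bounded j.
have C1 : 0 < C + 1 by rewrite ltr_wpDl.
have [u hu uv] := generator_core_dense pic_rep v (divr_gt0 e0 C1).
exists (mono j u); first exact: poly_seq_mono.
rewrite -linearB; apply: le_trans (hC _) _.
apply: le_trans (_ : (C + 1) * nrm (u - v) <= _).
  by rewrite ler_wpM2r ?nrm_ge0 // lerDl.
by rewrite mulrC -ler_pdivlMr.
Qed.

Lemma pi_plus_eq h : fix_tau h -> pi h @` plus = plus.
Proof.
move=> hh; apply/seteqP; split=> [_ [f hf <-]|f hf]; first exact: pi_plus.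
exists (pi (- h) f); last exact: repKV pi_rep _ _.
by apply: pi_plus => //; exact: fix_tauN.
Qed.

Lemma antifix_tauE (x : heis R) : antifix_tau x -> x = heis_mk (coordP x) 0 (coordZ x).
Proof.
move=> hx; apply: heis_eq => //.
have : coordQ x = - coordQ x by exact: (congr1 (@coordQ R) hx).
rewrite -[coordQ (heis_mk _ _ _)]/(0 : R); lra.
Qed.

Lemma poly_core_inv x f : antifix_tau x -> poly_core f -> poly_core (dpi pi x f).
Proof.
move=> /antifix_tauE-> /poly_core_gens[a [b [c [[ha hb hc] [[ga gb gc] _]]]]].
rewrite (gen_dpi pi_rep (gen_comb pi_rep _ _ _ ga gb gc)).
rewrite scale0r addr0; apply: poly_seq_lin => //; first exact: generator_core_subspace.
rewrite -[_ *: c]addr0; apply: poly_seq_lin => //; last exact: PolySeq0.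
exact: generator_core_subspace.
Qed.

Lemma inner_theta_ge0 f : plus f -> 0 <= '<theta f, f>.
Proof. by move=> hf; rewrite inner_theta // inner_nrm lecR sqr_ge0. Qed.

Lemma q_surj v : exists2 f, plus f & q f = v.
Proof.
exists (mono 0 v); last by rewrite q_mono expr0 scale1r.
by apply/subset_closure/poly_seq_mono.
Qed.

Lemma q_core f : poly_core f -> generator_core pic (q f).
Proof.
have [core0 coreD] := generator_core_subspace pic.
elim=> [|j v g hv _ ih]; first by rewrite linear0; exact/set_mem.
by rewrite linearD q_mono; apply/set_mem/coreD; exact/mem_set.
Qed.

Lemma q_smooth f : poly_core f -> smooth_vectors pic (q f).
Proof.
move=> /q_core; apply: (smooth_of_invariant pic_rep (generator_core_subspace pic)).
exact: generator_core_inv.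
Qed.

(** The element [to_gc x] is [coordQ x] times [Q], plus ['i] times an element
    of the span of [P] and [Z]; both parts are combinations of the three generators. *)
Lemma dpi_q x f : poly_core f ->
  dpi pic x (q f) = q (dpi pi (re_part (to_gc x)) f) - 'i *: q (dpi pi (im_part (to_gc x)) f).
Proof.
move=> /poly_core_gens[a [b [c [_ [[ga gb gc] [ga' gb' gc']]]]]].
case: x => [[s r] t].
rewrite (gen_dpi pic_rep (gen_comb pic_rep s r t ga' gb' gc')).
have -> : re_part (to_gc ((s, r), t)) = heis_mk 0 r 0 by [].
have -> : im_part (to_gc ((s, r), t)) = heis_mk s 0 t by [].
rewrite !(gen_dpi pi_rep (gen_comb pi_rep _ _ _ ga gb gc)).
have qZ (d : R[i]) v : q (d *: v) = d *: q v by exact: linearZ.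
rewrite !scale0r !(addr0, add0r) (linearD q) !qZ -complexiE.
rewrite scalerDr opprD !scalerA !mulrN ![_ * 'i%C]mulrC !scaleNr addrA.
by congr (_ + _); rewrite addrC.
Qed.

(** On polynomial sequences both sides apply [pic h] to the coefficients;
    bounded maps then agree on the closure. *)
Lemma pic_q h f : fix_tau h -> plus f -> pic h (q f) = q (pi h f).
Proof.
move=> hh /closure_nrmP hf; apply/eqP; rewrite -subr_eq0; apply/eqP/nrm_eq0/eqP.
have [C C0 qC] := q_bounded.
rewrite eq_le nrm_ge0 andbT; apply/ler_addgt0Pr => e e0; rewrite add0r.
have C1 : 0 < 2 * C + 1 by rewrite ltr_wpDl // mulr_ge0.
have [g hg gf] := hf _ (divr_gt0 e0 C1).
have hqg : pic h (q g) = q (pi h g).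
  elim: hg {gf} => [|j v g' _ _ ih]; first by rewrite !linear0.
  by rewrite !(linearD, ih) pi_mono // !q_mono linearZ.
have -> : pic h (q f) - q (pi h f) = pic h (q (f - g)) - q (pi h (f - g)).
  by rewrite !linearB hqg /=; abel.
apply: le_trans (nrmD _ _) _; rewrite nrmN (rep_nrm pic_rep).
apply: le_trans (lerD (qC _) (qC _)) _; rewrite (rep_nrm pi_rep) -nrmN opprB.
have : nrm (g - f) * (2 * C + 1) <= e by rewrite -ler_pdivlMr.
by have := nrm_ge0 (g - f); lra.
Qed.

End Realization.

Theorem proposition5p21 (R : realType) (H : hilbert R)
    (pic : heis R -> {linear H -> H})
    (pic_rep : is_unitary_rep pic)
    (pic_pos : nonneg_generator pic (basisZ R)) :
  has_euclidean_realization pic.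
Proof.
pose E := @RPHilbert R (ell2 H) (@plus R H) (@theta R H)
  (closure_subspace (poly_seq_subspace (setT_subspace H))) (@closed_closure _ _)
  (@theta_unitary R H) (@thetaK R H) (@inner_theta_ge0 R H).
exists E, (pi pic_rep), (poly_core pic), H, (@q R H), pic; split.
- split=> /=.
  + exact: pi_rep.
  + exact: theta_pi.
  + exact: pi_plus_eq.
  + exact: poly_core_subspace.
  + by move=> f hf; split; [exact: poly_core_plus hf|exact: poly_core_smooth].
  + exact: plus_poly_core.
  + by move=> x hx f; exact: poly_core_inv.
- split=> /= [a u v _ _|u v hu hv|].
  + exact: (linearP (q H)).
  + exact: (esym (inner_theta hu hv)).
  + move=> A [v Av] _; have [f hf fv] := q_surj v.
    by exists v; split=> //; exists f.
- split=> /=.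
  + exact: pic_rep.
  + exact: q_smooth.
  + by move=> x v hv; exact: dpi_q.
  + by move=> h hh v hv; exact: pic_q.
- exists (mk_linear (fun (a : R[i]) (u v : H) => erefl (a *: u + v))).
  by split=> //; split=> [u v|w] //; exists w.
Qed.
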